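(* Let $k\ge 2$ be a fixed integer, let $R_1(x_1,y),\dots,R_k(x_k,y)$ be binary relations each of size at most $N$, and let $$\mathrm{OUT} = \{(a_1,\dots,a_k) \mid \exists b:\ (a_i,b)\in R_i \text{ for all } i\in\{1,\dots,k\}\}.$$ For all integers $\Delta_1,\Delta_2\ge 1$, the set $\mathrm{OUT}$ can be computed by an algorithm whose running time is in the order of $$N\cdot \Delta_1^{k-1} + |\mathrm{OUT}|\cdot \Delta_2 + M\left(\left(\frac{N}{\Delta_2}\right)^{\lceil k/2\rceil},\ \frac{N}{\Delta_1},\ \left(\frac{N}{\Delta_2}\right)^{\lfloor k/2\rfloor}\right),$$ where $M(U,V,W)$ denotes the time bound for multiplying a $U\times V$ matrix by a $V\times W$ matrix.
   Context: The set $\mathrm{OUT}$ is the result of the star query with projection $Q^{\star}_k(x_1,\dots,x_k) = R_1(x_1,y), R_2(x_2,y),\dots,R_k(x_k,y)$: all relations are joined on the variable $y$, then $y$ is projected out and duplicates are removed. Running times are measured in the uniform-cost RAM model, where data values and pointers to databases have constant size; complexity is data complexity, i.e. the query (in particular $k$) is fixed and constants may depend on it. It is assumed that all tuples that do not contribute to the join output have already been removed from the relations. $M(U,V,W) = O(UVW\beta^{\omega-3})$ with $\beta=\min\{U,V,W\}$, where $\omega$, $2\le\omega<3$, is any constant such that two $n\times n$ matrices can be multiplied in time $O(n^{\omega})$. *)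

(* Defs.v *)
(* Machine words are in Z, data values in nat, time bounds in R. *)
From Stdlib Require Import Reals ZArith Arith List.
Import ListNotations.

(** * Uniform-cost random access machine

    Programs are while-programs over finitely many registers and finitely many
    random-access arrays, with the arithmetic of the textbook RAM (addition,
    subtraction, multiplication, integer division, test for [> 0]).  Programs
    with jumps, or with one memory instead of several arrays, translate to
    this form and back with a constant-factor overhead. *)

Inductive binop := Add | Sub | Mul | Div.

Definition eval_op (o : binop) : Z -> Z -> Z :=
  match o with Add => Z.add | Sub => Z.sub | Mul => Z.mul | Div => Z.div end.

Inductive cmd :=
| Skip
| Const (r : nat) (z : Z)                (* r := z *)
| Op (r : nat) (o : binop) (r1 r2 : nat) (* r := r1 o r2 *)
| Get (r a ri : nat)                     (* r := a[ri] *)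
| Put (a ri r : nat)                     (* a[ri] := r *)
| Seq (c1 c2 : cmd)
| If (r : nat) (c1 c2 : cmd)            (* test r > 0 *)
| While (r : nat) (c : cmd).            (* test r > 0 *)

Record state := State {
  reg : nat -> Z;
  arr : nat -> nat -> Z
}.

Definition set_reg (s : state) (r : nat) (v : Z) : state :=
  State (fun r' => if Nat.eqb r' r then v else reg s r') (arr s).

Definition set_arr (s : state) (a p : nat) (v : Z) : state :=
  State (reg s)
    (fun a' p' => if (Nat.eqb a' a && Nat.eqb p' p)%bool then v else arr s a' p').

(** [exec w c s s' t]: started in [s], program [c] halts in [s'] after exactly
    [t] unit-cost instructions, and no constant or arithmetic result exceeds
    [w] in absolute value.  There is no rule for an arithmetic overflow of [w]
    nor for an access at a negative address: such runs are faults. *)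
Inductive exec (w : Z) : cmd -> state -> state -> nat -> Prop :=
| exec_skip s :
    exec w Skip s s 1
| exec_const s r z :
    (Z.abs z <= w)%Z ->
    exec w (Const r z) s (set_reg s r z) 1
| exec_op s r o r1 r2 v :
    v = eval_op o (reg s r1) (reg s r2) ->
    (Z.abs v <= w)%Z ->
    exec w (Op r o r1 r2) s (set_reg s r v) 1
| exec_get s r a ri p :
    reg s ri = Z.of_nat p ->
    exec w (Get r a ri) s (set_reg s r (arr s a p)) 1
| exec_put s a ri r p :
    reg s ri = Z.of_nat p ->
    exec w (Put a ri r) s (set_arr s a p (reg s r)) 1
| exec_seq c1 c2 s s1 s2 t1 t2 :
    exec w c1 s s1 t1 ->
    exec w c2 s1 s2 t2 ->
    exec w (Seq c1 c2) s s2 (t1 + t2)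
| exec_if_true r c1 c2 s s' t :
    (0 < reg s r)%Z ->
    exec w c1 s s' t ->
    exec w (If r c1 c2) s s' (S t)
| exec_if_false r c1 c2 s s' t :
    (reg s r <= 0)%Z ->
    exec w c2 s s' t ->
    exec w (If r c1 c2) s s' (S t)
| exec_while_true r c s s1 s2 t1 t2 :
    (0 < reg s r)%Z ->
    exec w c s s1 t1 ->
    exec w (While r c) s1 s2 t2 ->
    exec w (While r c) s s2 (S (t1 + t2))
| exec_while_false r c s :
    (reg s r <= 0)%Z ->
    exec w (While r c) s s 1.

Definition bounded (V : Z) (s : state) : Prop :=
  (forall r, (Z.abs (reg s r) <= V)%Z) /\
  (forall a p, (Z.abs (arr s a p) <= V)%Z).

(** Values and pointers have constant size: all numbers handled during a run
    are polynomial, with an exponent [e] fixed with the program, in the numbers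
    of the input (the sizes of the input objects being part of the input), so
    that each of them takes O(1) words.  Charging one unit for arithmetic on
    unbounded integers would allow packing a whole matrix row in one cell, and
    multiplying n x n matrices in about n^2 steps. *)
Definition runs (c : cmd) (e : nat) (s s' : state) (t : nat) : Prop :=
  forall V : Z, bounded V s -> exec ((V + 2) ^ Z.of_nat e)%Z c s s' t.

(** * Matrix multiplication *)

Definition mx_prod (n : nat) (A B : nat -> nat -> Z) (i j : nat) : Z :=
  fold_right Z.add 0%Z (map (fun l => (A i l * B l j)%Z) (seq 0 n)).

Definition row_major (n : nat) (A : nat -> nat -> Z) (p : nat) : Z :=
  if Nat.ltb p (n * n) then A (p / n)%nat (p mod n)%nat else 0%Z.

(* Register 0 holds n; arrays 0 and 1 hold the two matrices. *)
Definition mx_input (n : nat) (A B : nat -> nat -> Z) : state :=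
  State
    (fun r => match r with 0 => Z.of_nat n | _ => 0%Z end)
    (fun a => match a with
              | 0 => row_major n A
              | 1 => row_major n B
              | _ => fun _ => 0%Z
              end).

(* The product is returned in array 2. *)
Definition mx_output (n : nat) (P : nat -> nat -> Z) (s : state) : Prop :=
  forall i j, (i < n)%nat -> (j < n)%nat -> arr s 2 (i * n + j) = P i j.

(** Two n x n (integer) matrices can be multiplied in time O(n^omega). *)
Definition matmul_in_time (omega : R) : Prop :=
  exists (c : cmd) (e : nat) (C : R),
    forall (n : nat) (A B : nat -> nat -> Z), (1 <= n)%nat ->
      exists (s : state) (t : nat),
        runs c e (mx_input n A B) s t /\
        mx_output n (mx_prod n A B) s /\
        (INR t <= C * Rpower (INR n) omega)%R.

(** The bound U V W beta^(omega-3), beta = min(U,V,W), for the product of a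
    U x V matrix by a V x W matrix; the dimensions are positive reals. *)
Definition M (omega U V W : R) : R :=
  (U * V * W * Rpower (Rmin U (Rmin V W)) (omega - 3))%R.

(** * Star queries *)

(* A finite relation R(x, y) is listed, without repetition, in any order. *)
Definition binrel := list (nat * nat).

Definition in_join (Rs : list binrel) (a : list nat) (b : nat) : Prop :=
  Forall2 (fun x R => In (x, b) R) a Rs.

Definition star_out (Rs : list binrel) (a : list nat) : Prop :=
  exists b, in_join Rs a b.

Definition no_dangling (Rs : list binrel) : Prop :=
  forall (i : nat) (R : binrel) (x b : nat),
    nth_error Rs i = Some R -> In (x, b) R ->
    exists a, in_join Rs a b /\ nth_error a i = Some x.

Definition enumerates {T : Type} (L : list T) (P : T -> Prop) : Prop :=
  NoDup L /\ forall x, In x L <-> P x.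

(* Registers 0 and 1 hold the thresholds and register i+2 the size of the i-th
   relation (counting from 0), whose x- and y-columns are in arrays 2i and
   2i+1.  All other registers and cells are 0, by the defaults of [nth]. *)
Definition star_input (D1 D2 : nat) (Rs : list binrel) : state :=
  State
    (fun r => match r with
              | 0 => Z.of_nat D1
              | 1 => Z.of_nat D2
              | S (S i) => Z.of_nat (length (nth i Rs []))
              end)
    (fun a p => let '(x, y) := nth p (nth (a / 2) Rs []) (0%nat, 0%nat) in
                Z.of_nat (if Nat.even a then x else y)).

(* Register 0 returns the number of tuples, array j their j-th components. *)
Definition star_output (k : nat) (L : list (list nat)) (s : state) : Prop :=
  reg s 0 = Z.of_nat (length L) /\
  forall p j, (p < length L)%nat -> (j < k)%nat ->
    arr s j p = Z.of_nat (nth j (nth p L []) 0%nat).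

(* Main.v *)
(** Call a value of [x_j] light if it has at most [D2] partners in [R_j], and a
    value of [y] light if it has at most [D1] partners in every relation.
    Expand the join around every tuple [(x, y)] of every [R_j] with [x] or [y]
    light: an output tuple with a light [j]-th component is met at most [D2]
    times through it, and a light [y] contributes at most [D1 ^ (k - 1)] tuples
    for each [(x, y)].  An output tuple not met in this way has only heavy
    components and a heavy witness, and there are at most [N / D2] heavy values
    of each [x_j] and [k N / D1] heavy values of [y].  Such tuples are the
    positive entries of a product of two 0/1 matrices, with rows indexed by the
    heavy values of the first half of the [x_j], columns by those of the second
    half, and the heavy values of [y] in between.  The product is cut into
    square blocks whose side is the least of the three dimensions.

    Memory is initially blank and addresses are unbounded, so a dictionary is an
    array addressed by the key itself, a tuple being coded in a base [Q] that
    exceeds all numbers of the relations. *)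
From Pilot Require Import Defs.
From Stdlib Require Import Reals ZArith Arith List Lia Lra Bool Cantor.
Import Pilot.Defs.
Import ListNotations.
Open Scope nat_scope.

(** The cost model shapes the proof. [runs] asks for one final state and one time that serve every
    bound [V] on the input, with all numbers below a fixed power of [V + 2]. A run is therefore
    built for each [V], and determinism identifies these runs. Numbers are controlled through the
    base [Q], which is itself polynomial in [V]. The multiplication program is a black box that
    expects blank memory, and it is called once per block. The cells it dirties are not known in
    advance, so they are not erased: the memories of all calls are interleaved, which gives each
    call fresh cells for a constant slowdown. Its inputs are 0/1 matrices, so its numbers stay
    polynomial in the side of the block. Only square products are assumed. With blocks of side
    [beta], the least of the three dimensions, the number of blocks times [beta ^ 3] is at most 8
    times the product of the dimensions, which yields the exponent [omega - 3]. Replacing the actual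
    dimensions by their bounds needs a monotonicity of [M] that rests on [omega >= 2]. The bound [N]
    occurs in the analysis only; the program never receives it. *)

(** * Determinism of the machine and finite sums *)

(** The two thresholds may differ: they only decide which runs are faults. This is how runs obtained
    for different bounds [V] are identified. *)
Lemma exec_det w w' c s s1 t1 s2 t2 :
  exec w c s s1 t1 -> exec w' c s s2 t2 -> s1 = s2 /\ t1 = t2.
Proof.
  intros H; revert s2 t2.
  induction H; intros u2 v2 H2; inversion H2; subst; auto; try lia.
  - assert (p0 = p) by lia; subst; auto.
  - assert (p0 = p) by lia; subst; auto.
  - match goal with A : exec w' c1 _ _ _, C : exec w' c2 _ _ _ |- _ =>
      destruct (IHexec1 _ _ A) as [-> ->]; destruct (IHexec2 _ _ C) as [-> ->] end.
    auto.
  - match goal with A : exec w' c1 _ _ _ |- _ => destruct (IHexec _ _ A) as [-> ->] end.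
    auto.
  - match goal with A : exec w' c2 _ _ _ |- _ => destruct (IHexec _ _ A) as [-> ->] end.
    auto.
  - match goal with A : exec w' c _ _ _, C : exec w' (While r c) _ _ _ |- _ =>
      destruct (IHexec1 _ _ A) as [-> ->]; destruct (IHexec2 _ _ C) as [-> ->] end.
    auto.
Qed.

(** Constants and results are checked against [w], while [Get] and [Put] only move values that are
    already there. *)
Lemma exec_bounded w c s s' t :
  exec w c s s' t -> bounded w s -> bounded w s'.
Proof.
  intros H; induction H; auto; intros [Hr Ha]; split; intros; simpl; auto.
  - destruct (Nat.eqb _ _); auto.
  - destruct (Nat.eqb _ _); auto.
  - destruct (Nat.eqb _ _); auto.
  - destruct (_ && _)%bool; auto.
Qed.

Lemma exec_mono w w' c s s' t :
  exec w c s s' t -> (w <= w')%Z -> exec w' c s s' t.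
Proof. intros X L. induction X; econstructor; eauto; lia. Qed.

(** The list is reversed so that the last index is split off first, as [iter] does with its last
    command. *)
Definition sumn (f : nat -> nat) (n : nat) : nat :=
  fold_right (fun i s => s + f i) 0 (rev (seq 0 n)).

Lemma sumn_S f n : sumn f (S n) = sumn f n + f n.
Proof. unfold sumn. rewrite seq_S, rev_app_distr. reflexivity. Qed.

Lemma sumn_le f g n : (forall i, i < n -> f i <= g i) -> sumn f n <= sumn g n.
Proof.
  induction n; intros H; [auto|]. rewrite !sumn_S.
  assert (f n <= g n) by (apply H; lia).
  assert (sumn f n <= sumn g n) by (apply IHn; intros; apply H; lia). lia.
Qed.

Lemma sumn_const c n : sumn (fun _ => c) n = c * n.
Proof. induction n; [cbn; lia|]. rewrite sumn_S, IHn. lia. Qed.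

Lemma sumn_add f g n : sumn (fun i => f i + g i) n = sumn f n + sumn g n.
Proof. induction n; auto. rewrite !sumn_S, IHn. lia. Qed.

Lemma sumn_mul c f n : sumn (fun i => c * f i) n = c * sumn f n.
Proof. induction n; [cbn; lia|]. rewrite !sumn_S, IHn. lia. Qed.

(** * A layer of named variables, named arrays and compiled expressions *)

Inductive vname := VIn | VTmp | VBox | VQ | Vp | Vt | Vx | Vy | Vd | Vok | Vrem
 | Vcode | Vcnt | Vxs | Vrad | Vbase | Vtot | Vh | Vm | Vu | Vw | Vbeta
 | Vnv | Vnw | Vnb | VI | VL | VJ | Vent.

Definition vnum (v : vname) : nat :=
  match v with VIn => 0 | VTmp => 1 | VBox => 2 | VQ => 3 | Vp => 4 | Vt => 5
  | Vx => 6 | Vy => 7 | Vd => 8 | Vok => 9 | Vrem => 10 | Vcode => 11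
  | Vcnt => 12 | Vxs => 13 | Vrad => 14 | Vbase => 15 | Vtot => 16 | Vh => 17
  | Vm => 18 | Vu => 19 | Vw => 20 | Vbeta => 21 | Vnv => 22
  | Vnw => 23 | Vnb => 24 | VI => 25 | VL => 26 | VJ => 27 | Vent => 28 end.

(* [AIn] is the input.  For relation [i]: [ACnt[y]] counts the partners of [y],
   [AL[y * Q + d]] is the [d]-th of them, [ADx[x]] counts the partners of [x],
   [AAdj[x * Q + y]] tells whether [(x, y)] is a tuple, and [AHX] lists the heavy
   [x], marked in [AMkx].  [AHY] and [AMky] do the same for the heavy [y].
   [AOut] holds the output, [AVis] marks the codes of its tuples, and [ABox] is
   the memory of the matrix multiplication program. *)
Inductive aname := AIn | AL | ACnt | ADx | AAdj | AVis | AOut | AMkx | AHX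
 | AMky | AHY | ABox.

Definition anum (a : aname) : nat :=
  match a with AIn => 0 | AL => 1 | ACnt => 2 | ADx => 3 | AAdj => 4 | AVis => 5
  | AOut => 6 | AMkx => 7 | AHX => 8 | AMky => 9 | AHY => 10 | ABox => 11 end.

Definition veqb (v v' : vname) : bool := Nat.eqb (vnum v) (vnum v').
Definition aeqb (a a' : aname) : bool := Nat.eqb (anum a) (anum a').

Lemma veqb_spec v v' : reflect (v = v') (veqb v v').
Proof.
  apply iff_reflect; split; [intros ->; apply Nat.eqb_refl|].
  destruct v; destruct v'; (reflexivity || discriminate).
Qed.

Lemma aeqb_spec v v' : reflect (v = v') (aeqb v v').
Proof.
  apply iff_reflect; split; [intros ->; apply Nat.eqb_refl|].
  destruct v; destruct v'; (reflexivity || discriminate).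
Qed.

(** Each name stands for a family, indexed by numbers that are fixed in the program text, typically
    the number of a relation. Only positions inside an array are computed at run time. *)
Record hst := Hst {
  hv : vname -> nat -> Z;
  ha : aname -> nat -> nat -> Z
}.

Definition setv (h : hst) (v : vname) (i : nat) (x : Z) : hst :=
  Hst (fun v' i' => if (veqb v' v && Nat.eqb i' i)%bool then x else hv h v' i')
      (ha h).

Definition seta (h : hst) (a : aname) (i p : nat) (x : Z) : hst :=
  Hst (hv h)
      (fun a' i' p' => if (aeqb a' a && (Nat.eqb i' i && Nat.eqb p' p))%bool
                       then x else ha h a' i' p').

Inductive expr :=
| Cst (z : Z)
| Var (v : vname) (i : nat)
| Bin (o : binop) (e1 e2 : expr)
| Rd (a : aname) (i : nat) (e : expr).

Fixpoint eval (h : hst) (e : expr) : Z :=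
  match e with
  | Cst z => z
  | Var v i => hv h v i
  | Bin o e1 e2 => eval_op o (eval h e1) (eval h e2)
  | Rd a i e => ha h a i (Z.to_nat (eval h e))
  end.

Fixpoint esize (e : expr) : nat :=
  match e with
  | Cst _ => 1
  | Var _ _ => 1
  | Bin _ e1 e2 => S (esize e1 + esize e2)
  | Rd _ _ e => S (esize e)
  end.

(** A static time bound for loop-free code: a conditional is charged for both branches, and the
    value is meaningless in the presence of [While]. *)
Fixpoint csz (c : cmd) : nat :=
  match c with
  | Seq c1 c2 => csz c1 + csz c2
  | If _ c1 c2 => S (csz c1 + csz c2)
  | While _ _ => 0
  | _ => 1
  end.

Fixpoint iter (n : nat) (f : nat -> cmd) : cmd :=
  match n with 0 => Skip | S n => Seq (iter n f) (f n) end.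

Declare Scope expr_scope.
Delimit Scope expr_scope with e.
Bind Scope expr_scope with expr.
Coercion Cst : Z >-> expr.
Notation "a + b" := (Bin Add a b) : expr_scope.
Notation "a - b" := (Bin Sub a b) : expr_scope.
Notation "a * b" := (Bin Mul a b) : expr_scope.
Notation "a / b" := (Bin Div a b) : expr_scope.
Notation "c1 ;; c2" := (Seq c1 c2) (at level 90, right associativity).

Lemma Zdiv_abs_le a b : (Z.abs (a / b) <= Z.abs a)%Z.
Proof.
  destruct (Z.eq_dec b 0) as [->|Hb]; [rewrite Zdiv_0_r; lia|].
  assert (Hp : forall x y, (0 < y)%Z -> (Z.abs (x / y) <= Z.abs x)%Z).
  { intros x y Hy. pose proof (Z.div_mod x y ltac:(lia)).
    pose proof (Z.mod_pos_bound x y Hy). nia. }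
  destruct (Z_lt_dec 0 b); [auto|].
  rewrite <- (Z.opp_involutive b), <- (Z.opp_involutive a), Z.div_opp_opp by lia.
  rewrite Z.abs_opp. apply Hp. lia.
Qed.

Section Layer.

(* [k] is the number of relations, [w] the overflow threshold of the machine
   and [B] a bound for the contents of the named variables and arrays.  An
   expression of size [n] evaluates within [B ^ n] (lemma [eval_bound]); no
   expression of the program has size above 24. *)
Context (k : nat) (w B : Z).
Hypothesis HB2 : (2 <= B)%Z.
Hypothesis HBw : (B ^ 24 <= w)%Z.

(** [VTmp] and [VBox] are excluded because [rep] does not track them: they hold the scratch
    registers and the registers of the embedded program. [VIn] is cut off where the registers of the
    other names begin. *)
Definition okv (v : vname) (i : nat) : Prop :=
  match v with VIn => i < k + 2 | VTmp => False | VBox => False | _ => True end.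

Definition oka (a : aname) (i : nat) : Prop :=
  match a with AIn => i < 2 * k | _ => True end.

(* The input keeps its place; the other names are spread behind it. *)
Definition rg (v : vname) (i : nat) : nat :=
  match v with VIn => i | _ => k + 2 + Cantor.to_nat (vnum v, i) end.

Definition ar (a : aname) (i : nat) : nat :=
  match a with AIn => i | _ => 2 * k + Cantor.to_nat (anum a, i) end.

Lemma vnum_inj v v' : vnum v = vnum v' -> v = v'.
Proof.
  intros E. destruct (veqb_spec v v') as [|N]; auto.
  unfold veqb in *. pose proof (veqb_spec v v') as R. unfold veqb in R.
  rewrite E, Nat.eqb_refl in R. inversion R; auto.
Qed.

Lemma anum_inj v v' : anum v = anum v' -> v = v'.
Proof.
  intros E. pose proof (aeqb_spec v v') as R. unfold aeqb in R.
  rewrite E, Nat.eqb_refl in R. inversion R; auto.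
Qed.

Lemma to_nat_inj2 a b a' b' :
  Cantor.to_nat (a, b) = Cantor.to_nat (a', b') -> a = a' /\ b = b'.
Proof.
  intros E. assert (H : (a, b) = (a', b')).
  { rewrite <- (cancel_of_to (a, b)), E. apply cancel_of_to. }
  inversion H; auto.
Qed.

Lemma rg_inj v i v' i' :
  (v = VIn -> i < k + 2) -> (v' = VIn -> i' < k + 2) ->
  rg v i = rg v' i' -> v = v' /\ i = i'.
Proof.
  intros H1 H2 E.
  assert (G : forall v v' i i', (v = VIn -> i < k + 2) -> v = VIn -> v' <> VIn ->
               rg v i <> rg v' i').
  { clear. intros v v' i i' H -> N. specialize (H eq_refl).
    destruct v'; unfold rg; try congruence; lia. }
  destruct (veqb_spec v VIn) as [->|N1]; destruct (veqb_spec v' VIn) as [->|N2].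
  - auto.
  - exfalso; eapply (G VIn v'); eauto.
  - exfalso; eapply (G VIn v); eauto.
  - assert (E' : Cantor.to_nat (vnum v, i) = Cantor.to_nat (vnum v', i')).
    { destruct v; try congruence; destruct v'; try congruence; unfold rg in E; lia. }
    apply to_nat_inj2 in E'. destruct E' as [E1 E2].
    split; auto. apply vnum_inj; auto.
Qed.

Lemma ar_inj v i v' i' :
  oka v i -> oka v' i' -> ar v i = ar v' i' -> v = v' /\ i = i'.
Proof.
  intros H1 H2 E.
  assert (G : forall v v' i i', oka v i -> v = AIn -> v' <> AIn ->
               ar v i <> ar v' i').
  { clear. intros v v' i i' H -> N. simpl in H.
    destruct v'; unfold ar; try congruence; lia. }
  destruct (aeqb_spec v AIn) as [->|N1]; destruct (aeqb_spec v' AIn) as [->|N2].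
  - auto.
  - exfalso; eapply (G AIn v'); eauto.
  - exfalso; eapply (G AIn v); eauto.
  - assert (E' : Cantor.to_nat (anum v, i) = Cantor.to_nat (anum v', i')).
    { destruct v; try congruence; destruct v'; try congruence; unfold ar in E; lia. }
    apply to_nat_inj2 in E'. destruct E' as [E1 E2].
    split; auto. apply anum_inj; auto.
Qed.

Lemma okv_VIn v i : okv v i -> v = VIn -> i < k + 2.
Proof. intros H ->. exact H. Qed.

Definition tmp (d : nat) : nat := rg VTmp d.

Lemma tmp_inj d d' : tmp d = tmp d' -> d = d'.
Proof. unfold tmp. intros E. apply rg_inj in E; [tauto| discriminate| discriminate]. Qed.

Lemma rg_tmp v i d : okv v i -> rg v i <> tmp d.
Proof.
  unfold tmp. intros H E. apply rg_inj in E; [|exact (okv_VIn v i H)|discriminate].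
  destruct E as [-> _]. exact H.
Qed.

Definition hbnd (h : hst) : Prop :=
  (forall v i, (Z.abs (hv h v i) <= B)%Z) /\
  (forall a i p, (Z.abs (ha h a i p) <= B)%Z).

Definition rep (h : hst) (s : state) : Prop :=
  (forall v i, okv v i -> reg s (rg v i) = hv h v i) /\
  (forall a i p, oka a i -> arr s (ar a i) p = ha h a i p) /\
  hbnd h.

(** The registers [tmp d], [tmp (S d)], and so on form an evaluation stack. The machine has no move
    instruction, so a variable is copied by adding zero. *)
Fixpoint comp (e : expr) (d : nat) : cmd :=
  match e with
  | Cst z => Const (tmp d) z
  | Var v i => Const (tmp d) 0 ;; Op (tmp d) Add (rg v i) (tmp d)
  | Bin o e1 e2 => comp e1 d ;; comp e2 (S d) ;; Op (tmp d) o (tmp d) (tmp (S d))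
  | Rd a i e => comp e d ;; Get (tmp d) (ar a i) (tmp d)
  end.

Fixpoint safe (h : hst) (e : expr) : Prop :=
  match e with
  | Cst z => (Z.abs z <= B)%Z
  | Var v i => okv v i
  | Bin _ e1 e2 => safe h e1 /\ safe h e2
  | Rd a i e => oka a i /\ safe h e /\ (0 <= eval h e)%Z
  end.

Lemma pow_ge1 n : (1 <= B ^ Z.of_nat n)%Z.
Proof. pose proof (Z.pow_pos_nonneg B (Z.of_nat n) ltac:(lia) ltac:(lia)). lia. Qed.

(** Every operator pays for one more factor [B]: for [P1, P2 >= 1] a sum is at most [2 * P1 * P2],
    and [2 <= B]. A read returns a stored value, which is at most [B]. *)
Lemma eval_bound h e :
  hbnd h -> safe h e -> (Z.abs (eval h e) <= B ^ Z.of_nat (esize e))%Z.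
Proof.
  intros [Hv Ha]. induction e; cbn [eval esize safe]; intros S.
  - change (Z.of_nat 1) with 1%Z. rewrite Z.pow_1_r. auto.
  - change (Z.of_nat 1) with 1%Z. rewrite Z.pow_1_r. auto.
  - destruct S as [S1 S2]. specialize (IHe1 S1). specialize (IHe2 S2).
    rewrite Nat2Z.inj_succ, Z.pow_succ_r, Nat2Z.inj_add, Z.pow_add_r by lia.
    pose proof (pow_ge1 (esize e1)). pose proof (pow_ge1 (esize e2)).
    set (P1 := (B ^ Z.of_nat (esize e1))%Z) in *.
    set (P2 := (B ^ Z.of_nat (esize e2))%Z) in *.
    assert (P1 + P2 <= 2 * (P1 * P2))%Z by nia.
    assert (2 * (P1 * P2) <= B * (P1 * P2))%Z by nia.
    destruct o; cbn [eval_op].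
    + lia.
    + lia.
    + rewrite Z.abs_mul. nia.
    + pose proof (Zdiv_abs_le (eval h e1) (eval h e2)). nia.
  - pose proof (pow_ge1 (esize e)).
    rewrite Nat2Z.inj_succ, Z.pow_succ_r by lia.
    specialize (Ha a i (Z.to_nat (eval h e))). nia.
Qed.

Lemma B_le_w : (B <= w)%Z.
Proof.
  etransitivity; [|exact HBw]. rewrite <- (Z.pow_1_r B) at 1.
  apply Z.pow_le_mono_r; lia.
Qed.

Lemma eval_bound_w h e :
  hbnd h -> safe h e -> esize e <= 24 -> (Z.abs (eval h e) <= w)%Z.
Proof.
  intros Hb S L. pose proof (eval_bound h e Hb S).
  assert (B ^ Z.of_nat (esize e) <= B ^ 24)%Z by (apply Z.pow_le_mono_r; lia).
  lia.
Qed.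

Definition pres_below (d : nat) (s s' : state) : Prop :=
  (forall r, (forall d', d <= d' -> r <> tmp d') -> reg s' r = reg s r) /\
  (forall a p, arr s' a p = arr s a p).

Lemma pres_below_rep d h s s' : rep h s -> pres_below d s s' -> rep h s'.
Proof.
  intros (H1 & H2 & H3) (P1 & P2). split; [|split]; auto.
  - intros v i O. rewrite P1; auto. intros d' _. apply rg_tmp; auto.
  - intros. rewrite P2; auto.
Qed.

Lemma reg_set_same s r v : reg (set_reg s r v) r = v.
Proof. simpl. now rewrite Nat.eqb_refl. Qed.

Lemma reg_set_other s r r' v : r' <> r -> reg (set_reg s r v) r' = reg s r'.
Proof. intros N. simpl. apply Nat.eqb_neq in N. now rewrite N. Qed.

Lemma pres_below_set d s v : pres_below d s (set_reg s (tmp d) v).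
Proof.
  split; auto. intros r H. apply reg_set_other. apply H; lia.
Qed.

Lemma pres_below_trans d d' s1 s2 s3 :
  d <= d' -> pres_below d s1 s2 -> pres_below d' s2 s3 -> pres_below d s1 s3.
Proof.
  intros L [A1 A2] [B1 B2]. split.
  - intros r H. rewrite B1, A1; auto. intros; apply H; lia.
  - intros. rewrite B2, A2; auto.
Qed.

Lemma comp_correct h e : forall d s,
  rep h s -> safe h e -> esize e <= 24 ->
  exists s', exec w (comp e d) s s' (csz (comp e d)) /\
    reg s' (tmp d) = eval h e /\ pres_below d s s'.
Proof.
  pose proof B_le_w as HBw1.
  induction e; intros d s Hr Hs He; cbn [comp csz eval] in *.
  - eexists; split; [apply exec_const; simpl in Hs; lia|].
    split; [apply reg_set_same|apply pres_below_set].
  - simpl in Hs. pose proof (rg_tmp v i d Hs) as N.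
    destruct Hr as (H1 & H2 & H3).
    eexists; split; [|split].
    + eapply exec_seq; [apply exec_const; lia|].
      apply exec_op; [reflexivity|]. cbn [eval_op].
      rewrite reg_set_same, reg_set_other by auto. rewrite Z.add_0_r, H1 by auto.
      destruct H3 as [H3 _]. specialize (H3 v i). lia.
    + rewrite reg_set_same. cbn [eval_op].
      rewrite reg_set_same, reg_set_other by auto. rewrite Z.add_0_r, H1; auto.
    + eapply pres_below_trans; [|apply pres_below_set|apply pres_below_set]; auto.
  - destruct Hs as [S1 S2]. cbn [esize] in He.
    destruct (IHe1 d s Hr S1 ltac:(lia)) as (s1 & X1 & R1 & P1).
    pose proof (pres_below_rep _ _ _ _ Hr P1) as Hr1.
    destruct (IHe2 (S d) s1 Hr1 S2 ltac:(lia)) as (s2 & X2 & R2 & P2).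
    assert (R1' : reg s2 (tmp d) = eval h e1).
    { rewrite (proj1 P2); auto. intros d' L E. apply tmp_inj in E. lia. }
    eexists; split; [|split].
    + eapply exec_seq; [exact X1|]. eapply exec_seq; [exact X2|].
      apply exec_op; [reflexivity|]. rewrite R1', R2.
      change (Z.abs (eval h (Bin o e1 e2)) <= w)%Z.
      apply eval_bound_w; [apply Hr|split; auto|]. cbn [esize]; lia.
    + rewrite reg_set_same, R1', R2. reflexivity.
    + eapply pres_below_trans; [|eapply pres_below_trans; [|exact P1|exact P2]|apply pres_below_set]; auto.
  - destruct Hs as (O & Hs & P0). cbn [esize] in He.
    destruct (IHe d s Hr Hs ltac:(lia)) as (s1 & X1 & R1 & P1).
    pose proof (pres_below_rep _ _ _ _ Hr P1) as (Q1 & Q2 & Q3).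
    eexists; split; [|split].
    + eapply exec_seq; [exact X1|].
      eapply exec_get. rewrite R1. symmetry. apply Z2Nat.id. exact P0.
    + rewrite reg_set_same. rewrite Q2; auto.
    + eapply pres_below_trans; [|exact P1|apply pres_below_set]; auto.
Qed.

Definition assign (v : vname) (i : nat) (e : expr) : cmd :=
  comp e 0 ;; Const (tmp 1) 0 ;; Op (rg v i) Add (tmp 0) (tmp 1).

Definition store (a : aname) (i : nat) (e1 e2 : expr) : cmd :=
  comp e1 0 ;; comp e2 1 ;; Put (ar a i) (tmp 0) (tmp 1).

Definition ifp (e : expr) (c1 c2 : cmd) : cmd := comp e 0 ;; If (tmp 0) c1 c2.

Definition for_init (v : vname) (e : expr) : cmd :=
  assign v 0 0%Z ;; comp (e - Var v 0)%e 0.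

Definition for_next (v : vname) (e : expr) : cmd :=
  assign v 0 (Var v 0 + 1%Z)%e ;; comp (e - Var v 0)%e 0.

(** The test of the [While] sits in the scratch register [tmp 0], which the body overwrites; it is
    recomputed at the end of each round. *)
Definition for_loop (v : vname) (e : expr) (c : cmd) : cmd :=
  for_init v e ;; While (tmp 0) (c ;; for_next v e).

(** A weakest precondition for total correctness with a time bound. The initial state comes last, so
    that the precondition of a second command can serve as the postcondition of the first. *)
Definition hwp (c : cmd) (T : nat) (Q : hst -> Prop) (h : hst) : Prop :=
  hbnd h -> forall s, rep h s -> exists s' h' t,
    exec w c s s' t /\ rep h' s' /\ t <= T /\ Q h'.

Definition hsl (c : cmd) (Q : hst -> Prop) (h : hst) : Prop := hwp c (csz c) Q h.

Lemma hwp_mono c T T' (Q Q' : hst -> Prop) h :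
  hwp c T Q h -> T <= T' -> (forall h', hbnd h' -> Q h' -> Q' h') -> hwp c T' Q' h.
Proof.
  clear HB2 HBw.
  intros H L I Hb s R. destruct (H Hb s R) as (s' & h' & t & X & R' & Lt & HQ).
  exists s', h', t. repeat split; auto; try apply R'. lia. apply I; auto. apply R'.
Qed.

Lemma hsl_mono c (Q Q' : hst -> Prop) h :
  hsl c Q h -> (forall h', hbnd h' -> Q h' -> Q' h') -> hsl c Q' h.
Proof. clear HB2 HBw. intros H I. eapply hwp_mono; [exact H|auto|auto]. Qed.

Lemma hwp_skip T (Q : hst -> Prop) h : 1 <= T -> Q h -> hwp Skip T Q h.
Proof.
  intros L H Hb s R. exists s, h, 1. split; [constructor|]. auto.
Qed.

Lemma hsl_skip (Q : hst -> Prop) h : Q h -> hsl Skip Q h.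
Proof. apply hwp_skip. auto. Qed.

Lemma hwp_seq c1 c2 T1 T2 T Q h :
  hwp c1 T1 (hwp c2 T2 Q) h -> T1 + T2 <= T -> hwp (c1 ;; c2) T Q h.
Proof.
  clear HB2 HBw.
  intros H L Hb s R. destruct (H Hb s R) as (s1 & h1 & t1 & X1 & R1 & L1 & H1).
  destruct (H1 ltac:(apply R1) s1 R1) as (s2 & h2 & t2 & X2 & R2 & L2 & H2).
  exists s2, h2, (t1 + t2). split; [eapply exec_seq; eauto|].
  repeat split; auto; try apply R2. lia.
Qed.

Lemma hsl_seq c1 c2 Q h : hsl c1 (hsl c2 Q) h -> hsl (c1 ;; c2) Q h.
Proof. intros H. eapply hwp_seq; [exact H|]. auto. Qed.

Lemma hbnd_setv h v i x : hbnd h -> (Z.abs x <= B)%Z -> hbnd (setv h v i x).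
Proof.
  intros [H1 H2] L. split; intros; cbn [setv hv ha]; auto.
  destruct (_ && _)%bool; auto.
Qed.

Lemma hbnd_seta h a i p x : hbnd h -> (Z.abs x <= B)%Z -> hbnd (seta h a i p x).
Proof.
  intros [H1 H2] L. split; intros; cbn [seta hv ha]; auto.
  destruct (_ && _)%bool; auto.
Qed.

Lemma hsl_assign v i e (Q : hst -> Prop) h :
  okv v i -> safe h e -> esize e <= 24 ->
  (hbnd h -> (Z.abs (eval h e) <= B)%Z) ->
  Q (setv h v i (eval h e)) ->
  hsl (assign v i e) Q h.
Proof.
  intros O S E Lb HQ Hb s R. specialize (Lb Hb). pose proof B_le_w as HBw1.
  destruct (comp_correct h e 0 s R S E) as (s1 & X1 & R1 & P1).
  pose proof (pres_below_rep _ _ _ _ R P1) as (Q1 & Q2 & Q3).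
  assert (N01 : tmp 0 <> tmp 1) by (intros E1; apply tmp_inj in E1; lia).
  assert (V : eval_op Add (reg (set_reg s1 (tmp 1) 0) (tmp 0))
                (reg (set_reg s1 (tmp 1) 0) (tmp 1)) = eval h e).
  { cbn [eval_op]. rewrite reg_set_same, reg_set_other, R1 by auto. lia. }
  eexists _, (setv h v i (eval h e)), _.
  split; [eapply exec_seq; [exact X1|]; eapply exec_seq|].
  { apply exec_const; lia. }
  { apply exec_op; [reflexivity|]. rewrite V. lia. }
  rewrite V. split; [|split; auto].
  split; [|split; [|apply hbnd_setv; auto]].
  - intros v' i' O'. cbn [setv hv].
    destruct (veqb_spec v' v) as [->|N]; cbn [andb].
    + destruct (Nat.eqb_spec i' i) as [->|N].
      * apply reg_set_same.
      * rewrite reg_set_other, reg_set_other; [apply Q1; auto| |].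
        { apply rg_tmp; auto. }
        { intros E'. apply rg_inj in E'; try (apply okv_VIn; auto). tauto. }
    + rewrite reg_set_other, reg_set_other; [apply Q1; auto| |].
      { apply rg_tmp; auto. }
      { intros E'. apply rg_inj in E'; try (apply okv_VIn; auto). tauto. }
  - intros a j p O'. simpl. apply Q2; auto.
Qed.

Lemma hsl_store a i e1 e2 (Q : hst -> Prop) h :
  oka a i -> safe h e1 -> safe h e2 -> esize e1 <= 24 -> esize e2 <= 24 ->
  (hbnd h -> (0 <= eval h e1)%Z) ->
  (hbnd h -> (Z.abs (eval h e2) <= B)%Z) ->
  Q (seta h a i (Z.to_nat (eval h e1)) (eval h e2)) ->
  hsl (store a i e1 e2) Q h.
Proof.
  intros O S1 S2 E1 E2 L0 Lb HQ Hb s R. specialize (Lb Hb). specialize (L0 Hb).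
  destruct (comp_correct h e1 0 s R S1 E1) as (s1 & X1 & R1 & P1).
  pose proof (pres_below_rep _ _ _ _ R P1) as Rs1.
  destruct (comp_correct h e2 1 s1 Rs1 S2 E2) as (s2 & X2 & R2 & P2).
  pose proof (pres_below_rep _ _ _ _ Rs1 P2) as (Q1 & Q2 & Q3).
  assert (R1' : reg s2 (tmp 0) = eval h e1).
  { rewrite (proj1 P2); auto. intros d' L E. apply tmp_inj in E. lia. }
  eexists _, (seta h a i (Z.to_nat (eval h e1)) (eval h e2)), _.
  split; [eapply exec_seq; [exact X1|]; eapply exec_seq; [exact X2|]|].
  { eapply exec_put. rewrite R1'. symmetry. apply Z2Nat.id; auto. }
  split; [|split; auto]. split; [|split; [|apply hbnd_seta; auto]].
  - intros v' i' O'. apply Q1; auto.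
  - intros a' i' p' O'. cbn [seta ha set_arr arr].
    destruct (aeqb_spec a' a) as [->|N]; cbn [andb].
    + destruct (Nat.eqb_spec i' i) as [->|N].
      * rewrite Nat.eqb_refl. cbn [andb]. destruct (Nat.eqb _ _); auto.
      * destruct (Nat.eqb_spec (ar a i') (ar a i)) as [E'|_].
        { apply ar_inj in E'; auto. tauto. }
        cbn [andb]. auto.
    + destruct (Nat.eqb_spec (ar a' i') (ar a i)) as [E'|_].
      { apply ar_inj in E'; auto. tauto. }
      cbn [andb]. auto.
Qed.

Lemma hwp_if e c1 c2 T T1 T2 (Q : hst -> Prop) h :
  safe h e -> esize e <= 24 ->
  ((0 < eval h e)%Z -> hwp c1 T1 Q h) ->
  ((eval h e <= 0)%Z -> hwp c2 T2 Q h) ->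
  ((0 < eval h e)%Z -> csz (comp e 0) + S T1 <= T) ->
  ((eval h e <= 0)%Z -> csz (comp e 0) + S T2 <= T) ->
  hwp (ifp e c1 c2) T Q h.
Proof.
  intros Sf E H1 H2 L1 L2 Hb s R.
  destruct (comp_correct h e 0 s R Sf E) as (s1 & X1 & R1 & P1).
  pose proof (pres_below_rep _ _ _ _ R P1) as Rs1.
  destruct (Z_lt_le_dec 0 (eval h e)) as [P|P].
  - destruct (H1 P Hb s1 Rs1) as (s' & h' & t & X & R' & Lt & HQ).
    exists s', h', (csz (comp e 0) + S t). split; [|split; [auto|split; auto]].
    + eapply exec_seq; [exact X1|]. apply exec_if_true; auto. rewrite R1; auto.
    + specialize (L1 P). lia.
  - destruct (H2 P Hb s1 Rs1) as (s' & h' & t & X & R' & Lt & HQ).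
    exists s', h', (csz (comp e 0) + S t). split; [|split; [auto|split; auto]].
    + eapply exec_seq; [exact X1|]. apply exec_if_false; auto. rewrite R1; auto.
    + specialize (L2 P). lia.
Qed.

Lemma hsl_if e c1 c2 (Q : hst -> Prop) h :
  safe h e -> esize e <= 24 ->
  ((0 < eval h e)%Z -> hsl c1 Q h) ->
  ((eval h e <= 0)%Z -> hsl c2 Q h) ->
  hsl (ifp e c1 c2) Q h.
Proof.
  intros S E H1 H2. eapply hwp_if; eauto; cbn [ifp csz]; lia.
Qed.

Lemma hwp_iter f T I : forall n h,
  I 0 h ->
  (forall j h', j < n -> I j h' -> hwp (f j) (T j) (I (S j)) h') ->
  hwp (iter n f) (S (sumn T n)) (I n) h.
Proof.
  clear HB2 HBw.
  induction n; intros h H0 HS; cbn [iter].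
  - apply hwp_skip; auto.
  - eapply hwp_seq; [eapply hwp_mono; [apply IHn; auto|reflexivity|]|].
    + intros h1 _ H1. apply HS; [lia|exact H1].
    + rewrite sumn_S. lia.
Qed.

Lemma hsl_iter f I : forall n h,
  I 0 h ->
  (forall j h', j < n -> I j h' -> hsl (f j) (I (S j)) h') ->
  hsl (iter n f) (I n) h.
Proof.
  induction n; intros h H0 HS; cbn [iter].
  - apply hsl_skip; auto.
  - apply hsl_seq. eapply hsl_mono; [apply IHn; auto|].
    intros h1 _ H1. apply HS; [lia|exact H1].
Qed.

(** The invariant speaks of the state in which the counter is already set to [i]. The limit 20 on
    the size of [e] leaves room for the test [e - Var v 0] under the general limit 24. *)
Lemma hwp_for v e c n T (I : nat -> hst -> Prop) h :
  esize e <= 20 -> okv v 0 -> (Z.of_nat n <= B)%Z ->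
  safe (setv h v 0 0) e ->
  I 0 (setv h v 0 0) ->
  (forall i h', i <= n -> hbnd h' -> I i h' ->
     safe h' e /\ eval h' e = Z.of_nat n /\ hv h' v 0 = Z.of_nat i) ->
  (forall i h', i < n -> hbnd h' -> I i h' ->
     hwp c (T i) (fun h2 => hv h2 v 0 = Z.of_nat i /\
                            safe (setv h2 v 0 (Z.of_nat (S i))) e /\
                            I (S i) (setv h2 v 0 (Z.of_nat (S i)))) h') ->
  hwp (for_loop v e c)
      (csz (for_init v e) + 1 + sumn (fun i => T i + (csz (for_next v e) + 1)) n)
      (I n) h.
Proof.
  intros Es Ov Ln S0 I0 HI HS.
  assert (G : forall j i h1 s1, n = i + j -> I i h1 -> rep h1 s1 ->
      reg s1 (tmp 0) = (Z.of_nat n - Z.of_nat i)%Z ->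
      exists s' h' t, exec w (While (tmp 0) (c ;; for_next v e)) s1 s' t /\
        rep h' s' /\
        t + sumn (fun i => T i + (csz (for_next v e) + 1)) i <=
          1 + sumn (fun i => T i + (csz (for_next v e) + 1)) n /\ I n h').
  { induction j; intros i h1 s1 En Ii R1 E1.
    - exists s1, h1, 1. replace i with n in * by lia.
      split; [apply exec_while_false; lia|]. repeat split; try apply R1; auto.
    - destruct (HS i h1 ltac:(lia) ltac:(apply R1) Ii ltac:(apply R1) s1 R1)
        as (s2 & h2 & t2 & X2 & R2 & L2 & V2 & S2 & I2).
      pose proof (HI (S i) _ ltac:(lia)
        (hbnd_setv h2 v 0 (Z.of_nat (S i)) ltac:(apply R2) ltac:(lia)) I2)
        as (_ & E2 & V3).
      assert (Ha : hsl (assign v 0 (Var v 0 + 1%Z)%e)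
          (fun h3 => h3 = setv h2 v 0 (Z.of_nat (S i))) h2).
      { apply hsl_assign; auto.
        - cbn [safe]. split; auto. rewrite Z.abs_eq; lia.
        - cbn; lia.
        - intros _. cbn [eval eval_op]. rewrite V2, Z.abs_eq; lia.
        - cbn [eval eval_op]. rewrite V2. f_equal. lia. }
      destruct (Ha ltac:(apply R2) s2 R2) as (s3 & h3 & t3 & X3 & R3 & L3 & ->).
      destruct (comp_correct _ (e - Var v 0)%e 0 s3 R3) as (s4 & X4 & E4 & P4).
      { split; auto. }
      { cbn [esize]; lia. }
      pose proof (pres_below_rep _ _ _ _ R3 P4) as R4.
      destruct (IHj (S i) _ s4 ltac:(lia) I2 R4) as (s5 & h5 & t5 & X5 & R5 & L5 & I5).
      { rewrite E4. cbn [eval eval_op]. rewrite E2, V3. reflexivity. }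
      exists s5, h5. eexists. split; [|split; [exact R5|split; [|exact I5]]].
      + eapply exec_while_true; [lia| |exact X5].
        eapply exec_seq; [exact X2|]. eapply exec_seq; eauto.
      + rewrite sumn_S in L5. unfold for_next in *. cbn [csz] in *. lia. }
  intros Hb s R.
  assert (Ha : hsl (assign v 0 0%Z) (fun h3 => h3 = setv h v 0 0%Z) h).
  { apply hsl_assign; auto.
    - cbn; lia.
    - cbn; lia.
    - intros _. cbn. lia. }
  destruct (Ha Hb s R) as (s3 & h3 & t3 & X3 & R3 & L3 & ->).
  destruct (comp_correct _ (e - Var v 0)%e 0 s3 R3) as (s4 & X4 & E4 & P4).
  { split; auto. }
  { cbn [esize]; lia. }
  pose proof (pres_below_rep _ _ _ _ R3 P4) as R4.
  destruct (HI 0 _ ltac:(lia) ltac:(apply R4) I0) as (_ & E0 & V0).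
  destruct (G n 0 _ s4 eq_refl I0 R4) as (s5 & h5 & t5 & X5 & R5 & L5 & I5).
  { rewrite E4. cbn [eval eval_op]. rewrite E0, V0. reflexivity. }
  exists s5, h5. eexists. split; [|split; [exact R5|split; [|exact I5]]].
  - eapply exec_seq; [eapply exec_seq; eauto|exact X5].
  - change (sumn _ 0) with 0 in L5. unfold for_init in *. cbn [csz] in *. lia.
Qed.

(** * Embedding a program in the host machine *)

Fixpoint nreg (c : cmd) : nat :=
  match c with
  | Skip => 0
  | Const r _ => S r
  | Op r _ r1 r2 => S (Nat.max r (Nat.max r1 r2))
  | Get r _ ri => S (Nat.max r ri)
  | Put _ ri r => S (Nat.max r ri)
  | Seq c1 c2 => Nat.max (nreg c1) (nreg c2)
  | If r c1 c2 => S (Nat.max r (Nat.max (nreg c1) (nreg c2)))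
  | While r c => S (Nat.max r (nreg c))
  end.

Definition br (r : nat) : nat := rg VBox r.

(* Cell [p] of the embedded program in its [m]-th call out of [K] is the cell
   [p * K + m] of the host, so that every call starts from blank memory. *)
Fixpoint lift (c : cmd) : cmd :=
  match c with
  | Skip => Skip
  | Const r z => Const (br r) z
  | Op r o r1 r2 => Op (br r) o (br r1) (br r2)
  | Get r a ri =>
      Op (tmp 0) Mul (br ri) (rg Vnb 0) ;; Op (tmp 0) Add (tmp 0) (rg Vp 0) ;;
      Get (br r) (ar ABox a) (tmp 0)
  | Put a ri r =>
      Op (tmp 0) Mul (br ri) (rg Vnb 0) ;; Op (tmp 0) Add (tmp 0) (rg Vp 0) ;;
      Put (ar ABox a) (tmp 0) (br r)
  | Seq c1 c2 => Seq (lift c1) (lift c2)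
  | If r c1 c2 => If (br r) (lift c1) (lift c2)
  | While r c => While (br r) (lift c)
  end.

Definition boxrel (n K m : nat) (s g : state) : Prop :=
  (forall r, r < n -> reg g (br r) = reg s r) /\
  (forall a p, arr g (ar ABox a) (p * K + m) = arr s a p).

Definition boxframe (K m : nat) (g g' : state) : Prop :=
  (forall r, (forall r', r <> br r') -> r <> tmp 0 -> reg g' r = reg g r) /\
  (forall a p, (forall a' p', ~ (a = ar ABox a' /\ p = p' * K + m)) ->
     arr g' a p = arr g a p).

Lemma boxframe_trans K m g1 g2 g3 :
  boxframe K m g1 g2 -> boxframe K m g2 g3 -> boxframe K m g1 g3.
Proof.
  intros [A1 A2] [B1 B2]; split; intros.
  - rewrite B1, A1; auto.
  - rewrite B2, A2; auto.
Qed.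

Lemma br_inj r r' : br r = br r' -> r = r'.
Proof. unfold br. intros E. apply rg_inj in E; [tauto|discriminate|discriminate]. Qed.

Lemma br_tmp r d : br r <> tmp d.
Proof.
  unfold br, tmp. intros E. apply rg_inj in E; [|discriminate|discriminate].
  destruct E; discriminate.
Qed.

Lemma br_rg r v i : okv v i -> rg v i <> br r.
Proof.
  unfold br. intros O E. apply rg_inj in E; [|exact (okv_VIn v i O)|discriminate].
  destruct E as [-> _]. exact O.
Qed.

Lemma arbox_inj a a' : ar ABox a = ar ABox a' -> a = a'.
Proof. intros E. apply ar_inj in E; try exact I. tauto. Qed.

Lemma boxrel_reg n K m s g r v :
  boxrel n K m s g -> boxrel n K m (set_reg s r v) (set_reg g (br r) v).
Proof.
  intros [R1 R2]; split; auto. intros r' L. simpl.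
  destruct (Nat.eqb_spec r' r) as [->|N]; [now rewrite Nat.eqb_refl|].
  destruct (Nat.eqb_spec (br r') (br r)) as [E|_]; [apply br_inj in E; tauto|auto].
Qed.

Lemma boxframe_reg K m g r v : boxframe K m g (set_reg g (br r) v).
Proof.
  split; auto. intros r' H _. apply reg_set_other. auto.
Qed.

Lemma boxframe_tmp K m g v : boxframe K m g (set_reg g (tmp 0) v).
Proof.
  split; auto. intros r' _ H. apply reg_set_other. auto.
Qed.

Lemma boxrel_tmp n K m s g v :
  boxrel n K m s g -> boxrel n K m s (set_reg g (tmp 0) v).
Proof.
  intros [R1 R2]; split; auto. intros r L.
  rewrite reg_set_other by apply br_tmp. auto.
Qed.

Lemma boxrel_arr n K m s g a p v :
  m < K ->
  boxrel n K m s g ->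
  boxrel n K m (set_arr s a p v) (set_arr g (ar ABox a) (p * K + m) v).
Proof.
  intros L [R1 R2]; split; auto. intros a' p'. cbn [set_arr arr].
  destruct (Nat.eqb_spec a' a) as [->|N].
  - rewrite Nat.eqb_refl. cbn [andb]. destruct (Nat.eqb_spec p' p) as [->|N].
    + now rewrite Nat.eqb_refl.
    + destruct (Nat.eqb_spec (p' * K + m) (p * K + m)) as [E|_]; [|apply R2].
      exfalso. apply N. apply (Nat.mul_cancel_r _ _ K); lia.
  - destruct (Nat.eqb_spec (ar ABox a') (ar ABox a)) as [E|_].
    + apply arbox_inj in E. tauto.
    + cbn [andb]. apply R2.
Qed.

Lemma boxframe_arr K m g a p v :
  boxframe K m g (set_arr g (ar ABox a) (p * K + m) v).
Proof.
  split; [reflexivity|]. intros a' p' H. cbn [set_arr arr].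
  destruct (Nat.eqb_spec a' (ar ABox a)) as [->|N]; [|reflexivity].
  destruct (Nat.eqb_spec p' (p * K + m)) as [->|N]; [|reflexivity].
  exfalso. eapply H; eauto.
Qed.

Definition boxhost (K m : nat) (g : state) : Prop :=
  reg g (rg Vnb 0) = Z.of_nat K /\ reg g (rg Vp 0) = Z.of_nat m.

Lemma boxhost_frame K m g g' : boxhost K m g -> boxframe K m g g' -> boxhost K m g'.
Proof.
  intros [H1 H2] [F _]. split; (rewrite F;
    [assumption|intros; apply br_rg; exact I|apply rg_tmp; exact I]).
Qed.

Lemma lift_addr w0 K m s g n ri p :
  (0 <= w0)%Z -> (w0 * Z.of_nat K + Z.of_nat m <= w)%Z -> m < K ->
  bounded w0 s -> boxrel n K m s g -> boxhost K m g -> ri < n ->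
  reg s ri = Z.of_nat p ->
  forall c g2 t2,
  exec w c (set_reg (set_reg g (tmp 0) (Z.of_nat p * Z.of_nat K)) (tmp 0)
              (Z.of_nat (p * K + m))) g2 t2 ->
  exec w (Op (tmp 0) Mul (br ri) (rg Vnb 0) ;; Op (tmp 0) Add (tmp 0) (rg Vp 0) ;; c)
    g g2 (1 + (1 + t2)).
Proof.
  intros P0 Lw Lm [Bd _] [R1 _] [H1 H2] Lr E c g2 t2 X.
  specialize (Bd ri). rewrite E in Bd.
  eapply exec_seq; [|eapply exec_seq; [|exact X]].
  - apply exec_op.
    + cbn [eval_op]. rewrite R1, E, H1 by auto. reflexivity.
    + nia.
  - apply exec_op.
    + cbn [eval_op]. rewrite reg_set_same, reg_set_other, H2 by (apply rg_tmp; exact I).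
      lia.
    + nia.
Qed.

(** Only [Get] and [Put] grow, to three instructions each, hence the factor 3. An address is the
    content of a register of the embedded run, so it is at most [w0], and its translation stays
    below [w0 * K + m]. *)
Lemma lift_correct w0 c s s' t n K m :
  exec w0 c s s' t -> nreg c <= n -> bounded w0 s -> (0 <= w0 <= w)%Z ->
  (w0 * Z.of_nat K + Z.of_nat m <= w)%Z -> m < K ->
  forall g, boxrel n K m s g -> boxhost K m g ->
  exists g' t', exec w (lift c) g g' t' /\ t' <= 3 * t /\
    boxrel n K m s' g' /\ boxframe K m g g'.
Proof.
  intros X. induction X; intros Hn Hb Hw HwK Lm g R Hh; cbn [nreg lift] in *.
  - exists g, 1. split; [constructor|]. split; [lia|]. split; auto. split; auto.
  - exists (set_reg g (br r) z), 1. split; [constructor; lia|]. split; [lia|].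
    split; [apply boxrel_reg; auto|apply boxframe_reg].
  - exists (set_reg g (br r) v), 1. split; [|split; [lia|
      split; [apply boxrel_reg; auto|apply boxframe_reg]]].
    constructor; [|lia]. destruct R as [R _]. rewrite !R by lia. auto.
  - eexists _, _. split; [|split; [|split]].
    + eapply lift_addr; eauto; try lia.
      eapply exec_get. apply reg_set_same.
    + lia.
    + pose proof R as [_ R2]. cbn [arr set_reg]. rewrite R2.
      apply boxrel_reg, boxrel_tmp, boxrel_tmp. exact R.
    + eapply boxframe_trans; [|apply boxframe_reg].
      eapply boxframe_trans; apply boxframe_tmp.
  - eexists _, _. split; [|split; [|split]].
    + eapply lift_addr; eauto; try lia.
      eapply exec_put. apply reg_set_same.
    + lia.
    + pose proof R as [R1 _]. rewrite reg_set_other, reg_set_other, R1 by (lia || apply br_tmp).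
      apply boxrel_arr; auto. apply boxrel_tmp, boxrel_tmp. exact R.
    + eapply boxframe_trans; [|apply boxframe_arr].
      eapply boxframe_trans; apply boxframe_tmp.
  - destruct (IHX1 ltac:(lia) Hb Hw HwK Lm g R Hh) as (g1 & t1' & Y1 & L1 & R1 & F1).
    destruct (IHX2 ltac:(lia) (exec_bounded _ _ _ _ _ X1 Hb) Hw HwK Lm g1 R1
      (boxhost_frame _ _ _ _ Hh F1)) as (g2 & t2' & Y2 & L2 & R2 & F2).
    exists g2, (t1' + t2'). split; [eapply exec_seq; eauto|]. split; [lia|].
    split; [auto|eapply boxframe_trans; eauto].
  - destruct (IHX ltac:(lia) Hb Hw HwK Lm g R Hh) as (g1 & t1' & Y1 & L1 & R1 & F1).
    exists g1, (S t1'). split; [|split; [lia|split; auto]].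
    apply exec_if_true; auto. rewrite (proj1 R) by lia. auto.
  - destruct (IHX ltac:(lia) Hb Hw HwK Lm g R Hh) as (g1 & t1' & Y1 & L1 & R1 & F1).
    exists g1, (S t1'). split; [|split; [lia|split; auto]].
    apply exec_if_false; auto. rewrite (proj1 R) by lia. auto.
  - destruct (IHX1 ltac:(lia) Hb Hw HwK Lm g R Hh) as (g1 & t1' & Y1 & L1 & R1 & F1).
    destruct (IHX2 ltac:(lia) (exec_bounded _ _ _ _ _ X1 Hb) Hw HwK Lm g1 R1
      (boxhost_frame _ _ _ _ Hh F1)) as (g2 & t2' & Y2 & L2 & R2 & F2).
    exists g2, (S (t1' + t2')). split; [|split; [lia|split; [auto|eapply boxframe_trans; eauto]]].
    eapply exec_while_true; eauto. rewrite (proj1 R) by lia. auto.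
  - exists g, 1. split; [apply exec_while_false; rewrite (proj1 R) by lia; auto|].
    split; [lia|]. split; auto. split; auto.
Qed.

(** Only the registers are cleared: they are finitely many and known from the program text, whereas
    the arrays are fresh by the interleaving. Register 0 is zeroed once more since [nreg c] may be
    0; it then receives [beta] by an addition. *)
Definition call_init (c : cmd) : cmd :=
  iter (nreg c) (fun r => Const (br r) 0) ;;
  Const (br 0) 0 ;; Op (br 0) Add (rg Vbeta 0) (br 0).

Definition call (c : cmd) : cmd := call_init c ;; lift c.

Lemma clear_regs n : forall g, exists g',
  exec w (iter n (fun r => Const (br r) 0)) g g' (csz (iter n (fun r => Const (br r) 0))) /\
  (forall r, r < n -> reg g' (br r) = 0%Z) /\
  (forall r, (forall r', r <> br r') -> reg g' r = reg g r) /\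
  arr g' = arr g.
Proof.
  pose proof B_le_w.
  induction n; intros g; cbn [iter csz].
  - exists g. split; [constructor|]. split; [lia|auto].
  - destruct (IHn g) as (g1 & X & Z1 & F & A).
    exists (set_reg g1 (br n) 0). split; [eapply exec_seq; [exact X|constructor; lia]|].
    split; [|split; [|exact A]].
    + intros r L. destruct (Nat.eq_dec r n) as [->|N]; [apply reg_set_same|].
      rewrite reg_set_other; [apply Z1; lia|]. intros E; apply br_inj in E; auto.
    + intros r N. rewrite reg_set_other; auto.
Qed.

Lemma hwp_call c e0 n A1 A2 sF tF K m (Q : hst -> Prop) h :
  (1 <= n) -> (forall i j, (Z.abs (A1 i j) <= 1)%Z) -> (forall i j, (Z.abs (A2 i j) <= 1)%Z) ->
  runs c e0 (mx_input n A1 A2) sF tF ->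
  mx_output n (mx_prod n A1 A2) sF ->
  ((Z.of_nat n + 2) ^ Z.of_nat e0 <= B)%Z -> (Z.of_nat n <= B)%Z ->
  hv h Vnb 0 = Z.of_nat K -> hv h Vp 0 = Z.of_nat m -> m < K ->
  hv h Vbeta 0 = Z.of_nat n ->
  (forall a p, ha h ABox a (p * K + m) = arr (mx_input n A1 A2) a p) ->
  (forall h', (forall v i, hv h' v i = hv h v i) ->
     (forall a i p, a <> ABox -> ha h' a i p = ha h a i p) ->
     (forall a p, p mod K <> m -> ha h' ABox a p = ha h ABox a p) ->
     (forall i j, i < n -> j < n ->
        ha h' ABox 2 ((i * n + j) * K + m) = mx_prod n A1 A2 i j) ->
     Q h') ->
  hwp (call c) (csz (call_init c) + 3 * tF) Q h.
Proof.
  intros Hn BA1 BA2 Hrun Hout HwB HnB HK Hm Lm Hbeta Hin HQ Hb s R.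
  pose proof B_le_w as HBw1.
  (* The entries are at most 1 in absolute value, so the side [n] bounds the whole input of the
     embedded program. *)
  assert (Bin : bounded (Z.of_nat n) (mx_input n A1 A2)).
  { split.
    - intros [|r]; cbn; lia.
    - intros [|[|a]] p; cbn; unfold row_major; try destruct (Nat.ltb _ _);
        try (etransitivity; [apply BA1 || apply BA2|]); lia. }
  pose proof (Hrun _ Bin) as X.
  set (w0 := ((Z.of_nat n + 2) ^ Z.of_nat e0)%Z) in *.
  destruct R as (R1 & R2 & R3).
  destruct (clear_regs (nreg c) s) as (g1 & X1 & C1 & C2 & C3).
  set (g2 := set_reg (set_reg g1 (br 0) 0) (br 0) (Z.of_nat n)).
  assert (X2 : exec w (call_init c) s g2 (csz (call_init c))).
  { unfold call_init. cbn [csz]. eapply exec_seq; [exact X1|].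
    eapply exec_seq; [constructor; lia|]. unfold g2.
    assert (E : Z.of_nat n = eval_op Add (reg (set_reg g1 (br 0) 0) (rg Vbeta 0))
      (reg (set_reg g1 (br 0) 0) (br 0))).
    { cbn [eval_op]. rewrite reg_set_same, reg_set_other, C2, R1, Hbeta; try exact I.
      - lia.
      - intros; apply br_rg; exact I.
      - apply br_rg; exact I. }
    apply exec_op; auto. lia. }
  assert (F2 : forall v i, okv v i -> reg g2 (rg v i) = hv h v i).
  { intros v i O. unfold g2. rewrite !reg_set_other, C2, R1; auto; intros; apply br_rg; auto. }
  assert (P2 : boxrel (nreg c) K m (mx_input n A1 A2) g2).
  { split.
    - intros r L. unfold g2. destruct (Nat.eq_dec r 0) as [->|N].
      + rewrite reg_set_same. reflexivity.
      + rewrite !reg_set_other; [|intros E; apply br_inj in E; auto..].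
        rewrite C1 by auto. destruct r; [lia|reflexivity].
    - intros a p. unfold g2. cbn [set_reg arr]. rewrite C3, R2 by exact I. apply Hin. }
  assert (H2 : boxhost K m g2) by (split; rewrite F2; auto; exact I).
  pose proof (proj1 R3 Vnb 0) as BK. pose proof (proj1 R3 Vp 0) as Bm.
  rewrite HK in BK. rewrite Hm in Bm.
  (* If [e0 = 0], then [w0] is 1 and need not bound the input; the maximum does in every case. *)
  set (w1 := Z.max w0 (Z.of_nat n)) in *.
  assert (Bin1 : bounded w1 (mx_input n A1 A2)).
  { destruct Bin as [Bin1 Bin2]. split; intros; [specialize (Bin1 r)|specialize (Bin2 a p)];
      unfold w1; lia. }
  pose proof (exec_mono _ w1 _ _ _ _ X ltac:(unfold w1; lia)) as X0.
  assert (Hw1 : (0 <= w1 <= B)%Z) by (unfold w1; lia).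
  (* Room for the translated addresses [p * K + m]: the bound [w1] and the values of the host
     variables [K] and [m] are at most [B]. *)
  assert (Hww : (B * B + B <= w)%Z).
  { etransitivity; [|exact HBw].
    assert (B ^ 3 <= B ^ 24)%Z by (apply Z.pow_le_mono_r; lia).
    assert (B ^ 3 = B * B * B)%Z by ring. nia. }
  destruct (lift_correct w1 c _ _ _ (nreg c) K m X0 ltac:(lia) Bin1 ltac:(lia)
    ltac:(nia) Lm g2 P2 H2) as (g' & t' & Y & Lt & [Rel1 Rel2] & Fr1 & Fr2).
  (* What the embedded program leaves in its cells obeys its own threshold, hence also the bound [B]
     of the host. *)
  pose proof (exec_bounded _ _ _ _ _ X0 Bin1) as [_ BF].
  set (h' := Hst (hv h) (fun a i p => if aeqb a ABox then arr g' (ar ABox i) p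
                                      else ha h a i p)).
  assert (Hout' : forall a p, p mod K <> m -> arr g' (ar ABox a) p = ha h ABox a p).
  { intros a p N. rewrite Fr2.
    - unfold g2. cbn [set_reg arr]. rewrite C3. apply R2. exact I.
    - intros a' p' [_ ->]. apply N. rewrite Nat.add_comm, Nat.Div0.mod_add.
      apply Nat.mod_small; auto. }
  exists g', h', (csz (call_init c) + t').
  split; [eapply exec_seq; eauto|]. split; [|split; [lia|]].
  - split; [|split; [|split]].
    + intros v i O. cbn [h' hv]. rewrite Fr1, F2; auto.
      * intros; apply br_rg; auto.
      * apply rg_tmp; auto.
    + intros a i p O. cbn [h' ha]. destruct (aeqb_spec a ABox) as [->|N]; auto.
      rewrite Fr2.
      * unfold g2. cbn [set_reg arr]. rewrite C3. apply R2; auto.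
      * intros a' p' [E _]. apply ar_inj in E; auto; [tauto|exact I].
    + intros v i. cbn [h' hv]. apply R3.
    + intros a i p. cbn [h' ha]. destruct (aeqb_spec a ABox) as [->|N]; [|apply R3].
      destruct (Nat.eq_dec (p mod K) m) as [E|N]; [|rewrite Hout' by auto; apply R3].
      assert (Ep : p = p / K * K + m) by (pose proof (Nat.div_mod_eq p K); lia).
      rewrite Ep, Rel2. specialize (BF i (p / K)). lia.
  - apply HQ.
    + reflexivity.
    + intros a i p N. cbn [h' ha]. destruct (aeqb_spec a ABox) as [->|_]; tauto.
    + intros a p N. cbn [h' ha aeqb]. apply Hout'; auto.
    + intros i j Li Lj. change (arr g' (ar ABox 2) ((i * n + j) * K + m) = mx_prod n A1 A2 i j).
      rewrite Rel2. apply Hout; auto.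
Qed.

End Layer.

(** * The program *)

Definition emod (a b : expr) : expr := (a - (a / b) * b)%e.

Section Program.

Context (k : nat).

Local Notation "v # i ::= e" := (assign k v i e%e)
  (at level 85, i at level 9, e at level 80).
Local Notation "a # i ! p ::= e" := (store k a i p%e e%e)
  (at level 85, i at level 9, p at level 60, e at level 80).
Local Notation If_ := (ifp k).
Local Notation for_ := (for_loop k).

Definition qv : expr := Var VQ 0.
Definition xv : expr := Var Vx 0.
Definition yv : expr := Var Vy 0.
Definition pv : expr := Var Vp 0.
Definition tv : expr := Var Vt 0.
Definition size_of (i : nat) : expr := Var VIn (S (S i)).
Definition D1v : expr := Var VIn 0.
Definition D2v : expr := Var VIn 1.

Definition load (i : nat) : cmd :=
  Vx # 0 ::= Rd AIn (2 * i) pv ;; Vy # 0 ::= Rd AIn (2 * i + 1) pv.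

Definition set_stride : cmd :=
  VQ # 0 ::= 1%Z ;;
  iter k (fun i => for_ Vp (size_of i) (load i ;; VQ # 0 ::= qv + ((xv + yv) + 1%Z))).

Definition build_tuple (i : nat) : cmd :=
    load i ;;
    Vd # 0 ::= Rd ACnt i yv ;;
    AL # i ! yv * qv + Var Vd 0 ::= xv ;;
    ACnt # i ! yv ::= Var Vd 0 + 1%Z ;;
    ADx # i ! xv ::= Rd ADx i xv + 1%Z ;;
    AAdj # i ! xv * qv + yv ::= 1%Z.

Definition build : cmd := iter k (fun i => for_ Vp (size_of i) (build_tuple i)).

(** One counter runs through a Cartesian product of lists: its mixed radix digits, split off [Vrem]
    one by one, are the positions in the lists. This replaces nested loops, in the light phase as
    well as for rows and columns. *)
Definition decode (a : aname) (lo n : nat) : cmd :=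
  iter n (fun i =>
    Vxs # (lo + i) ::= Rd a (lo + i)
      (Var Vbase (lo + i) + emod (Var Vrem 0) (Var Vrad (lo + i))) ;;
    Vrem # 0 ::= Var Vrem 0 / Var Vrad (lo + i)).

Definition insert : cmd :=
  Vcode # 0 ::= 0%Z ;;
  iter k (fun i => Vcode # 0 ::= Var Vcode 0 * qv + Var Vxs i) ;;
  If_ (Rd AVis 0 (Var Vcode 0)) Skip (
    AVis # 0 ! Var Vcode 0 ::= 1%Z ;;
    iter k (fun i => AOut # i ! Var Vcnt 0 ::= Var Vxs i) ;;
    Vcnt # 0 ::= Var Vcnt 0 + 1%Z).

(* The radix of relation [j] is 1, and its component, read from a meaningless
   cell by [decode], is overwritten with [x] in [light_enum]. *)
Definition light_tuple (j : nat) : cmd :=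
  load j ;;
  Vok # 0 ::= 1%Z ;;
  Vtot # 0 ::= 1%Z ;;
  iter k (fun i =>
    Vbase # i ::= yv * qv ;;
    Vrad # i ::= (if Nat.eqb i j then Cst 1 else Rd ACnt i yv) ;;
    Vtot # 0 ::= Var Vtot 0 * Var Vrad i ;;
    If_ (Rd ACnt i yv - D1v) (Vok # 0 ::= 0%Z) Skip) ;;
  If_ (Rd ADx j xv - D2v) Skip (Vok # 0 ::= 1%Z).

Definition light_enum (j : nat) : cmd :=
  Vrem # 0 ::= tv ;; decode AL 0 k ;; Vxs # j ::= xv ;; insert.

Definition light_body (j : nat) : cmd :=
  light_tuple j ;;
  If_ (Var Vok 0) (for_ Vt (Var Vtot 0) (light_enum j)) Skip.

Definition light_phase : cmd := iter k (fun j => for_ Vp (size_of j) (light_body j)).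

Definition push (v : vname) (al am : aname) (i : nat) (e : expr) : cmd :=
  If_ (Rd am i e) Skip (
    am # i ! e ::= 1%Z ;;
    al # i ! Var v i ::= e ;;
    v # i ::= Var v i + 1%Z).

(** The heavy [x] are listed for each relation separately; the heavy [y] go to a single list, at
    index 0, since being heavy in one relation is enough. *)
Definition find_body (i : nat) : cmd :=
  load i ;;
  If_ (Rd ADx i xv - D2v) (push Vh AHX AMkx i xv) Skip ;;
  If_ (Rd ACnt i yv - D1v) (push Vm AHY AMky 0 yv) Skip.

Definition find_heavy : cmd := iter k (fun i => for_ Vp (size_of i) (find_body i)).

Definition half : nat := (k + 1) / 2.

Definition entry (lo n : nat) : cmd :=
  Vent # 0 ::= 1%Z ;;
  iter n (fun i => Vent # 0 ::= Var Vent 0 *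
                     Rd AAdj (lo + i) (Var Vxs (lo + i) * qv + yv)).

Definition beta : expr := Var Vbeta 0.
(** The address that [lift] assigns to cell [t] in call number [Vp] out of [Vnb]: the host writes
    the factors and reads the product in place. *)
Definition cell : expr := (tv * Var Vnb 0 + pv)%e.

Definition decode_row : cmd :=
  Vrem # 0 ::= Var VI 0 * beta + tv / beta ;; decode AHX 0 half.

Definition decode_col : cmd :=
  Vrem # 0 ::= Var VJ 0 * beta + emod tv beta ;; decode AHX half (k - half).

(* Rows and columns beyond the last one need no test: their entries are again
   products of membership tests, so a positive one still witnesses a tuple. *)
Definition fill : cmd :=
  Vy # 0 ::= Rd AHY 0 (Var VL 0 * beta + emod tv beta) ;;
  decode_row ;; entry 0 half ;; ABox # 0 ! cell ::= Var Vent 0 ;;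
  Vy # 0 ::= Rd AHY 0 (Var VL 0 * beta + tv / beta) ;;
  decode_col ;; entry half (k - half) ;; ABox # 1 ! cell ::= Var Vent 0.

Definition scan : cmd :=
  If_ (Rd ABox 2 cell) (decode_row ;; decode_col ;; insert) Skip.

Definition set_block : cmd :=
  VJ # 0 ::= emod pv (Var Vnw 0) ;;
  VL # 0 ::= emod (pv / Var Vnw 0) (Var Vnv 0) ;;
  VI # 0 ::= pv / Var Vnw 0 / Var Vnv 0.

Definition set_sides : cmd :=
  Vu # 0 ::= 1%Z ;; iter half (fun i => Vu # 0 ::= Var Vu 0 * Var Vh i) ;;
  Vw # 0 ::= 1%Z ;; iter (k - half) (fun i => Vw # 0 ::= Var Vw 0 * Var Vh (half + i)) ;;
  iter k (fun i => Vrad # i ::= Var Vh i ;; Vbase # i ::= 0%Z).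

(** With [x / beta + 1] blocks a side of length [x] is always covered, without rounding up; the last
    block may overhang or lie wholly beyond the end. *)
Definition set_blocks : cmd :=
  Vbeta # 0 ::= Var Vm 0 ;;
  If_ (beta - Var Vu 0) (Vbeta # 0 ::= Var Vu 0) Skip ;;
  If_ (beta - Var Vw 0) (Vbeta # 0 ::= Var Vw 0) Skip ;;
  Vnv # 0 ::= Var Vm 0 / beta + 1%Z ;;
  Vnw # 0 ::= Var Vw 0 / beta + 1%Z ;;
  Vnb # 0 ::= (Var Vu 0 / beta + 1%Z) * (Var Vnv 0 * Var Vnw 0).

Definition block_body (mm : cmd) : cmd :=
  set_block ;;
  for_ Vt (beta * beta) fill ;;
  call k mm ;;
  for_ Vt (beta * beta) scan.

(** The test keeps [beta] positive. If one of the sides is empty, no output tuple is heavy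
    throughout and nothing has to be done. *)
Definition heavy_phase (mm : cmd) : cmd :=
  set_sides ;;
  If_ (Var Vu 0 * (Var Vw 0 * Var Vm 0))
    (set_blocks ;; for_ Vp (Var Vnb 0) (block_body mm)) Skip.

(** The output format occupies registers and arrays of the input, so the tuples are collected in
    [AOut] and moved only at the very end. *)
Definition output : cmd :=
  for_ Vp (Var Vcnt 0) (iter k (fun i => AIn # i ! pv ::= Rd AOut i pv)) ;;
  VIn # 0 ::= Var Vcnt 0.

Definition star_query (mm : cmd) : cmd :=
  set_stride ;; build ;; light_phase ;; find_heavy ;; heavy_phase mm ;; output.

End Program.

(** * Mixed radix and Horner codes *)

Fixpoint prodn (f : nat -> nat) (n : nat) : nat :=
  match n with 0 => 1 | S n => prodn f n * f n end.

Fixpoint quo (rad : nat -> nat) (n r : nat) : nat :=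
  match n with 0 => r | S n => quo rad n r / rad n end.

Definition digit (rad : nat -> nat) (r i : nat) : nat := quo rad i r mod rad i.

Lemma quo_prodn rad n r : quo rad n r = r / prodn rad n.
Proof.
  induction n; cbn [quo prodn]; [now rewrite Nat.div_1_r|].
  now rewrite IHn, Nat.Div0.div_div.
Qed.

Lemma prodn_pos f n : (forall i, i < n -> 0 < f i) -> 0 < prodn f n.
Proof.
  induction n; intros H; cbn [prodn]; [lia|].
  specialize (IHn ltac:(intros; apply H; lia)). specialize (H n ltac:(lia)). nia.
Qed.

Lemma prodn_split f n i : i < n -> exists c, prodn f n = prodn f i * f i * c.
Proof.
  induction n; intros L; [lia|]. cbn [prodn].
  destruct (Nat.eq_dec i n) as [->|N].
  - exists 1. lia.
  - destruct IHn as [c E]; [lia|]. exists (c * f n). rewrite E. ring.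
Qed.

Lemma prodn_le f c n : (forall i, i < n -> f i <= c) -> prodn f n <= c ^ n.
Proof.
  induction n; intros H; cbn [prodn]; [cbn; lia|].
  rewrite Nat.pow_succ_r'.
  specialize (IHn ltac:(intros; apply H; lia)). specialize (H n ltac:(lia)). nia.
Qed.

(** The new digit is added with weight [prodn rad n]. For [i < n] this weight is a multiple of
    [prodn rad i * rad i], so the lower digits do not change. *)
Lemma digits_exist rad (d : nat -> nat) n :
  (forall i, i < n -> d i < rad i) ->
  exists r, r < prodn rad n /\ forall i, i < n -> digit rad r i = d i.
Proof.
  induction n; intros H.
  - exists 0. cbn; split; [lia|intros; lia].
  - destruct IHn as (r & L & D); [intros; apply H; lia|].
    assert (P : 0 < prodn rad n) by lia.
    pose proof (H n ltac:(lia)) as Hn.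
    exists (r + d n * prodn rad n). cbn [prodn]. split; [nia|].
    intros i Li. unfold digit. rewrite quo_prodn.
    destruct (Nat.eq_dec i n) as [->|N].
    + rewrite Nat.div_add, Nat.div_small by lia. now apply Nat.mod_small.
    + destruct (prodn_split rad n i ltac:(lia)) as [c E].
      assert (Pi : prodn rad i <> 0) by (intros E0; rewrite E0 in E; lia).
      replace (r + d n * prodn rad n) with (r + (d n * c * rad i) * prodn rad i)
        by (rewrite E; ring).
      rewrite Nat.div_add, Nat.Div0.mod_add by auto.
      rewrite <- quo_prodn. apply D; lia.
Qed.

Lemma digit_lt rad r i : 0 < rad i -> digit rad r i < rad i.
Proof. intros. apply Nat.mod_upper_bound. lia. Qed.

Definition horner (q : nat) (a : list nat) : nat :=
  fold_left (fun c x => c * q + x) a 0.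

Lemma horner_snoc q a x : horner q (a ++ [x]) = horner q a * q + x.
Proof. unfold horner. now rewrite fold_left_app. Qed.

Lemma horner_lt q a : (forall x, In x a -> x < q) -> horner q a < q ^ length a.
Proof.
  induction a as [|x a IH] using rev_ind; intros H; [cbn; lia|].
  rewrite horner_snoc, length_app. cbn [length]. rewrite Nat.pow_add_r, Nat.pow_1_r.
  specialize (IH ltac:(intros; apply H, in_or_app; auto)).
  specialize (H x ltac:(apply in_or_app; cbn; auto)). nia.
Qed.

Lemma stride_inj q a b c d : b < q -> d < q -> a * q + b = c * q + d -> a = c /\ b = d.
Proof.
  intros L1 L2 E.
  assert (a = c).
  { destruct (Nat.lt_trichotomy a c) as [L|[L|L]]; auto; exfalso; nia. }
  subst. lia.
Qed.

Lemma horner_inj q a : forall b, length a = length b ->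
  (forall x, In x a -> x < q) -> (forall x, In x b -> x < q) ->
  horner q a = horner q b -> a = b.
Proof.
  induction a as [|x a IH] using rev_ind; intros b L Ha Hb E.
  - destruct b; [auto|discriminate].
  - destruct b as [|y b _] using rev_ind; [rewrite length_app in L; cbn in L; lia|].
    rewrite !length_app in L. cbn in L. rewrite !horner_snoc in E.
    apply stride_inj in E;
      [|apply Ha, in_or_app; cbn; auto|apply Hb, in_or_app; cbn; auto].
    destruct E as [E ->]. f_equal. apply IH; auto; [lia| |];
      intros; [apply Ha|apply Hb]; apply in_or_app; auto.
Qed.

Lemma firstn_S_nth {T} (d : T) l n :
  n < length l -> firstn (S n) l = firstn n l ++ [nth n l d].
Proof.
  revert n. induction l; intros n L; cbn in L; [lia|].
  destruct n; cbn; auto. f_equal. apply IHl. lia.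
Qed.

Lemma NoDup_lt_length l n : NoDup l -> (forall x, In x l -> x < n) -> length l <= n.
Proof.
  intros H L. rewrite <- (length_seq n 0). apply NoDup_incl_length; auto.
  intros x Hx. apply in_seq. specialize (L x Hx). lia.
Qed.

(** True for [b = 0] as well, where both sides are [a]; this lets [decode_spec] speak of arbitrary
    radices. *)
Lemma of_nat_mod a b : Z.of_nat (a mod b) =
  (Z.of_nat a - Z.of_nat a / Z.of_nat b * Z.of_nat b)%Z.
Proof.
  destruct (Nat.eq_dec b 0) as [->|N].
  - rewrite Nat.mod_0_r. lia.
  - rewrite Nat2Z.inj_mod. rewrite Z.mod_eq by lia. ring.
Qed.

Definition sec (R : binrel) (y : nat) : list nat :=
  map fst (filter (fun t => Nat.eqb (snd t) y) R).

Definition sec2 (R : binrel) (x : nat) : list nat :=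
  map snd (filter (fun t => Nat.eqb (fst t) x) R).

Lemma in_sec R x y : In x (sec R y) <-> In (x, y) R.
Proof.
  unfold sec. rewrite in_map_iff. split.
  - intros ((u, v) & E & H). apply filter_In in H. cbn in *.
    destruct H as [H E2]. apply Nat.eqb_eq in E2. congruence.
  - intros H. exists (x, y). split; auto. apply filter_In. cbn.
    now rewrite Nat.eqb_refl.
Qed.

Lemma in_sec2 R x y : In y (sec2 R x) <-> In (x, y) R.
Proof.
  unfold sec2. rewrite in_map_iff. split.
  - intros ((u, v) & E & H). apply filter_In in H. cbn in *.
    destruct H as [H E2]. apply Nat.eqb_eq in E2. congruence.
  - intros H. exists (x, y). split; auto. apply filter_In. cbn.
    now rewrite Nat.eqb_refl.
Qed.

Lemma sec_snoc R x y y' :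
  sec (R ++ [(x, y)]) y' = sec R y' ++ (if Nat.eqb y y' then [x] else []).
Proof.
  unfold sec. rewrite filter_app, map_app. cbn. destruct (Nat.eqb y y'); auto.
Qed.

Lemma sec2_snoc R x y x' :
  sec2 (R ++ [(x, y)]) x' = sec2 R x' ++ (if Nat.eqb x x' then [y] else []).
Proof.
  unfold sec2. rewrite filter_app, map_app. cbn. destruct (Nat.eqb x x'); auto.
Qed.

Lemma sec_length R y : length (sec R y) <= length R.
Proof. unfold sec. rewrite length_map. apply filter_length_le. Qed.

Lemma sec2_length R x : length (sec2 R x) <= length R.
Proof. unfold sec2. rewrite length_map. apply filter_length_le. Qed.

(** * Specifications of the building blocks *)

(** The lists contain the names that may change. Membership is a boolean test, so that side
    conditions about concrete lists are settled by computation. *)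
Definition frame (vs : list vname) (al : list aname) (h h' : hst) : Prop :=
  (forall v i, existsb (veqb v) vs = false -> hv h' v i = hv h v i) /\
  (forall a i p, existsb (aeqb a) al = false -> ha h' a i p = ha h a i p).

Lemma frame_refl vs al h : frame vs al h h.
Proof. split; auto. Qed.

Lemma existsb_incl {T} (f : T -> T -> bool) (v : T) l l' :
  (forall x y, reflect (x = y) (f x y)) ->
  forallb (fun x => existsb (f x) l') l = true ->
  existsb (f v) l' = false -> existsb (f v) l = false.
Proof.
  intros S H N. destruct (existsb (f v) l) eqn:E; auto.
  apply existsb_exists in E. destruct E as (x & I & E).
  destruct (S v x); [subst|discriminate].
  rewrite forallb_forall in H. rewrite H in N; auto.
Qed.

Lemma frame_trans vs al vs' al' h0 h h' :
  frame vs al h0 h -> frame vs' al' h h' ->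
  forallb (fun v => existsb (veqb v) vs) vs' = true ->
  forallb (fun a => existsb (aeqb a) al) al' = true ->
  frame vs al h0 h'.
Proof.
  intros [A1 A2] [B1 B2] Hv Ha. split; intros.
  - rewrite B1, A1; auto. eapply existsb_incl; eauto. apply veqb_spec.
  - rewrite B2, A2; auto. eapply existsb_incl; eauto. apply aeqb_spec.
Qed.

Lemma frame_weak vs al vs' al' h h' :
  frame vs' al' h h' ->
  forallb (fun v => existsb (veqb v) vs) vs' = true ->
  forallb (fun a => existsb (aeqb a) al) al' = true ->
  frame vs al h h'.
Proof. intros. eapply frame_trans; eauto. apply frame_refl. Qed.

Lemma frame_setv vs al h0 h v i x :
  frame vs al h0 h -> existsb (veqb v) vs = true -> frame vs al h0 (setv h v i x).
Proof.
  intros [A1 A2] H. split; auto. intros v' i' N. cbn [setv hv].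
  destruct (veqb_spec v' v) as [->|]; [congruence|]. cbn [andb]. auto.
Qed.

Lemma frame_seta vs al h0 h a i p x :
  frame vs al h0 h -> existsb (aeqb a) al = true -> frame vs al h0 (seta h a i p x).
Proof.
  intros [A1 A2] H. split; auto. intros a' i' p' N. cbn [seta ha].
  destruct (aeqb_spec a' a) as [->|]; [congruence|]. cbn [andb]. auto.
Qed.

Lemma hv_setv h v i x v' i' :
  hv (setv h v i x) v' i' = if (veqb v' v && Nat.eqb i' i)%bool then x else hv h v' i'.
Proof. reflexivity. Qed.

Lemma ha_setv h v i x : ha (setv h v i x) = ha h.
Proof. reflexivity. Qed.

Lemma hv_seta h a i p x : hv (seta h a i p x) = hv h.
Proof. reflexivity. Qed.

Lemma ha_seta h a i p x a' i' p' :
  ha (seta h a i p x) a' i' p' =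
  if (aeqb a' a && (Nat.eqb i' i && Nat.eqb p' p))%bool then x else ha h a' i' p'.
Proof. reflexivity. Qed.

Ltac hs := repeat (rewrite ?hv_setv, ?ha_setv, ?hv_seta, ?ha_seta;
  cbn [veqb aeqb vnum anum Nat.eqb andb]).
Ltac hs_in H := repeat (rewrite ?hv_setv, ?ha_setv, ?hv_seta, ?ha_seta in H;
  cbn [veqb aeqb vnum anum Nat.eqb andb] in H).

Ltac hrw := repeat match goal with
  | H : hv ?h ?v ?i = _ |- context [hv ?h ?v ?i] => rewrite H
  | H : ha ?h ?v ?i ?p = _ |- context [ha ?h ?v ?i ?p] => rewrite H
  end.

Ltac ev := cbn [eval eval_op safe okv oka esize qv xv yv pv tv D1v D2v size_of
                beta cell emod]; hs; hrw.

Ltac frv F := rewrite (proj1 F) by reflexivity.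
Ltac fra F := rewrite (proj2 F) by reflexivity.
Ltac ftrans F F' := eapply frame_trans; [exact F|exact F'|reflexivity|reflexivity].
Ltac fweak F := eapply frame_weak; [exact F|reflexivity|reflexivity].
Ltac frm := repeat match goal with
  | |- frame _ _ _ (setv _ _ _ _) => apply frame_setv; [|reflexivity]
  | |- frame _ _ _ (seta _ _ _ _ _) => apply frame_seta; [|reflexivity]
  | |- frame _ _ ?h ?h => apply frame_refl
  end.

(** The largest quantity stored in a variable by the host is the number of blocks, at most
    [8 * Q ^ (2 * k + 1)]; codes of tuples stay below [Q ^ k]. The bound [16 * Q ^ (2 * k + 3)]
    covers all of them. *)
Record Env (k : nat) (w B : Z) (Rs : list binrel) (Q : nat) : Prop := {
  env_B2 : (2 <= B)%Z;
  env_Bw : (B ^ 24 <= w)%Z;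
  env_k2 : 2 <= k;
  env_k : length Rs = k;
  env_NoDup : forall i, i < k -> NoDup (nth i Rs []);
  env_lt : forall i x y, i < k -> In (x, y) (nth i Rs []) -> x < Q /\ y < Q;
  env_len : forall i, i < k -> length (nth i Rs []) < Q;
  env_BQ : (Z.of_nat (16 * Q ^ (2 * k + 3)) <= B)%Z
}.

Section Blocks.

Context (k : nat) (w B : Z) (Rs : list binrel) (D1 D2 Q : nat).
Hypothesis E : Env k w B Rs Q.

Let HB2 := env_B2 _ _ _ _ _ E.
Let HBw := env_Bw _ _ _ _ _ E.
Notation hsl := (hsl k w B).
Notation hwp := (hwp k w B).
Notation R i := (nth i Rs (@nil (nat * nat))).

Lemma assign_rule v i e z (P : hst -> Prop) h :
  okv k v i -> esize e <= 24 -> safe k B h e ->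
  (hbnd B h -> eval h e = z /\ (Z.abs z <= B)%Z) ->
  P (setv h v i z) -> hsl (assign k v i e) P h.
Proof.
  intros O S Sf Ev HP.
  intros Hb. destruct (Ev Hb) as [Ez Lz]. revert Hb.
  apply hsl_assign; auto; rewrite Ez; auto.
Qed.

Lemma store_rule a i e1 e2 p z (P : hst -> Prop) h :
  oka k a i -> esize e1 <= 24 -> esize e2 <= 24 -> safe k B h e1 -> safe k B h e2 ->
  eval h e1 = Z.of_nat p ->
  (hbnd B h -> eval h e2 = z /\ (Z.abs z <= B)%Z) ->
  P (seta h a i p z) -> hsl (store k a i e1 e2) P h.
Proof.
  intros O S1 S2 Sf1 Sf2 E1 E2 HP Hb. destruct (E2 Hb) as [Ez Lz]. revert Hb.
  apply hsl_store; auto; rewrite ?E1, ?Ez, ?Nat2Z.id; auto. lia.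
Qed.

Lemma seq_rule c1 c2 (P : hst -> Prop) h :
  hsl c1 (hsl c2 P) h -> hsl (c1 ;; c2) P h.
Proof. intros; eapply hsl_seq; eauto. Qed.

Lemma spec_rule c (P P' : hst -> Prop) h :
  hsl c P h -> (forall h', hbnd B h' -> P h' -> P' h') -> hsl c P' h.
Proof. intros; eapply hsl_mono; eauto. Qed.

Lemma iter_rule f n (I : nat -> hst -> Prop) h :
  I 0 h ->
  (forall j h', j < n -> I j h' -> hsl (f j) (I (S j)) h') ->
  hsl (iter n f) (I n) h.
Proof. intros; eapply hsl_iter; eauto. Qed.

Lemma Q_pos : 1 <= Q.
Proof.
  pose proof (env_len _ _ _ _ _ E 0 ltac:(pose proof (env_k2 _ _ _ _ _ E); lia)). lia.
Qed.

Lemma Qpow_B m c : m <= 2 * k + 3 -> c <= 16 -> (Z.of_nat (c * Q ^ m) <= B)%Z.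
Proof.
  intros L Lc. etransitivity; [|exact (env_BQ _ _ _ _ _ E)]. apply inj_le.
  apply Nat.mul_le_mono; auto. apply Nat.pow_le_mono_r; auto. pose proof Q_pos. lia.
Qed.

Lemma nat_B n m c : n <= c * Q ^ m -> m <= 2 * k + 3 -> c <= 16 ->
  (Z.abs (Z.of_nat n) <= B)%Z.
Proof. intros L L1 L2. pose proof (Qpow_B m c L1 L2). lia. Qed.

Lemma nat_BQ n : n <= 16 * Q -> (Z.abs (Z.of_nat n) <= B)%Z.
Proof. intros L. apply (nat_B n 1 16); try lia. now rewrite Nat.pow_1_r. Qed.

Lemma nat_BQ2 n : n <= 16 * (Q * Q) -> (Z.abs (Z.of_nat n) <= B)%Z.
Proof. intros L. apply (nat_B n 2 16); try lia. now rewrite Nat.pow_2_r. Qed.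

Lemma half_le : half k <= k.
Proof.
  unfold half. pose proof (env_k2 _ _ _ _ _ E).
  apply Nat.Div0.div_le_upper_bound. lia.
Qed.

Lemma decode_spec a lo n (rad base : nat -> nat) r h :
  a <> AIn -> lo + n <= k ->
  hv h Vrem 0 = Z.of_nat r ->
  (forall i, i < n -> hv h Vrad (lo + i) = Z.of_nat (rad i)) ->
  (forall i, i < n -> hv h Vbase (lo + i) = Z.of_nat (base i)) ->
  hsl (decode k a lo n) (fun h' =>
    frame [Vrem; Vxs] [] h h' /\
    (forall i, ~ (lo <= i < lo + n) -> hv h' Vxs i = hv h Vxs i) /\
    (forall i, i < n -> hv h' Vxs (lo + i) = ha h a (lo + i) (base i + digit rad r i))) h.
Proof.
  intros Na Ln Hr Hrad Hbase.
  assert (Oa : forall i, oka k a i) by (destruct a; intros; cbn; tauto).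
  unfold decode.
  eapply spec_rule; [eapply iter_rule with (I := fun n' h' =>
    frame [Vrem; Vxs] [] h h' /\ hv h' Vrem 0 = Z.of_nat (quo rad n' r) /\
    (forall i, ~ (lo <= i < lo + n') -> hv h' Vxs i = hv h Vxs i) /\
    (forall i, i < n' -> hv h' Vxs (lo + i) = ha h a (lo + i) (base i + digit rad r i)))|].
  - repeat split; auto. intros; lia.
  - intros i h1 Li (F & Er & Hout & Hin).
    assert (Erad : hv h1 Vrad (lo + i) = Z.of_nat (rad i)).
    { frv F. auto. }
    assert (Ebase : hv h1 Vbase (lo + i) = Z.of_nat (base i)).
    { frv F. auto. }
    assert (Ead : (hv h1 Vbase (lo + i) + (hv h1 Vrem 0 - hv h1 Vrem 0 /
       hv h1 Vrad (lo + i) * hv h1 Vrad (lo + i)))%Z =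
       Z.of_nat (base i + digit rad r i)).
    { rewrite Er, Erad, Ebase. unfold digit. rewrite Nat2Z.inj_add, of_nat_mod. lia. }
    apply seq_rule.
    eapply (assign_rule _ _ _ (ha h a (lo + i) (base i + digit rad r i))).
    + exact I.
    + cbn; lia.
    + ev. repeat split; auto. rewrite Er, Erad, Ebase in Ead. rewrite Ead. lia.
    (* Nothing is known about the meaning of the cell that is read, so the bound on its value comes
       from [hbnd]. *)
    + intros Hb. ev. rewrite Er, Erad, Ebase in Ead. rewrite Ead, Nat2Z.id.
      fra F. split; auto.
      rewrite <- (proj2 F) by reflexivity. apply Hb.
    + eapply (assign_rule _ _ _ (Z.of_nat (quo rad (S i) r))).
      * exact I.
      * cbn; lia.
      * ev. auto.
      * intros Hb. ev. cbn [quo]. rewrite Nat2Z.inj_div. split; auto.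
        etransitivity; [apply Zdiv_abs_le|]. rewrite <- Er.
        pose proof (proj1 Hb Vrem 0) as Hb0. hs_in Hb0. exact Hb0.
      * split; [frm; auto|]. split; [hs; auto|]. split.
        -- intros j Lj. hs. destruct (Nat.eqb_spec j (lo + i)); [lia|]. apply Hout; lia.
        -- intros j Lj. hs. destruct (Nat.eqb_spec (lo + j) (lo + i)) as [Ej|Nj].
           ++ replace j with i by lia. auto.
           ++ apply Hin; lia.
  - intros h' _ (F & _ & H1 & H2). auto.
Qed.

Lemma if_rule e c1 c2 z (P : hst -> Prop) h :
  esize e <= 24 -> safe k B h e -> eval h e = z ->
  ((0 < z)%Z -> hsl c1 P h) -> ((z <= 0)%Z -> hsl c2 P h) ->
  hsl (ifp k e c1 c2) P h.
Proof. intros Sz Sf Ev H1 H2. subst z. eapply hsl_if; eauto. Qed.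

Definition Inp (h : hst) : Prop :=
  hv h VIn 0 = Z.of_nat D1 /\ hv h VIn 1 = Z.of_nat D2 /\
  (forall i, i < k -> hv h VIn (S (S i)) = Z.of_nat (length (R i))) /\
  (forall i p, i < k -> p < length (R i) ->
     ha h AIn (2 * i) p = Z.of_nat (fst (nth p (R i) (0, 0))) /\
     ha h AIn (2 * i + 1) p = Z.of_nat (snd (nth p (R i) (0, 0)))).

Lemma Inp_frame vs al h h' :
  Inp h -> frame vs al h h' ->
  existsb (veqb VIn) vs = false -> existsb (aeqb AIn) al = false -> Inp h'.
Proof.
  intros (A1 & A2 & A3 & A4) [F1 F2] Nv Na. unfold Inp.
  rewrite !F1 by auto. split; [auto|]. split; [auto|]. split.
  - intros. rewrite F1 by auto. auto.
  - intros. rewrite !F2 by auto. auto.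
Qed.

Lemma load_spec i p x y h :
  Inp h -> hv h Vp 0 = Z.of_nat p -> i < k -> p < length (R i) ->
  nth p (R i) (0, 0) = (x, y) ->
  hsl (load k i) (fun h' => h' = setv (setv h Vx 0 (Z.of_nat x)) Vy 0 (Z.of_nat y)) h.
Proof.
  intros (_ & _ & _ & A) Ep Li Lp Exy. destruct (A i p Li Lp) as [A1 A2].
  rewrite Exy in A1, A2. cbn [fst snd] in *.
  unfold load. apply seq_rule.
  eapply (assign_rule _ _ _ (Z.of_nat x)).
  - exact I.
  - cbn; lia.
  - ev. repeat split; auto; lia.
  - intros Hb. ev. rewrite Nat2Z.id, A1. split; auto. rewrite <- A1. apply Hb.
  - eapply (assign_rule _ _ _ (Z.of_nat y)).
    + exact I.
    + cbn; lia.
    + ev. repeat split; auto; lia.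
    + intros Hb. ev. rewrite Nat2Z.id, A2. split; auto. rewrite <- A2. apply Hb.
    + reflexivity.
Qed.

End Blocks.

Ltac with_env tac := lazymatch goal with E : Env _ _ _ _ _ |- _ => tac E end.
Ltac asg z := with_env ltac:(fun E =>
  eapply (assign_rule _ _ _ _ _ E _ _ _ z);
  [first [exact I|cbn; lia]|cbn; lia| | |]).
Ltac sto p z := with_env ltac:(fun E =>
  eapply (store_rule _ _ _ _ _ E _ _ _ _ p z);
  [first [exact I|cbn; lia]|cbn; lia|cbn; lia| | | | |]).
Ltac seq := eapply seq_rule.
Ltac spec := eapply spec_rule.

Lemma Forall2_nth {S T} (P : S -> T -> Prop) (d : S) (e : T) l m :
  Forall2 P l m <->
  length l = length m /\ forall i, i < length m -> P (nth i l d) (nth i m e).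
Proof.
  split.
  - intros H. split; [eapply Forall2_length; eauto|].
    induction H; intros i L; cbn in L; [lia|]. destruct i; cbn; auto. apply IHForall2; lia.
  - revert m. induction l; intros [|y m] [L H]; cbn in L; try lia; constructor.
    + apply (H 0). cbn; lia.
    + apply IHl. split; [lia|]. intros i Li. apply (H (Datatypes.S i)). cbn; lia.
Qed.

(** * The output set and the marked lists of heavy values *)

Section Sets.

Context (k : nat) (w B : Z) (Rs : list binrel) (D1 D2 Q : nat).
Hypothesis E : Env k w B Rs Q.

Notation hsl := (hsl k w B).
Notation hwp := (hwp k w B).
Notation R i := (nth i Rs (@nil (nat * nat))).

Lemma in_join_nth a b :
  in_join Rs a b <-> length a = k /\ forall i, i < k -> In (nth i a 0, b) (R i).
Proof.
  unfold in_join. rewrite (Forall2_nth _ 0 []).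
  pose proof (env_k _ _ _ _ _ E) as Ek. unfold binrel in *. rewrite Ek. tauto.
Qed.

Lemma star_out_length a : star_out Rs a -> length a = k.
Proof. intros [b H]. apply in_join_nth in H. tauto. Qed.

Lemma star_out_lt a x : star_out Rs a -> In x a -> x < Q.
Proof.
  intros [b H] Hx. apply in_join_nth in H. destruct H as [L H].
  apply (In_nth _ _ 0) in Hx. destruct Hx as (i & Li & <-).
  refine (proj1 (env_lt _ _ _ _ _ E i _ b _ (H i _))); lia.
Qed.

(** The last clause fixes [AVis] at every address; for the empty set it says that the array is
    blank, as it is initially. *)
Definition OutInv (OUT : list (list nat)) (h : hst) : Prop :=
  NoDup OUT /\ (forall a, In a OUT -> star_out Rs a) /\
  hv h Vcnt 0 = Z.of_nat (length OUT) /\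
  (forall p j, p < length OUT -> j < k ->
     ha h AOut j p = Z.of_nat (nth j (nth p OUT []) 0)) /\
  (forall c, ha h AVis 0 c =
     if in_dec Nat.eq_dec c (map (horner Q) OUT) then 1%Z else 0%Z).

Lemma OutInv_frame vs al OUT h h' :
  OutInv OUT h -> frame vs al h h' ->
  existsb (veqb Vcnt) vs = false -> existsb (aeqb AOut) al = false ->
  existsb (aeqb AVis) al = false -> OutInv OUT h'.
Proof.
  intros (A1 & A2 & A3 & A4 & A5) [F1 F2] N1 N2 N3. repeat split; auto.
  - rewrite F1; auto.
  - intros. rewrite F2; auto.
  - intros. rewrite F2; auto.
Qed.

(** The Horner codes of the tuples are distinct and below [Q ^ k]. This keeps the output counter
    within the bound [B]. *)
Lemma star_out_bound OUT :
  NoDup OUT -> (forall a, In a OUT -> star_out Rs a) -> length OUT <= Q ^ k.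
Proof.
  intros N H. rewrite <- (length_map (horner Q)). apply NoDup_lt_length.
  - apply NoDup_map_NoDup_ForallPairs; auto.
    intros a b Ha Hb. apply H in Ha, Hb. apply horner_inj.
    + now rewrite (star_out_length _ Ha), (star_out_length _ Hb).
    + intros x. apply star_out_lt; auto.
    + intros x. apply star_out_lt; auto.
  - intros c Hc. apply in_map_iff in Hc. destruct Hc as (a & <- & Ha).
    rewrite <- (star_out_length a) by auto. apply horner_lt.
    intros x; apply star_out_lt; auto.
Qed.

Lemma insert_spec OUT a h :
  OutInv OUT h -> hv h VQ 0 = Z.of_nat Q -> star_out Rs a ->
  (forall i, i < k -> hv h Vxs i = Z.of_nat (nth i a 0)) ->
  hsl (insert k) (fun h' => frame [Vcode; Vcnt] [AVis; AOut] h h' /\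
    exists OUT', OutInv OUT' h' /\ (forall b, In b OUT' <-> In b OUT \/ b = a)) h.
Proof.
  intros HO HQ Ha Hxs. pose proof (star_out_length _ Ha) as La.
  pose proof (Q_pos k w B Rs Q E) as Qp. pose proof (env_B2 _ _ _ _ _ E) as HB2.
  unfold insert. seq. asg 0%Z.
  { cbn; lia. } { intros _; cbn. lia. }
  set (h1 := setv h Vcode 0 0).
  seq. spec.
  { apply iter_rule with (I := fun i h' => frame [Vcode] [] h1 h' /\
      hv h' Vcode 0 = Z.of_nat (horner Q (firstn i a))).
    - split; [apply frame_refl|]. reflexivity.
    - intros i h2 Li [F Ec].
      assert (Ex : hv h2 Vxs i = Z.of_nat (nth i a 0)).
      { frv F. unfold h1. hs. auto. }
      assert (EQ : hv h2 VQ 0 = Z.of_nat Q).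
      { frv F. unfold h1. hs. auto. }
      asg (Z.of_nat (horner Q (firstn (S i) a))).
      + ev. auto.
      + intros _. ev. rewrite (firstn_S_nth 0) by lia. rewrite horner_snoc. split; [lia|].
        rewrite <- horner_snoc, <- firstn_S_nth by lia.
        apply (nat_B k w B Rs Q E) with (m := k) (c := 1); try lia.
        rewrite Nat.mul_1_l. etransitivity; [apply Nat.lt_le_incl, horner_lt|].
        * intros x Hx. eapply star_out_lt; [exact Ha|].
          rewrite <- (firstn_skipn (S i) a). apply in_or_app; auto.
        * apply Nat.pow_le_mono_r; [lia|]. rewrite length_firstn. lia.
      + split; [frm; auto|]. hs. auto. }
  intros h2 _ [F Ec]. cbn beta. rewrite <- La, firstn_all in Ec.
  assert (F2 : frame [Vcode] [] h h2).
  { eapply frame_trans; [|exact F|reflexivity|reflexivity]. unfold h1. frm. }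
  pose proof (OutInv_frame _ _ _ _ _ HO F2 eq_refl eq_refl eq_refl) as HO2.
  destruct HO2 as (O1 & O2 & O3 & O4 & O5).
  eapply (if_rule k w B Rs Q E).
  { cbn; lia. } { ev. repeat split; auto; lia. } { ev. rewrite Nat2Z.id. apply O5. }
  - destruct (in_dec Nat.eq_dec (horner Q a) (map (horner Q) OUT)) as [Hin|]; [|lia].
    intros _. apply hsl_skip. split.
    { fweak F2. }
    exists OUT. split; [repeat split; auto|].
    intros b. split; [auto|]. intros [Hb| ->]; auto.
    apply in_map_iff in Hin. destruct Hin as (b & Eb & Hb).
    replace a with b; auto. apply horner_inj with (q := Q); auto.
    + rewrite La, (star_out_length b); auto.
    + intros x. apply star_out_lt; auto.
    + intros x. apply star_out_lt; auto.
  - destruct (in_dec Nat.eq_dec (horner Q a) (map (horner Q) OUT)) as [|Hin]; [lia|].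
    intros _.
    assert (Na : ~ In a OUT) by (intros Hi; apply Hin; apply in_map; auto).
    assert (N' : NoDup (OUT ++ [a])).
    { apply NoDup_app; auto; [repeat constructor; auto|].
      intros x Hx [<-|[]]. auto. }
    assert (S' : forall b, In b (OUT ++ [a]) -> star_out Rs b).
    { intros b Hb. apply in_app_or in Hb. destruct Hb as [Hb|[<-|[]]]; auto. }
    pose proof (star_out_bound _ N' S') as Lb. rewrite length_app in Lb. cbn in Lb.
    seq. sto (horner Q a) 1%Z.
    { ev. auto. } { cbn; lia. } { ev. auto. } { intros _. cbn; lia. }
    set (h3 := seta h2 AVis 0 (horner Q a) 1%Z).
    seq. spec.
    { apply iter_rule with (I := fun i h' => frame [] [AOut] h3 h' /\
        forall j p, ha h' AOut j p = if (Nat.ltb j i && Nat.eqb p (length OUT))%bool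
                     then Z.of_nat (nth j a 0) else ha h2 AOut j p).
      - split; [apply frame_refl|]. intros. reflexivity.
      - intros i h4 Li [F4 G].
        assert (Ex : hv h4 Vxs i = Z.of_nat (nth i a 0)).
        { frv F4. unfold h3. hs.
          frv F2. auto. }
        assert (Ecn : hv h4 Vcnt 0 = Z.of_nat (length OUT)).
        { frv F4. unfold h3. hs. auto. }
        sto (length OUT) (Z.of_nat (nth i a 0)).
        + ev. auto.
        + ev. auto.
        + ev. auto.
        + intros Hb. ev. split; auto. rewrite <- Ex. apply Hb.
        + split; [frm; auto|]. intros j p. hs. rewrite G.
          destruct (Nat.eqb_spec j i) as [->|Nj]; cbn [andb].
          * replace (i <? S i) with true by (symmetry; apply Nat.ltb_lt; lia).
            replace (i <? i) with false by (symmetry; apply Nat.ltb_ge; lia).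
            cbn [andb]. destruct (p =? length OUT); auto.
          * replace (j <? S i) with (j <? i); auto.
            destruct (Nat.ltb_spec j i), (Nat.ltb_spec j (S i)); auto; lia. }
    intros h4 _ [F4 G]. cbn beta.
    assert (Ecn : hv h4 Vcnt 0 = Z.of_nat (length OUT)).
    { frv F4. unfold h3. hs. auto. }
    asg (Z.of_nat (length OUT + 1)).
    { ev. split; auto. cbn; lia. }
    { intros _. ev. split; [lia|].
      apply (nat_B k w B Rs Q E) with (m := k) (c := 1); lia. }
    assert (F5 : frame [Vcode; Vcnt] [AVis; AOut] h h4).
    { eapply frame_trans; [|exact F4|reflexivity|reflexivity]. unfold h3. frm.
      fweak F2. }
    split; [frm; exact F5|].
    exists (OUT ++ [a]). split.
    + split; [auto|]. split; [auto|]. split; [|split].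
      * hs. rewrite length_app. reflexivity.
      * intros p j Lp Lj. hs. rewrite G. rewrite length_app in Lp. cbn in Lp.
        replace (j <? k) with true by (symmetry; apply Nat.ltb_lt; lia). cbn [andb].
        destruct (Nat.eqb_spec p (length OUT)) as [->|Np].
        -- rewrite nth_middle. auto.
        -- rewrite app_nth1 by lia. apply O4; lia.
      * intros c. hs. fra F4. unfold h3. hs. rewrite O5.
        rewrite map_app. cbn [map].
        destruct (Nat.eqb_spec c (horner Q a)) as [->|Nc].
        -- destruct (in_dec _ _ _) as [|N]; auto. exfalso. apply N. apply in_or_app. cbn; auto.
        -- destruct (in_dec _ c (map _ OUT)) as [I1|N1];
           destruct (in_dec _ c (map _ OUT ++ _)) as [I2|N2]; auto; exfalso.
           ++ apply N2, in_or_app; auto.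
           ++ apply in_app_or in I2. destruct I2 as [I2|[I2|[]]]; auto.
    + intros b. rewrite in_app_iff. cbn. intuition congruence.
Qed.

(** The list is described at every index, with the default 0 past its end, because [fill] reads
    [AHY] there in an overhanging block. *)
Definition SetInv (v : vname) (al am : aname) (i : nat) (l : list nat) (h : hst) : Prop :=
  NoDup l /\ hv h v i = Z.of_nat (length l) /\
  (forall d, ha h al i d = Z.of_nat (nth d l 0)) /\
  (forall x, ha h am i x = if in_dec Nat.eq_dec x l then 1%Z else 0%Z).

(** The expression is evaluated again after some of the writes. The hypothesis on [h'] says that its
    value depends only on variables other than [v], so these evaluations agree. *)
Lemma push_spec v al am i e l x h :
  SetInv v al am i l h -> okv k v i -> v <> VIn -> al <> AIn -> am <> AIn -> al <> am ->
  esize e <= 20 -> eval h e = Z.of_nat x -> safe k B h e ->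
  (forall h', (forall v' i', v' <> v -> hv h' v' i' = hv h v' i') ->
     eval h' e = Z.of_nat x /\ safe k B h' e) ->
  (forall y, In y (x :: l) -> y < Q) ->
  hsl (push k v al am i e) (fun h' => frame [v] [al; am] h h' /\
    (exists l', SetInv v al am i l' h' /\ (forall y, In y l' <-> In y l \/ y = x)) /\
    forall j, j <> i -> hv h' v j = hv h v j /\
      forall p, ha h' al j p = ha h al j p /\ ha h' am j p = ha h am j p) h.
Proof.
  intros (S1 & S2 & S3 & S4) Ov Nv Nal Nam Naa Se Ee Sf He Hlt.
  assert (Oal : oka k al i) by (destruct al; cbn; tauto).
  assert (Oam : oka k am i) by (destruct am; cbn; tauto).
  pose proof (env_B2 _ _ _ _ _ E) as HB2.
  unfold push. eapply (if_rule k w B Rs Q E).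
  { cbn; lia. } { cbn [safe]. rewrite Ee. repeat split; auto; lia. }
  { cbn [eval]. rewrite Ee, Nat2Z.id. apply S4. }
  - destruct (in_dec _ x l) as [Hin|]; [|lia]. intros _.
    apply hsl_skip.
    split; [apply frame_refl|]. split; [|auto].
    exists l. split; [repeat split; auto|]. intros y. intuition congruence.
  - destruct (in_dec _ x l) as [|Hin]; [lia|]. intros _.
    assert (N' : NoDup (l ++ [x])).
    { apply NoDup_app; auto; [repeat constructor; auto|]. intros z Hz [<-|[]]. auto. }
    assert (Lq : length (l ++ [x]) <= Q).
    { apply NoDup_lt_length; auto. intros y Hy. apply Hlt.
      apply in_app_or in Hy. cbn in *. tauto. }
    rewrite length_app in Lq. cbn in Lq.
    assert (Xq : x < Q) by (apply Hlt; cbn; auto).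
    seq. eapply (store_rule k w B Rs Q E _ _ _ _ x 1%Z); auto; try (cbn; lia).
    set (h1 := seta h am i x 1%Z).
    destruct (He h1 ltac:(intros; reflexivity)) as [Ee1 Sf1].
    seq. eapply (store_rule k w B Rs Q E _ _ _ _ (length l) (Z.of_nat x)); auto; try (cbn; lia).
    { intros _. split; [auto|]. apply (nat_BQ k w B Rs Q E); lia. }
    set (h2 := seta h1 al i (length l) (Z.of_nat x)).
    eapply (assign_rule k w B Rs Q E _ _ _ (Z.of_nat (length l + 1))); auto; try (cbn; lia).
    { cbn [safe]. split; auto. cbn; lia. }
    { intros _. cbn [eval eval_op]. unfold h2, h1. hs. rewrite S2. split; [lia|].
      apply (nat_BQ k w B Rs Q E); lia. }
    assert (Vv : veqb v v = true) by (destruct (veqb_spec v v); congruence).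
    assert (Aal : aeqb al al = true) by (destruct (aeqb_spec al al); congruence).
    assert (Aam : aeqb am am = true) by (destruct (aeqb_spec am am); congruence).
    assert (Alm : aeqb al am = false) by (destruct (aeqb_spec al am); congruence).
    assert (Aml : aeqb am al = false) by (destruct (aeqb_spec am al); congruence).
    split; [|split].
    + apply frame_setv; [|cbn; now rewrite Vv].
      unfold h2, h1. apply frame_seta; [|cbn; now rewrite Aal].
      apply frame_seta; [|cbn; now rewrite Aam, orb_true_r]. apply frame_refl.
    + exists (l ++ [x]). split; [|intros y; rewrite in_app_iff; cbn; intuition congruence].
      split; [auto|]. split; [|split].
      * rewrite hv_setv, Vv, Nat.eqb_refl. rewrite length_app. reflexivity.
      * intros d. rewrite ha_setv. unfold h2, h1. rewrite !ha_seta.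
        rewrite Aal, Alm, Nat.eqb_refl. cbn [andb]. rewrite S3.
        destruct (Nat.eqb_spec d (length l)) as [->|Nd]; [now rewrite nth_middle|].
        destruct (Nat.lt_ge_cases d (length l)); [now rewrite app_nth1|].
        rewrite !nth_overflow; auto. rewrite length_app. cbn. lia.
      * intros y. rewrite ha_setv. unfold h2, h1. rewrite !ha_seta.
        rewrite Aam, Aml, Nat.eqb_refl. cbn [andb]. rewrite S4.
        destruct (Nat.eqb_spec y x) as [->|Ny].
        -- destruct (in_dec _ _ _) as [|N]; auto. exfalso. apply N, in_or_app. cbn; auto.
        -- destruct (in_dec _ y l) as [I1|N1];
           destruct (in_dec _ y (l ++ [x])) as [I2|N2]; auto; exfalso.
           ++ apply N2, in_or_app; auto.
           ++ apply in_app_or in I2. destruct I2 as [I2|[I2|[]]]; auto.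
    + intros j Nj. assert (Nj' : j =? i = false) by (apply Nat.eqb_neq; auto).
      split; [|intros p; split].
      * rewrite hv_setv, Nj', andb_false_r. reflexivity.
      * rewrite ha_setv. unfold h2, h1. rewrite !ha_seta, Nj'. cbn [andb].
        rewrite !andb_false_r. reflexivity.
      * rewrite ha_setv. unfold h2, h1. rewrite !ha_seta, Nj'. cbn [andb].
        rewrite !andb_false_r. reflexivity.
Qed.

End Sets.

(** * The stride and the dictionaries of the relations *)

Definition weight (l : binrel) : nat :=
  list_sum (map (fun t => fst t + snd t + 1) l).

(** A sum instead of a maximum: it costs one addition chain per tuple, and the unit added for each
    tuple makes it exceed the sizes of the relations too. *)
Definition stride (Rs : list binrel) : nat := S (weight (concat Rs)).

Lemma weight_app l m : weight (l ++ m) = weight l + weight m.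
Proof. unfold weight. now rewrite map_app, list_sum_app. Qed.

Lemma pair_dec (s t : nat * nat) : {s = t} + {s <> t}.
Proof. decide equality; apply Nat.eq_dec. Qed.

Section Building.

Context (k : nat) (w B : Z) (Rs : list binrel) (D1 D2 Q : nat).
Hypothesis E : Env k w B Rs Q.

Notation hsl := (hsl k w B).
Notation hwp := (hwp k w B).
Notation R i := (nth i Rs (@nil (nat * nat))).
Notation Inp := (Inp k Rs D1 D2).

Let HB2 := env_B2 _ _ _ _ _ E.
Let HBw := env_Bw _ _ _ _ _ E.

Definition for_cost (v : vname) (e : expr) : nat :=
  csz (for_init k v e) + csz (for_next k v e) + 2.

(** The invariant has to be insensitive to [Vp], so that advancing the loop counter preserves it
    without further argument. *)
Lemma tuples_rule i body T (I : nat -> hst -> Prop) h :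
  i < k ->
  (forall p h', I p h' -> Inp h') ->
  (forall p h' z, I p h' -> I p (setv h' Vp 0 z)) ->
  (forall p x y h', p < length (R i) -> nth p (R i) (0, 0) = (x, y) -> I p h' ->
     hv h' Vp 0 = Z.of_nat p ->
     hwp body (T p) (fun h2 => hv h2 Vp 0 = Z.of_nat p /\ I (S p) h2) h') ->
  I 0 h ->
  hwp (for_loop k Vp (size_of i) body)
    (for_cost Vp (size_of i) +
     sumn (fun p => T p + for_cost Vp (size_of i)) (length (R i)))
    (I (length (R i))) h.
Proof.
  intros Li HI HV HS H0.
  assert (Ei : forall p h', I p h' -> hv h' VIn (S (S i)) = Z.of_nat (length (R i))).
  { intros p h' Hp. apply HI in Hp. apply Hp; auto. }
  eapply hwp_mono; [eapply (hwp_for k w B HB2 HBw) with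
    (I := fun p h' => I p h' /\ hv h' Vp 0 = Z.of_nat p) (T := T) (n := length (R i))| |].
  - cbn; lia.
  - exact Logic.I.
  - pose proof (env_len _ _ _ _ _ E i Li) as Ll.
    pose proof (nat_BQ k w B Rs Q E (length (R i)) ltac:(lia)). lia.
  - cbn. lia.
  - split; auto.
  - intros p h' Lp _ [Hp Ep]. split; [cbn; lia|]. split; auto. apply (Ei p); auto.
  - intros p h' Lp _ [Hp Ep]. destruct (nth p (R i) (0, 0)) as [x y] eqn:Exy.
    eapply hwp_mono; [eapply HS; eauto|reflexivity|].
    intros h2 _ [Ep2 Hp2]. split; [auto|]. split; [cbn; lia|]. split; [auto|].
    reflexivity.
  - unfold for_cost.
    pose proof (sumn_le (fun p => T p + (csz (for_next k Vp (size_of i)) + 1))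
      (fun p => T p + (csz (for_init k Vp (size_of i)) + csz (for_next k Vp (size_of i)) + 2))
      (length (R i)) ltac:(intros; cbv beta; lia)). lia.
  - intros h' _ [Hp _]. exact Hp.
Qed.

Lemma set_stride_spec h :
  Inp h -> Q = stride Rs ->
  hwp (set_stride k)
    (csz (assign k VQ 0 1%Z) + S (sumn (fun i => for_cost Vp (size_of i) +
       sumn (fun p => csz (load k i ;; assign k VQ 0 (qv + ((xv + yv) + 1%Z))%e)
                      + for_cost Vp (size_of i)) (length (R i))) k))
    (fun h' => frame [VQ; Vx; Vy; Vp] [] h h' /\ hv h' VQ 0 = Z.of_nat Q) h.
Proof.
  intros HI HQ. pose proof (Q_pos k w B Rs Q E) as Qp.
  pose proof (env_k _ _ _ _ _ E) as Ek.
  unfold set_stride. eapply hwp_seq; [|reflexivity].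
  asg 1%Z. { cbn; lia. } { intros _; cbn; lia. }
  set (h1 := setv h VQ 0 1%Z).
  eapply hwp_mono; [eapply hwp_iter with (I := fun i h' =>
     frame [VQ; Vx; Vy; Vp] [] h h' /\
     hv h' VQ 0 = Z.of_nat (S (weight (concat (firstn i Rs)))))|reflexivity|].
  - split; [unfold h1; frm|]. reflexivity.
  - intros i h2 Li [F Eq].
    assert (Hcc : concat Rs = concat (firstn i Rs) ++ R i ++ concat (skipn (S i) Rs)).
    { rewrite <- (firstn_skipn i Rs) at 1. rewrite concat_app. f_equal.
      change (R i ++ concat (skipn (S i) Rs)) with (concat (R i :: skipn (S i) Rs)).
      f_equal. clear -Ek Li. unfold binrel in *. subst k. revert i Li.
      induction Rs; intros i Li; cbn in Li; [lia|]. destruct i; cbn; auto.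
      apply IHl. lia. }
    eapply hwp_mono; [eapply tuples_rule with (i := i) (I := fun p h' =>
      frame [VQ; Vx; Vy; Vp] [] h h' /\
      hv h' VQ 0 = Z.of_nat (S (weight (concat (firstn i Rs)) + weight (firstn p (R i)))))
      (T := fun _ => csz (load k i ;; assign k VQ 0 (qv + ((xv + yv) + 1%Z))%e))| |].
    + auto.
    + intros p h' [F' _]. eapply Inp_frame; eauto.
    + intros p h' z [F' Eq']. split; [frm; auto|]. hs; auto.
    + intros p x y h' Lp Exy [F' Eq'] Ep.
      assert (HI' : Inp h') by (eapply Inp_frame; eauto).
      seq. spec; [eapply (load_spec k w B Rs D1 D2 Q E); eauto|].
      intros h3 _ ->.
      assert (Ew : weight (firstn (S p) (R i)) = weight (firstn p (R i)) + (x + y + 1)).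
      { rewrite (firstn_S_nth (0, 0)) by auto. rewrite weight_app, Exy. cbn. lia. }
      asg (Z.of_nat (S (weight (concat (firstn i Rs)) + weight (firstn (S p) (R i))))).
      * ev. repeat split; auto; cbn; lia.
      (* A partial sum is at most the final value [Q], since the tuples still to come have
         nonnegative weight. *)
      * intros _. ev. split; [lia|]. apply (nat_BQ k w B Rs Q E).
        rewrite HQ. unfold stride. rewrite Hcc, !weight_app.
        rewrite <- (firstn_skipn (S p) (R i)) at 2. rewrite weight_app. lia.
      * split; [hs; auto|]. split; [frm; auto|]. hs. auto.
    + split; [auto|]. cbn. rewrite Nat.add_0_r. auto.
    + reflexivity.
    + intros h' _ [F' Eq']. split; auto. rewrite Eq'. rewrite firstn_all.
      rewrite (@firstn_S_nth binrel []) by lia.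
      rewrite concat_app, weight_app. cbn [concat]. now rewrite app_nil_r.
  - intros h' _ [F Eq]. split; auto. rewrite Eq, HQ. unfold stride.
    rewrite <- Ek. now rewrite firstn_all.
Qed.

(** The keys of [AL] and [AAdj] are two-digit codes in base [Q], which are injective only if the
    second digit is below [Q]; hence the restricted quantifiers there. *)
Definition Bld1 (j : nat) (l : binrel) (h : hst) : Prop :=
  (forall y, ha h ACnt j y = Z.of_nat (length (sec l y))) /\
  (forall y d, y < Q -> d < length (sec l y) ->
     ha h AL j (y * Q + d) = Z.of_nat (nth d (sec l y) 0)) /\
  (forall x, ha h ADx j x = Z.of_nat (length (sec2 l x))) /\
  (forall x y, y < Q ->
     ha h AAdj j (x * Q + y) = if in_dec pair_dec (x, y) l then 1%Z else 0%Z).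

Lemma Bld1_frame vs al j l h h' :
  Bld1 j l h -> frame vs al h h' ->
  existsb (aeqb ACnt) al = false -> existsb (aeqb AL) al = false ->
  existsb (aeqb ADx) al = false -> existsb (aeqb AAdj) al = false -> Bld1 j l h'.
Proof.
  intros (B1 & B2 & B3 & B4) [_ F] N1 N2 N3 N4.
  repeat split; intros; rewrite F; auto.
Qed.

Notation build_tuple := (build_tuple k).

Lemma build_tuple_spec i p x y pre h :
  i < k -> Inp h -> hv h VQ 0 = Z.of_nat Q -> hv h Vp 0 = Z.of_nat p ->
  p < length (R i) -> nth p (R i) (0, 0) = (x, y) ->
  (forall j, j < k -> Bld1 j (pre j) h) ->
  pre i = firstn p (R i) ->
  hsl (build_tuple i) (fun h' =>
    frame [Vx; Vy; Vd] [AL; ACnt; ADx; AAdj] h h' /\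
    (forall j, j < k -> Bld1 j (if j =? i then firstn (S p) (R i) else pre j) h')) h.
Proof.
  intros Li HI EQ Ep Lp Exy HB Epre.
  pose proof (Q_pos k w B Rs Q E) as Qp.
  assert (Hin : In (x, y) (R i)) by (rewrite <- Exy; apply nth_In; auto).
  destruct (env_lt _ _ _ _ _ E i x y Li Hin) as [Lx Ly].
  pose proof (env_len _ _ _ _ _ E i Li) as Ll.
  assert (Lc : length (sec (pre i) y) <= p).
  { rewrite Epre. etransitivity; [apply sec_length|]. rewrite length_firstn. lia. }
  assert (Lc2 : length (sec2 (pre i) x) <= p).
  { rewrite Epre. etransitivity; [apply sec2_length|]. rewrite length_firstn. lia. }
  destruct (HB i Li) as (B1 & B2 & B3 & B4).
  unfold build_tuple. seq. spec; [eapply (load_spec k w B Rs D1 D2 Q E); eauto|].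
  intros h1 _ ->. set (d := length (sec (pre i) y)) in *.
  seq. asg (Z.of_nat d).
  { ev. repeat split; auto; lia. }
  { intros _. ev. rewrite Nat2Z.id, B1. split; auto. apply (nat_BQ k w B Rs Q E). lia. }
  seq. sto (y * Q + d) (Z.of_nat x).
  { ev. auto. } { ev. auto. } { ev. lia. }
  { intros _. ev. split; auto. apply (nat_BQ k w B Rs Q E). lia. }
  seq. sto y (Z.of_nat (d + 1)).
  { ev. auto. } { ev. repeat split; auto; cbn; lia. } { ev. auto. }
  { intros _. ev. split; [lia|]. apply (nat_BQ k w B Rs Q E). lia. }
  seq. sto x (Z.of_nat (length (sec2 (pre i) x) + 1)).
  { ev. auto. } { ev. repeat split; auto; cbn; lia. } { ev. auto. }
  { intros _. ev. rewrite Nat2Z.id, B3. split; [lia|]. apply (nat_BQ k w B Rs Q E). lia. }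
  sto (x * Q + y) 1%Z.
  { ev. auto. } { cbn; lia. } { ev. lia. } { intros _. cbn; lia. }
  split; [frm|].
  assert (Es : firstn (S p) (R i) = pre i ++ [(x, y)]).
  { rewrite (firstn_S_nth (0, 0)) by auto. now rewrite Exy, Epre. }
  intros j Lj. destruct (Nat.eqb_spec j i) as [->|Nj].
  - rewrite Es. split; [|split; [|split]].
    + intros y'. hs. rewrite Nat.eqb_refl. cbn [andb]. rewrite sec_snoc, length_app.
      rewrite (Nat.eqb_sym y y'). destruct (Nat.eqb_spec y' y) as [->|Ny].
      * fold d. cbn. lia.
      * cbn [length]. rewrite Nat.add_0_r. apply B1.
    + intros y' d' Ly' Ld'. hs. rewrite Nat.eqb_refl. cbn [andb].
      rewrite sec_snoc in *. rewrite length_app in Ld'.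
      (* Both offsets count tuples of one relation, so they are below [Q] and equal addresses mean
         equal pairs. *)
      destruct (Nat.eqb_spec (y' * Q + d') (y * Q + d)) as [Ea|Na].
      * assert (d' < Q).
        { assert (length (sec (pre i) y') <= p); [|destruct (y =? y'); cbn in Ld'; lia].
          rewrite Epre. etransitivity; [apply sec_length|]. rewrite length_firstn. lia. }
        apply stride_inj in Ea; [|lia|lia]. destruct Ea as [-> ->].
        rewrite Nat.eqb_refl. unfold d. now rewrite nth_middle.
      * destruct (Nat.eqb_spec y y') as [->|Ny]; cbn [length] in Ld'.
        -- assert (d' <> d) by congruence. fold d in Ld'.
           rewrite app_nth1 by (fold d; lia). apply B2; auto. fold d; lia.
        -- rewrite app_nil_r. apply B2; auto. lia.
    + intros x'. hs. rewrite Nat.eqb_refl. cbn [andb]. rewrite sec2_snoc, length_app.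
      rewrite (Nat.eqb_sym x x'). destruct (Nat.eqb_spec x' x) as [->|Ny].
      * cbn. lia.
      * cbn [length]. rewrite Nat.add_0_r. apply B3.
    + intros x' y' Ly'. hs. rewrite Nat.eqb_refl. cbn [andb].
      destruct (Nat.eqb_spec (x' * Q + y') (x * Q + y)) as [Ea|Na].
      * apply stride_inj in Ea; [|lia|lia]. destruct Ea as [-> ->].
        destruct (in_dec _ _ _) as [|N]; auto. exfalso. apply N, in_or_app. cbn; auto.
      * rewrite B4 by auto.
        destruct (in_dec _ _ (pre i)) as [I1|N1];
        destruct (in_dec _ _ (pre i ++ _)) as [I2|N2]; auto; exfalso.
        -- apply N2, in_or_app; auto.
        -- apply in_app_or in I2. destruct I2 as [I2|[I2|[]]]; auto.
           inversion I2; subst; auto.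
  - destruct (HB j Lj) as (C1 & C2 & C3 & C4).
    assert (Nji : (j =? i) = false) by (apply Nat.eqb_neq; auto).
    repeat split; intros; hs; rewrite Nji; cbn [andb]; auto.
Qed.

Definition Built (h : hst) : Prop := forall j, j < k -> Bld1 j (R j) h.

Lemma Built_frame vs al h h' :
  Built h -> frame vs al h h' ->
  existsb (aeqb ACnt) al = false -> existsb (aeqb AL) al = false ->
  existsb (aeqb ADx) al = false -> existsb (aeqb AAdj) al = false -> Built h'.
Proof. intros H F N1 N2 N3 N4 j Lj. eapply Bld1_frame; eauto. Qed.

Lemma build_spec h :
  Inp h -> hv h VQ 0 = Z.of_nat Q ->
  (forall a i p, a <> AIn -> ha h a i p = 0%Z) ->
  hwp (build k)
    (S (sumn (fun i => for_cost Vp (size_of i) +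
       sumn (fun p => csz (build_tuple i) + for_cost Vp (size_of i)) (length (R i))) k))
    (fun h' => frame [Vx; Vy; Vd; Vp] [AL; ACnt; ADx; AAdj] h h' /\ Built h') h.
Proof.
  intros HI HQ H0.
  (* The part of relation [j] that has been read when [p] tuples of relation [i] are done. *)
  set (pre := fun i p j => if j <? i then R j else if j =? i then firstn p (R i) else []).
  assert (Hpre : forall i j, pre i (length (R i)) j = pre (S i) 0 j).
  { intros i j. unfold pre. rewrite firstn_all.
    destruct (Nat.ltb_spec j i), (Nat.ltb_spec j (S i)), (Nat.eqb_spec j i),
      (Nat.eqb_spec j (S i)); subst; auto; lia. }
  eapply hwp_mono; [eapply hwp_iter with (I := fun i h' =>
     frame [Vx; Vy; Vd; Vp] [AL; ACnt; ADx; AAdj] h h' /\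
     forall j, j < k -> Bld1 j (pre i 0 j) h')|reflexivity|].
  - split; [apply frame_refl|]. intros j Lj.
    replace (pre 0 0 j) with (@nil (nat * nat)).
    + repeat split; intros; try (rewrite H0 by discriminate; reflexivity).
      cbn in *; lia.
    + unfold pre. cbn. destruct (j =? 0); auto.
  - intros i h2 Li [F HB].
    eapply hwp_mono; [eapply tuples_rule with (i := i) (I := fun p h' =>
      frame [Vx; Vy; Vd; Vp] [AL; ACnt; ADx; AAdj] h h' /\
      forall j, j < k -> Bld1 j (pre i p j) h') (T := fun _ => csz (build_tuple i))| |].
    + auto.
    + intros p h' [F' _]. eapply Inp_frame; eauto.
    + intros p h' z [F' HB']. split; [frm; auto|]. intros j Lj.
      eapply Bld1_frame; [apply HB'; auto|apply (frame_setv [Vp] []); [apply frame_refl|reflexivity]|reflexivity..].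
    + intros p x y h' Lp Exy [F' HB'] Ep.
      assert (HI' : Inp h') by (eapply Inp_frame; eauto).
      eapply hwp_mono; [eapply (build_tuple_spec i p x y (pre i p)); eauto|reflexivity|].
      * rewrite (proj1 F') by reflexivity. auto.
      * unfold pre. rewrite Nat.ltb_irrefl, Nat.eqb_refl. reflexivity.
      * intros h3 _ [F3 HB3]. split; [|split].
        -- frv F3. auto.
        -- eapply frame_trans; eauto.
        -- intros j Lj. specialize (HB3 j Lj). unfold pre in *.
           destruct (Nat.ltb_spec j i), (Nat.eqb_spec j i); auto; lia.
    + split; auto.
    + reflexivity.
    + intros h' _ [F' HB']. split; auto. intros j Lj. rewrite <- Hpre. auto.
  - intros h' _ [F HB]. split; auto. intros j Lj. specialize (HB j Lj).
    replace (R j) with (pre k 0 j); auto. unfold pre.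
    destruct (Nat.ltb_spec j k); auto; lia.
Qed.

End Building.

Lemma nth_map_seq (f : nat -> nat) n i : i < n -> nth i (map f (seq 0 n)) 0 = f i.
Proof.
  intros L. rewrite nth_indep with (d' := f 0) by (rewrite length_map, length_seq; auto).
  rewrite map_nth, seq_nth; auto.
Qed.

Lemma prodn_factor_pos f n i : 0 < prodn f n -> i < n -> 0 < f i.
Proof.
  intros P L. destruct (prodn_split f n i L) as [c Ec].
  destruct (f i); [|lia]. rewrite Nat.mul_0_r in Ec. cbn in Ec. lia.
Qed.

(** * The light phase *)

Section Light.

Context (k : nat) (w B : Z) (Rs : list binrel) (D1 D2 Q : nat).
Hypothesis E : Env k w B Rs Q.

Notation hsl := (hsl k w B).
Notation hwp := (hwp k w B).
Notation R i := (nth i Rs (@nil (nat * nat))).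
Notation Inp := (Inp k Rs D1 D2).
Notation OutInv := (OutInv k Rs Q).
Notation Built := (Built k Rs Q).
Notation for_cost := (for_cost k).

Let HB2 := env_B2 _ _ _ _ _ E.
Let HBw := env_Bw _ _ _ _ _ E.

(** The prefix length [n] is there for the invariant of the loop over the relations; lightness
    proper is the case [n = k]. *)
Definition light_y (n y : nat) : bool :=
  forallb (fun i => length (sec (R i) y) <=? D1) (seq 0 n).

Definition light (j x y : nat) : bool :=
  (length (sec2 (R j) x) <=? D2) || light_y k y.

Definition lrad (j y i : nat) : nat := if i =? j then 1 else length (sec (R i) y).

Definition ltot (j y : nat) : nat := prodn (lrad j y) k.

Definition ltup (j x y t : nat) : list nat :=
  map (fun i => if i =? j then x else nth (digit (lrad j y) t i) (sec (R i) y) 0) (seq 0 k).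

Lemma lrad_le j y i : i < k -> lrad j y i <= Q.
Proof.
  intros L. unfold lrad. destruct (i =? j); [apply (Q_pos k w B Rs Q E)|].
  pose proof (sec_length (R i) y). pose proof (env_len _ _ _ _ _ E i L). lia.
Qed.

Lemma lrad_prod_B j y n : n <= k -> (Z.abs (Z.of_nat (prodn (lrad j y) n)) <= B)%Z.
Proof.
  intros L. apply (nat_B k w B Rs Q E) with (m := n) (c := 1); try lia.
  rewrite Nat.mul_1_l. apply prodn_le. intros; apply lrad_le; lia.
Qed.

(** A counter below [ltot] exists only if all radices are positive, and then every digit is a valid
    position in its list of partners. *)
Lemma ltup_star j x y t :
  j < k -> In (x, y) (R j) -> t < ltot j y -> star_out Rs (ltup j x y t).
Proof.
  intros Lj Hin Lt. exists y. apply (in_join_nth k w B Rs Q E). split.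
  - unfold ltup. now rewrite length_map, length_seq.
  - intros i Li. unfold ltup. rewrite nth_map_seq by auto.
    destruct (Nat.eqb_spec i j) as [->|Nj]; auto.
    apply in_sec. apply nth_In.
    assert (P : 0 < lrad j y i) by (eapply (prodn_factor_pos _ k); [unfold ltot in Lt; lia|auto]).
    pose proof (digit_lt (lrad j y) t i P) as D. unfold lrad in D at 2.
    destruct (Nat.eqb_spec i j); [contradiction|auto].
Qed.

Lemma ltup_complete j a b :
  j < k -> in_join Rs a b -> exists t, t < ltot j b /\ ltup j (nth j a 0) b t = a.
Proof.
  intros Lj H. apply (in_join_nth k w B Rs Q E) in H. destruct H as [La H].
  assert (G : forall i, i < k -> exists d, d < lrad j b i /\
     (i <> j -> nth d (sec (R i) b) 0 = nth i a 0)).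
  { intros i Li. unfold lrad. destruct (Nat.eqb_spec i j).
    - exists 0. split; [lia|tauto].
    - specialize (H i Li). apply in_sec in H. apply (In_nth _ _ 0) in H.
      destruct H as (d & Ld & Ed). exists d. auto. }
  (* The positions are gathered into one function by finite choice, with an induction on the number
     of relations. *)
  assert (G' : exists d, forall i, i < k -> d i < lrad j b i /\
     (i <> j -> nth (d i) (sec (R i) b) 0 = nth i a 0)).
  { clear -G. induction k as [|n IH].
    - exists (fun _ => 0). intros; lia.
    - destruct IH as [d Hd]; [intros; apply G; lia|].
      destruct (G n ltac:(lia)) as (dn & Hn).
      exists (fun i => if i =? n then dn else d i). intros i Li.
      destruct (Nat.eqb_spec i n); [subst; auto|apply Hd; lia]. }
  destruct G' as [d Hd].
  destruct (digits_exist (lrad j b) d k) as (t & Lt & Dt).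
  { intros i Li. apply Hd; auto. }
  exists t. split; [exact Lt|].
  apply (nth_ext _ _ 0 0).
  - unfold ltup. now rewrite length_map, length_seq.
  - intros i Li. unfold ltup in *. rewrite length_map, length_seq in Li.
    rewrite nth_map_seq by auto. destruct (Nat.eqb_spec i j); [subst; auto|].
    rewrite Dt by auto. apply Hd; auto.
Qed.

Definition LightState (j x y : nat) (h : hst) : Prop :=
  hv h Vx 0 = Z.of_nat x /\ hv h Vy 0 = Z.of_nat y /\
  hv h Vok 0 = (if light j x y then 1 else 0)%Z /\
  hv h Vtot 0 = Z.of_nat (ltot j y) /\
  (forall i, i < k -> hv h Vbase i = Z.of_nat (y * Q) /\ hv h Vrad i = Z.of_nat (lrad j y i)).

Lemma LightState_frame vs al j x y h h' :
  LightState j x y h -> frame vs al h h' ->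
  forallb (fun v => negb (existsb (veqb v) vs)) [Vx; Vy; Vok; Vtot; Vbase; Vrad] = true ->
  LightState j x y h'.
Proof.
  intros (A1 & A2 & A3 & A4 & A5) [F _] N. rewrite forallb_forall in N.
  assert (N' : forall v, In v [Vx; Vy; Vok; Vtot; Vbase; Vrad] ->
    existsb (veqb v) vs = false) by (intros v Hv; apply negb_true_iff; auto).
  cbn in N'. unfold LightState. rewrite !F by (apply N'; tauto).
  repeat split; auto; rewrite F by (apply N'; tauto); apply A5; auto.
Qed.

Lemma light_tuple_spec j p x y h :
  j < k -> Inp h -> Built h -> hv h VQ 0 = Z.of_nat Q -> hv h Vp 0 = Z.of_nat p ->
  p < length (R j) -> nth p (R j) (0, 0) = (x, y) ->
  hsl (light_tuple k j) (fun h' =>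
    frame [Vx; Vy; Vok; Vtot; Vbase; Vrad] [] h h' /\ LightState j x y h') h.
Proof.
  intros Lj HI HBt EQ Ep Lp Exy.
  pose proof (Q_pos k w B Rs Q E) as Qp.
  assert (Hin : In (x, y) (R j)) by (rewrite <- Exy; apply nth_In; auto).
  destruct (env_lt _ _ _ _ _ E j x y Lj Hin) as [Lx Ly].
  unfold light_tuple. seq. spec; [eapply (load_spec k w B Rs D1 D2 Q E); eauto|].
  intros h1 _ ->.
  seq. asg 1%Z. { cbn; lia. } { intros _; cbn; lia. }
  seq. asg 1%Z. { cbn; lia. } { intros _; cbn; lia. }
  set (h1 := setv (setv (setv (setv h Vx 0 (Z.of_nat x)) Vy 0 (Z.of_nat y)) Vok 0 1%Z) Vtot 0 1%Z).
  assert (F1 : frame [Vx; Vy; Vok; Vtot; Vbase; Vrad] [] h h1) by (unfold h1; frm).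
  seq. spec.
  { eapply iter_rule with (I := fun n h' =>
      frame [Vok; Vtot; Vbase; Vrad] [] h1 h' /\
      hv h' Vok 0 = (if light_y n y then 1 else 0)%Z /\
      hv h' Vtot 0 = Z.of_nat (prodn (lrad j y) n) /\
      forall i, i < n -> hv h' Vbase i = Z.of_nat (y * Q) /\
                         hv h' Vrad i = Z.of_nat (lrad j y i)).
    - split; [apply frame_refl|]. split; [reflexivity|]. split; [reflexivity|].
      intros; lia.
    - intros n h2 Ln (F2 & Eok & Etot & Hbr).
      assert (F02 : frame [Vx; Vy; Vok; Vtot; Vbase; Vrad] [] h h2)
        by (ftrans F1 F2).
      assert (EQ2 : hv h2 VQ 0 = Z.of_nat Q) by (frv F02; auto).
      assert (Ey2 : hv h2 Vy 0 = Z.of_nat y) by (frv F2; reflexivity).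
      assert (Ecn : ha h2 ACnt n y = Z.of_nat (length (sec (R n) y))).
      { fra F02. apply HBt; auto. }
      assert (ED1 : hv h2 VIn 0 = Z.of_nat D1).
      { frv F02. apply HI. }
      seq. asg (Z.of_nat (y * Q)).
      { ev. auto. }
      { intros _. ev. split; [lia|]. apply (nat_BQ2 k w B Rs Q E); nia. }
      seq. eapply (assign_rule k w B Rs Q E _ _ _ (Z.of_nat (lrad j y n)));
        [exact I|destruct (n =? j); cbn; lia| | |].
      { destruct (n =? j); ev; repeat split; auto; cbn; lia. }
      { intros _. split; [|apply (nat_BQ k w B Rs Q E); pose proof (lrad_le j y n Ln); lia].
        unfold lrad. destruct (n =? j); ev; auto. rewrite Nat2Z.id. auto. }
      seq. asg (Z.of_nat (prodn (lrad j y) (S n))).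
      { ev. auto. }
      { intros _. ev. rewrite Nat.eqb_refl. cbn [prodn]. split; [lia|].
        apply (lrad_prod_B j y (S n)); lia. }
      eapply (if_rule k w B Rs Q E _ _ _
        (Z.of_nat (length (sec (R n) y)) - Z.of_nat D1)%Z).
      { cbn; lia. }
      { ev. repeat split; auto; cbn; lia. }
      { ev. rewrite Nat2Z.id. now rewrite Ecn. }
      + intros Hgt. asg 0%Z. { cbn; lia. } { intros _; cbn; lia. }
        split; [frm; auto|]. split; [|split].
        * hs. unfold light_y. rewrite seq_S, forallb_app. cbn [forallb Nat.add].
          replace (length (sec (R n) y) <=? D1) with false; [now rewrite andb_false_r|].
          symmetry. apply Nat.leb_gt. lia.
        * hs. reflexivity.
        * intros i Li. hs. destruct (Nat.eqb_spec i n) as [->|Nn]; auto.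
          apply Hbr; lia.
      + intros Hle. apply hsl_skip.
        split; [frm; auto|]. split; [|split].
        * hs. unfold light_y in *. rewrite seq_S, forallb_app. cbn [forallb Nat.add].
          replace (length (sec (R n) y) <=? D1) with true; [|symmetry; apply Nat.leb_le; lia].
          rewrite !andb_true_r. auto.
        * hs. reflexivity.
        * intros i Li. hs. destruct (Nat.eqb_spec i n) as [->|Nn]; auto.
          apply Hbr; lia. }
  intros h2 _ (F2 & Eok & Etot & Hbr). cbn beta.
  assert (F02 : frame [Vx; Vy; Vok; Vtot; Vbase; Vrad] [] h h2)
    by (ftrans F1 F2).
  assert (Ex2 : hv h2 Vx 0 = Z.of_nat x) by (frv F2; reflexivity).
  assert (Ey2 : hv h2 Vy 0 = Z.of_nat y) by (frv F2; reflexivity).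
  assert (Edx : ha h2 ADx j x = Z.of_nat (length (sec2 (R j) x))).
  { fra F02. apply HBt; auto. }
  assert (ED2 : hv h2 VIn 1 = Z.of_nat D2).
  { frv F02. apply HI. }
  eapply (if_rule k w B Rs Q E _ _ _
    (Z.of_nat (length (sec2 (R j) x)) - Z.of_nat D2)%Z).
  { cbn; lia. } { ev. repeat split; auto; cbn; lia. }
  { ev. rewrite Nat2Z.id. now rewrite Edx. }
  - intros Hgt. apply hsl_skip. split; auto. split; auto. split; auto. split; auto.
    unfold light. replace (length (sec2 (R j) x) <=? D2) with false; [auto|].
    symmetry. apply Nat.leb_gt. lia.
  - intros Hle. asg 1%Z. { cbn; lia. } { intros _; cbn; lia. }
    split; [frm; auto|]. split; [hs; auto|]. split; [hs; auto|].
    split; [|split; [hs; auto|hs; auto]].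
    hs. unfold light. replace (length (sec2 (R j) x) <=? D2) with true; [auto|].
    symmetry. apply Nat.leb_le. lia.
Qed.

Lemma light_enum_spec j x y t OUT h :
  j < k -> In (x, y) (R j) -> Built h -> hv h VQ 0 = Z.of_nat Q -> LightState j x y h ->
  t < ltot j y -> hv h Vt 0 = Z.of_nat t -> OutInv OUT h ->
  hsl (light_enum k j) (fun h' =>
    frame [Vrem; Vxs; Vcode; Vcnt] [AVis; AOut] h h' /\
    exists OUT', OutInv OUT' h' /\
      forall a, In a OUT' <-> In a OUT \/ a = ltup j x y t) h.
Proof.
  intros Lj Hin HBt EQ (Ex & Ey & _ & _ & Hbr) Lt Et HO.
  pose proof (Q_pos k w B Rs Q E) as Qp.
  destruct (env_lt _ _ _ _ _ E j x y Lj Hin) as [Lx Ly].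
  unfold light_enum. seq. asg (Z.of_nat t).
  { ev. auto. }
  { intros _. ev. split; auto. pose proof (lrad_prod_B j y k ltac:(lia)).
    unfold ltot in Lt. lia. }
  set (h1 := setv h Vrem 0 (Z.of_nat t)).
  seq. spec.
  { apply (decode_spec k w B Rs Q E AL 0 k (lrad j y) (fun _ => y * Q) t); auto.
    - discriminate.
    - intros i Li. apply Hbr; auto.
    - intros i Li. apply Hbr; auto. }
  intros h2 _ (F2 & _ & Hx). cbn [Nat.add] in Hx.
  assert (F02 : frame [Vrem; Vxs; Vcode; Vcnt] [AVis; AOut] h h2).
  { eapply frame_trans; [|exact F2|reflexivity|reflexivity]. unfold h1; frm. }
  seq. asg (Z.of_nat x).
  { ev. auto. }
  { intros _. ev. frv F02. split; auto.
    apply (nat_BQ k w B Rs Q E). lia. }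
  set (h3 := setv h2 Vxs j (Z.of_nat x)).
  assert (F03 : frame [Vrem; Vxs; Vcode; Vcnt] [AVis; AOut] h h3) by (unfold h3; frm; auto).
  spec; [apply (insert_spec k w B Rs Q E OUT (ltup j x y t))|].
  - eapply (OutInv_frame k Rs Q [Vrem; Vxs] []); [exact HO| |reflexivity..].
    unfold h3, h1 in *. frm. eapply frame_trans; [|exact F2|reflexivity|reflexivity]. frm.
  - frv F03. auto.
  - apply ltup_star; auto.
  - intros i Li. unfold h3. hs. unfold ltup. rewrite nth_map_seq by auto.
    destruct (Nat.eqb_spec i j) as [->|Nj]; auto.
    rewrite Hx by auto. unfold h1. hs.
    assert (P : 0 < lrad j y i) by (eapply (prodn_factor_pos _ k); [unfold ltot in Lt; lia|auto]).
    pose proof (digit_lt (lrad j y) t i P) as D. unfold lrad in D at 2.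
    destruct (Nat.eqb_spec i j); [contradiction|].
    apply HBt; auto.
  - intros h4 _ (F4 & HO4). split; auto. eapply frame_trans; eauto.
Qed.

Definition LV : list vname :=
  [Vp; Vx; Vy; Vok; Vtot; Vbase; Vrad; Vt; Vrem; Vxs; Vcode; Vcnt].
Definition LA : list aname := [AVis; AOut].

Notation light_body := (light_body k).

Definition light_const (j : nat) : nat :=
  csz (light_tuple k j) + csz (comp k (Var Vok 0) 0) + for_cost Vt (Var Vtot 0)
  + csz (light_enum k j) + 2.

Definition lcost (j p : nat) : nat :=
  let '(x, y) := nth p (R j) (0, 0) in
  light_const j * (1 + if light j x y then ltot j y else 0).

Lemma light_body_spec j p x y OUT h :
  j < k -> Inp h -> Built h -> hv h VQ 0 = Z.of_nat Q -> hv h Vp 0 = Z.of_nat p ->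
  p < length (R j) -> nth p (R j) (0, 0) = (x, y) -> OutInv OUT h ->
  hwp (light_body j) (lcost j p) (fun h' =>
    frame LV LA h h' /\ hv h' Vp 0 = Z.of_nat p /\
    exists OUT', OutInv OUT' h' /\ incl OUT OUT' /\
      (light j x y = true -> forall t, t < ltot j y -> In (ltup j x y t) OUT')) h.
Proof.
  intros Lj HI HBt EQ Ep Lp Exy HO.
  assert (Hin : In (x, y) (R j)) by (rewrite <- Exy; apply nth_In; auto).
  unfold light_body. eapply (hwp_seq k w B _ _ (csz (light_tuple k j))
    (lcost j p - csz (light_tuple k j))).
  2:{ unfold lcost. rewrite Exy. unfold light_const. lia. }
  eapply hwp_mono; [eapply light_tuple_spec; eauto|reflexivity|].
  intros h1 Hb1 (F1 & HL).
  assert (F1' : frame LV LA h h1) by (fweak F1).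
  pose proof HL as (Ex & Ey & Eok & Etot & Hbr).
  assert (HO1 : OutInv OUT h1) by (eapply (OutInv_frame k Rs Q); [exact HO|exact F1|reflexivity..]).
  eapply (hwp_if k w B HB2 HBw _ _ _ _
    (for_cost Vt (Var Vtot 0) + (csz (light_enum k j) + for_cost Vt (Var Vtot 0)) * ltot j y) 1);
    cbn [eval]; try rewrite Eok.
  - exact I.
  - cbn; lia.
  - destruct (light j x y) eqn:El; [intros _|lia].
    eapply hwp_mono; [eapply (hwp_for k w B HB2 HBw Vt) with (n := ltot j y)
      (T := fun _ => csz (light_enum k j))
      (I := fun t h' => frame [Vt; Vrem; Vxs; Vcode; Vcnt] [AVis; AOut] h1 h' /\
         hv h' Vt 0 = Z.of_nat t /\
         exists OUT', OutInv OUT' h' /\ incl OUT OUT' /\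
         forall t', t' < t -> In (ltup j x y t') OUT')| |].
    + cbn; lia.
    + exact I.
    + pose proof (lrad_prod_B j y k ltac:(lia)). unfold ltot. lia.
    + exact I.
    + split; [frm|]. split; [reflexivity|]. exists OUT. split; [|split].
      * eapply (OutInv_frame k Rs Q [Vt] []); [exact HO1|frm|reflexivity..].
      * apply incl_refl.
      * intros; lia.
    + intros t h' Lt _ (F & Et & _). split; [exact I|]. split; auto.
      cbn [eval]. frv F. auto.
    + intros t h' Lt _ (F & Et & OUT' & HO' & Inc & Hall).
      eapply hwp_mono; [eapply light_enum_spec with (OUT := OUT'); eauto|reflexivity|].
      * eapply Built_frame; [|exact F|reflexivity..].
        eapply Built_frame; [exact HBt|exact F1|reflexivity..].
      * rewrite (proj1 F), (proj1 F1) by reflexivity. auto.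
      * eapply LightState_frame; [exact HL|exact F|reflexivity].
      * intros h2 _ (F2 & OUT2 & HO2 & In2). split; [|split; [exact I|]].
        { frv F2. auto. }
        split; [frm; ftrans F F2|].
        split; [reflexivity|]. exists OUT2. split; [|split].
        -- eapply (OutInv_frame k Rs Q [Vt] []); [exact HO2|frm|reflexivity..].
        -- intros a Ha. apply In2. left. apply Inc; auto.
        -- intros t' Lt'. apply In2. destruct (Nat.eq_dec t' t) as [->|]; [auto|].
           left. apply Hall; lia.
    + rewrite sumn_const. unfold for_cost. nia.
    + intros h' _ (F & _ & OUT' & HO' & Inc & Hall). split; [|split].
      * eapply frame_trans; [exact F1'|exact F|reflexivity|reflexivity].
      * rewrite (proj1 F), (proj1 F1) by reflexivity. auto.
      * exists OUT'. auto.
  - destruct (light j x y) eqn:El; [lia|intros _].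
    apply hwp_skip; [lia|]. split; [auto|]. split.
    + frv F1. auto.
    + exists OUT. split; [auto|]. split; [apply incl_refl|discriminate].
  - destruct (light j x y) eqn:El; [intros _|lia].
    unfold lcost. rewrite Exy, El. unfold light_const. nia.
  - destruct (light j x y) eqn:El; [lia|intros _].
    unfold lcost. rewrite Exy, El. unfold light_const. lia.
Qed.

(** Progress is measured on triples of a tuple, a witness and a light component. Such a triple is
    settled once the loops have passed the tuple of the relation formed by that component and the
    witness. *)
Definition LDone (j p : nat) (OUT : list (list nat)) : Prop :=
  forall a b j', in_join Rs a b -> j' < k -> light j' (nth j' a 0) b = true ->
    (j' < j \/ j' = j /\ In (nth j' a 0, b) (firstn p (R j))) -> In a OUT.

Lemma light_phase_spec h :
  Inp h -> Built h -> hv h VQ 0 = Z.of_nat Q -> OutInv [] h ->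
  hwp (light_phase k)
    (S (sumn (fun j => for_cost Vp (size_of j) +
       sumn (fun p => lcost j p + for_cost Vp (size_of j)) (length (R j))) k))
    (fun h' => frame LV LA h h' /\ exists OUT, OutInv OUT h' /\ LDone k 0 OUT) h.
Proof.
  intros HI HBt EQ HO.
  eapply hwp_mono; [eapply hwp_iter with (I := fun j h' =>
     frame LV LA h h' /\ exists OUT, OutInv OUT h' /\ LDone j 0 OUT)|reflexivity|auto].
  - split; [apply frame_refl|]. exists []. split; auto.
    intros a b j' _ _ _ [L|[_ []]]. lia.
  - intros j h2 Lj (F2 & OUT2 & HO2 & HD2).
    eapply hwp_mono; [eapply tuples_rule with (i := j) (T := lcost j)
      (I := fun p h' => frame LV LA h h' /\ exists OUT, OutInv OUT h' /\ LDone j p OUT)| |].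
    + exact E.
    + auto.
    + intros p h' [F' _]. eapply Inp_frame; eauto.
    + intros p h' z (F' & OUT' & HO' & HD'). split; [frm; auto|].
      exists OUT'. split; [|auto]. eapply (OutInv_frame k Rs Q [Vp] []); [exact HO'|frm|reflexivity..].
    + intros p x y h' Lp Exy (F' & OUT' & HO' & HD') Ep.
      eapply hwp_mono; [eapply light_body_spec with (OUT := OUT'); eauto|reflexivity|].
      * eapply Inp_frame; eauto.
      * eapply Built_frame; [exact HBt|exact F'|reflexivity..].
      * rewrite (proj1 F') by reflexivity. auto.
      * intros h3 _ (F3 & Ep3 & OUT3 & HO3 & Inc & Hall). split; auto.
        split; [eapply frame_trans; [exact F'|exact F3|reflexivity|reflexivity]|].
        exists OUT3. split; auto. intros a b j' Hj Lj' Hl Hc.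
        rewrite (firstn_S_nth (0, 0)) in Hc by auto. rewrite Exy in Hc.
        destruct Hc as [L|[-> Hc]]; [apply Inc, (HD' a b j'); auto|].
        apply in_app_or in Hc. destruct Hc as [Hc|[Hc|[]]].
        -- apply Inc, (HD' a b j); auto.
        -- inversion Hc; subst.
           destruct (ltup_complete j a b Lj Hj) as (t & Lt & Et).
           rewrite <- Et. apply Hall; auto.
    + split; auto. exists OUT2. auto.
    + reflexivity.
    + intros h' _ (F' & OUT' & HO' & HD'). split; auto. exists OUT'. split; auto.
      intros a b j' Hj Lj' Hl [L|[-> []]].
      destruct (Nat.eq_dec j' j) as [->|]; [|apply (HD' a b j'); auto; left; lia].
      apply (HD' a b j); auto. right. split; auto. rewrite firstn_all.
      apply (in_join_nth k w B Rs Q E) in Hj. apply Hj; auto.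
Qed.

End Light.

(** * The heavy phase *)

Section Finding.

Context (k : nat) (w B : Z) (Rs : list binrel) (D1 D2 Q : nat).
Hypothesis E : Env k w B Rs Q.

Notation hsl := (hsl k w B).
Notation hwp := (hwp k w B).
Notation R i := (nth i Rs (@nil (nat * nat))).
Notation Inp := (Inp k Rs D1 D2).
Notation Built := (Built k Rs Q).
Notation for_cost := (for_cost k).

Let HB2 := env_B2 _ _ _ _ _ E.
Let HBw := env_Bw _ _ _ _ _ E.

Definition HeavyLists (hx : nat -> list nat) (hy : list nat) (h : hst) : Prop :=
  (forall i, i < k -> SetInv Vh AHX AMkx i (hx i) h) /\
  SetInv Vm AHY AMky 0 hy h.

Lemma HeavyLists_frame vs al hx hy h h' :
  HeavyLists hx hy h -> frame vs al h h' ->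
  forallb (fun v => negb (existsb (veqb v) vs)) [Vh; Vm] = true ->
  forallb (fun a => negb (existsb (aeqb a) al)) [AHX; AMkx; AHY; AMky] = true ->
  HeavyLists hx hy h'.
Proof.
  intros [H1 H2] [F1 F2] Nv Na. rewrite forallb_forall in Nv, Na.
  assert (Nv' : forall v, In v [Vh; Vm] -> existsb (veqb v) vs = false)
    by (intros v Hv; apply negb_true_iff; auto).
  assert (Na' : forall a, In a [AHX; AMkx; AHY; AMky] -> existsb (aeqb a) al = false)
    by (intros a Hv; apply negb_true_iff; auto).
  cbn in Nv', Na'. split.
  - intros i Li. destruct (H1 i Li) as (A1 & A2 & A3 & A4).
    repeat split; auto; intros; rewrite ?F1, ?F2 by ((apply Nv' || apply Na'); tauto); auto.
  - destruct H2 as (A1 & A2 & A3 & A4).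
    repeat split; auto; intros; rewrite ?F1, ?F2 by ((apply Nv' || apply Na'); tauto); auto.
Qed.

(** Only occurrence refers to the part [pre] scanned so far; degrees are taken in the complete
    relations, which are known from the building phase. *)
Definition Found (pre : nat -> binrel) (hx : nat -> list nat) (hy : list nat) : Prop :=
  (forall j x, j < k -> (In x (hx j) <->
     D2 < length (sec2 (R j) x) /\ In x (map fst (pre j)))) /\
  (forall y, In y hy <->
     exists j, j < k /\ D1 < length (sec (R j) y) /\ In y (map snd (pre j))).

Notation find_body := (find_body k).

Lemma pre_lt (pre : nat -> binrel) :
  (forall j, j < k -> incl (pre j) (R j)) ->
  forall hx hy, Found pre hx hy ->
  (forall j x, j < k -> In x (hx j) -> x < Q) /\ (forall y, In y hy -> y < Q).
Proof.
  intros Hp hx hy [F1 F2]. split.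
  - intros j x Lj Hx. apply F1 in Hx; auto. destruct Hx as [_ Hx].
    apply in_map_iff in Hx. destruct Hx as ((x', y') & <- & Hx).
    apply (env_lt _ _ _ _ _ E j x' y' Lj). apply Hp; auto.
  - intros y Hy. apply F2 in Hy. destruct Hy as (j & Lj & _ & Hy).
    apply in_map_iff in Hy. destruct Hy as ((x', y') & <- & Hy).
    apply (env_lt _ _ _ _ _ E j x' y' Lj). apply Hp; auto.
Qed.

Lemma find_body_spec i p x y pre hx hy h :
  i < k -> Inp h -> Built h -> hv h Vp 0 = Z.of_nat p ->
  p < length (R i) -> nth p (R i) (0, 0) = (x, y) ->
  (forall j, j < k -> incl (pre j) (R j)) ->
  HeavyLists hx hy h -> Found pre hx hy ->
  hsl (find_body i) (fun h' =>
    frame [Vx; Vy; Vh; Vm] [AHX; AMkx; AHY; AMky] h h' /\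
    exists hx' hy', HeavyLists hx' hy' h' /\
      Found (fun j => if j =? i then pre i ++ [(x, y)] else pre j) hx' hy') h.
Proof.
  intros Li HI HBt Ep Lp Exy Hpre HH HF.
  assert (Hin : In (x, y) (R i)) by (rewrite <- Exy; apply nth_In; auto).
  destruct (env_lt _ _ _ _ _ E i x y Li Hin) as [Lx Ly].
  destruct (pre_lt pre Hpre _ _ HF) as [Bx By].
  unfold find_body. seq. spec; [eapply (load_spec k w B Rs D1 D2 Q E); eauto|].
  intros h1 _ ->. set (h1 := setv (setv h Vx 0 (Z.of_nat x)) Vy 0 (Z.of_nat y)).
  assert (F1 : frame [Vx; Vy; Vh; Vm] [AHX; AMkx; AHY; AMky] h h1) by (unfold h1; frm).
  assert (HH1 : HeavyLists hx hy h1).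
  { eapply (HeavyLists_frame [Vx; Vy] []); [exact HH|unfold h1; frm|reflexivity..]. }
  assert (Edx : ha h1 ADx i x = Z.of_nat (length (sec2 (R i) x))) by (apply HBt; auto).
  assert (Edy : ha h1 ACnt i y = Z.of_nat (length (sec (R i) y))) by (apply HBt; auto).
  assert (Ed1 : hv h1 VIn 0 = Z.of_nat D1) by apply HI.
  assert (Ed2 : hv h1 VIn 1 = Z.of_nat D2) by apply HI.
  assert (Ex1 : hv h1 Vx 0 = Z.of_nat x) by reflexivity.
  assert (Ey1 : hv h1 Vy 0 = Z.of_nat y) by reflexivity.
  clearbody h1.
  seq. spec.
  { eapply (if_rule k w B Rs Q E) with (P := fun h2 =>
      frame [Vh] [AHX; AMkx] h1 h2 /\ exists hx', HeavyLists hx' hy h2 /\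
      forall j z, j < k -> (In z (hx' j) <->
        D2 < length (sec2 (R j) z) /\
        In z (map fst (if j =? i then pre i ++ [(x, y)] else pre j))))
      (z := (Z.of_nat (length (sec2 (R i) x)) - Z.of_nat D2)%Z).
    { cbn; lia. } { ev. repeat split; auto; cbn; lia. }
    { ev. rewrite Nat2Z.id. now rewrite Edx. }
    - intros Hgt. spec; [eapply (push_spec k w B Rs Q E) with (l := hx i) (x := x);
        try discriminate; try exact I|].
      + apply HH1; auto.
      + cbn; lia.
      + ev. auto.
      + intros h' He. split; [ev; rewrite He by discriminate; auto|exact I].
      + intros z [<-|Hz]; auto. apply (Bx i); auto.
      + intros h2 _ (F2 & (l' & S' & Hl') & Ho). split; auto.
        exists (fun j => if j =? i then l' else hx j). split; [split|].
        * intros j Lj. destruct (Nat.eqb_spec j i) as [->|Nj]; auto.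
          destruct (Ho j Nj) as [Ho1 Ho2].
          destruct (proj1 HH1 j Lj) as (A1 & A2 & A3 & A4).
          split; [auto|]. split; [now rewrite Ho1|]. split.
          -- intros d. destruct (Ho2 d) as [-> _]. auto.
          -- intros z. destruct (Ho2 z) as [_ ->]. auto.
        * destruct (proj2 HH1) as (A1 & A2 & A3 & A4).
          repeat split; auto; intros; rewrite ?(proj1 F2), ?(proj2 F2) by reflexivity; auto.
        * intros j z Lj. destruct (Nat.eqb_spec j i) as [->|Nj]; [|apply HF; auto].
          rewrite Hl'. rewrite (proj1 HF) by auto. rewrite map_app, in_app_iff. cbn.
          assert (D2 < length (sec2 (R i) x)) by lia. intuition (subst; auto).
    - intros Hle. apply hsl_skip. split; [frm|]. exists hx. split; auto.
      intros j z Lj. rewrite (proj1 HF) by auto.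
      destruct (Nat.eqb_spec j i) as [->|Nj]; [|tauto].
      rewrite map_app, in_app_iff. cbn.
      assert (~ D2 < length (sec2 (R i) x)) by lia. intuition (subst; tauto). }
  intros h2 _ (F2 & hx' & HH2 & Hx').
  assert (F02 : frame [Vx; Vy; Vh; Vm] [AHX; AMkx; AHY; AMky] h h2).
  { ftrans F1 F2. }
  assert (Ey2 : hv h2 Vy 0 = Z.of_nat y) by (frv F2; auto).
  assert (Ed12 : hv h2 VIn 0 = Z.of_nat D1) by (frv F2; auto).
  assert (Edy2 : ha h2 ACnt i y = Z.of_nat (length (sec (R i) y)))
    by (fra F2; auto).
  eapply (if_rule k w B Rs Q E) with
    (z := (Z.of_nat (length (sec (R i) y)) - Z.of_nat D1)%Z).
  { cbn; lia. } { ev. repeat split; auto; cbn; lia. }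
  { ev. rewrite Nat2Z.id. now rewrite Edy2. }
  - intros Hgt. spec; [eapply (push_spec k w B Rs Q E) with (l := hy) (x := y);
        try discriminate; try exact I|].
    + apply HH2.
    + cbn; lia.
    + ev. auto.
    + intros h' He. split; [ev; rewrite He by discriminate; auto|exact I].
    + intros z [<-|Hz]; auto.
    + intros h3 _ (F3 & (l' & S' & Hl') & _).
      split; [ftrans F02 F3|].
      exists hx', l'. split; [split; auto|].
      * intros j Lj. destruct (proj1 HH2 j Lj) as (A1 & A2 & A3 & A4).
        repeat split; auto; intros; rewrite ?(proj1 F3), ?(proj2 F3) by reflexivity; auto.
      * split; [exact Hx'|]. intros z. rewrite Hl', (proj2 HF). split.
        -- intros [(j & Lj & Hj1 & Hj2)| ->].
           ++ exists j. split; auto. split; auto.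
              destruct (Nat.eqb_spec j i) as [->|]; auto.
              rewrite map_app. apply in_or_app; auto.
           ++ exists i. rewrite Nat.eqb_refl. split; auto. split; [lia|].
              rewrite map_app. apply in_or_app; cbn; auto.
        -- intros (j & Lj & Hj1 & Hj2).
           destruct (Nat.eqb_spec j i) as [->|]; [|left; exists j; auto].
           rewrite map_app in Hj2. apply in_app_or in Hj2.
           destruct Hj2 as [Hj2|[<-|[]]]; auto. left; exists i; auto.
  - intros Hle. apply hsl_skip. split; auto. exists hx', hy. split; auto.
    split; [exact Hx'|]. intros z. rewrite (proj2 HF). split.
    + intros (j & Lj & Hj1 & Hj2). exists j. split; auto. split; auto.
      destruct (Nat.eqb_spec j i) as [->|]; auto. rewrite map_app. apply in_or_app; auto.
    + intros (j & Lj & Hj1 & Hj2). exists j. split; auto. split; auto.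
      destruct (Nat.eqb_spec j i) as [->|]; auto.
      rewrite map_app in Hj2. apply in_app_or in Hj2.
      destruct Hj2 as [Hj2|[<-|[]]]; auto. cbn in Hj1. lia.
Qed.

Lemma find_heavy_spec h :
  Inp h -> Built h ->
  (forall i, i < k -> hv h Vh i = 0%Z) -> hv h Vm 0 = 0%Z ->
  (forall a i p, In a [AHX; AMkx; AHY; AMky] -> ha h a i p = 0%Z) ->
  hwp (find_heavy k)
    (S (sumn (fun i => for_cost Vp (size_of i) +
       sumn (fun p => csz (find_body i) + for_cost Vp (size_of i)) (length (R i))) k))
    (fun h' => frame [Vp; Vx; Vy; Vh; Vm] [AHX; AMkx; AHY; AMky] h h' /\
       exists hx hy, HeavyLists hx hy h' /\
         Found (fun j => R j) hx hy) h.
Proof.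
  intros HI HBt Zh Zm Za.
  set (pre := fun i p j => if j <? i then R j else if j =? i then firstn p (R i) else []).
  assert (Hpre : forall i j, pre i (length (R i)) j = pre (S i) 0 j).
  { intros i j. unfold pre. rewrite firstn_all.
    destruct (Nat.ltb_spec j i), (Nat.ltb_spec j (S i)), (Nat.eqb_spec j i),
      (Nat.eqb_spec j (S i)); subst; auto; lia. }
  assert (Fext : forall f g hx hy, (forall j, j < k -> f j = g j) ->
     Found f hx hy -> Found g hx hy).
  { intros f g hx hy Hfg [G1 G2]. split.
    - intros j z Lj. rewrite <- Hfg by auto. auto.
    - intros z. rewrite G2. split; intros (j & Lj & Hj); exists j; (split; [auto|]);
        [rewrite <- Hfg by auto|rewrite Hfg by auto]; auto. }
  eapply hwp_mono; [eapply hwp_iter with (I := fun i h' =>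
     frame [Vp; Vx; Vy; Vh; Vm] [AHX; AMkx; AHY; AMky] h h' /\
     exists hx hy, HeavyLists hx hy h' /\ Found (pre i 0) hx hy)|reflexivity|].
  - split; [apply frame_refl|]. exists (fun _ => []), [].
    assert (Sn : forall (v : vname) al am i, In al [AHX; AMkx; AHY; AMky] ->
       In am [AHX; AMkx; AHY; AMky] -> hv h v i = 0%Z -> SetInv v al am i [] h).
    { intros v al am i Hal Ham Hv. split; [constructor|]. split; [auto|].
      split; intros; rewrite Za by auto; cbn; auto. destruct d; auto. }
    split; [split|split].
    + intros i Li. apply Sn; cbn; auto.
    + apply Sn; cbn; auto.
    + intros j x Lj. unfold pre. cbn. destruct (j =? 0); cbn; tauto.
    + intros y. unfold pre. cbn. split; [tauto|].
      intros (j & _ & _ & Hj). destruct (j =? 0); cbn in Hj; tauto.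
  - intros i h2 Li (F & hx & hy & HH & HF).
    eapply hwp_mono; [eapply tuples_rule with (i := i)
      (T := fun _ => csz (find_body i)) (I := fun p h' =>
      frame [Vp; Vx; Vy; Vh; Vm] [AHX; AMkx; AHY; AMky] h h' /\
      exists hx hy, HeavyLists hx hy h' /\ Found (pre i p) hx hy)| |].
    + exact E.
    + auto.
    + intros p h' [F' _]. eapply Inp_frame; eauto.
    + intros p h' z (F' & hx' & hy' & HH' & HF'). split; [frm; auto|].
      exists hx', hy'. split; [|auto].
      eapply (HeavyLists_frame [Vp] []); [exact HH'|frm|reflexivity..].
    + intros p x y h' Lp Exy (F' & hx' & hy' & HH' & HF') Ep.
      eapply hwp_mono; [eapply (find_body_spec i p x y (pre i p)); eauto|reflexivity|].
      * eapply Inp_frame; eauto.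
      * eapply Built_frame; eauto.
      * intros j Lj. unfold pre. destruct (j <? i); [apply incl_refl|].
        destruct (Nat.eqb_spec j i) as [->|].
        -- intros t Ht. rewrite <- (firstn_skipn p (R i)). apply in_or_app; auto.
        -- intros t [].
      * intros h3 _ (F3 & hx3 & hy3 & HH3 & HF3). split; [|split].
        -- frv F3. auto.
        -- eapply frame_trans; eauto.
        -- exists hx3, hy3. split; auto. eapply Fext; [|exact HF3].
           intros j Lj. unfold pre. rewrite Nat.ltb_irrefl, Nat.eqb_refl.
           rewrite (firstn_S_nth (0, 0)) by auto. rewrite Exy.
           destruct (Nat.eqb_spec j i) as [->|]; auto.
           now rewrite Nat.ltb_irrefl.
    + split; auto. exists hx, hy. auto.
    + reflexivity.
    + intros h' _ (F' & hx' & hy' & HH' & HF'). split; auto.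
      exists hx', hy'. split; auto. eapply Fext; [|exact HF']. intros; apply Hpre.
  - intros h' _ (F & hx & hy & HH & HF). split; auto. exists hx, hy. split; auto.
    eapply Fext; [|exact HF]. intros j Lj. unfold pre.
    destruct (Nat.ltb_spec j k); auto; lia.
Qed.

End Finding.

(** * The blocked matrix product over the heavy values *)

(** Entries are nonnegative, so nothing cancels and the integer product decides the Boolean one. The
    induction carries nonnegativity of the partial sums along. *)
Lemma mx_prod_pos n (X Y : nat -> nat -> nat) i j :
  (0 < mx_prod n (fun i j => Z.of_nat (X i j)) (fun i j => Z.of_nat (Y i j)) i j)%Z <->
  exists l, l < n /\ 0 < X i l /\ 0 < Y l j.
Proof.
  unfold mx_prod. assert (G : forall s,
    (0 <= fold_right Z.add 0 (map (fun l => Z.of_nat (X i l) * Z.of_nat (Y l j)) s))%Z /\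
    ((0 < fold_right Z.add 0 (map (fun l => Z.of_nat (X i l) * Z.of_nat (Y l j)) s))%Z <->
     exists l, In l s /\ 0 < X i l /\ 0 < Y l j)).
  { induction s as [|a s [IH1 IH2]]; cbn [map fold_right].
    - split; [lia|]. split; [lia|]. intros (l & [] & _).
    - split; [nia|]. split.
      + intros H. destruct (Nat.eq_dec (X i a * Y a j) 0) as [Z0|N0].
        * destruct (proj1 IH2) as (l & Hl & H1); [nia|]. exists l. cbn; auto.
        * exists a. cbn. nia.
      + intros (l & [->|Hl] & H1 & H2); [nia|].
        pose proof (proj2 IH2 (ex_intro _ l (conj Hl (conj H1 H2)))). nia. }
  rewrite (proj2 (G _)). split; intros (l & Hl & H); exists l; split; auto.
  - apply in_seq in Hl. lia.
  - apply in_seq. lia.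
Qed.

Lemma cell_eq K m q t : m < K ->
  (Nat.eqb q (t * K + m)) = (Nat.eqb (q mod K) m && Nat.eqb (q / K) t)%bool.
Proof.
  intros L. destruct (Nat.eqb_spec q (t * K + m)) as [->|N].
  - rewrite Nat.add_comm, Nat.Div0.mod_add, Nat.mod_small, Nat.div_add, Nat.div_small by lia.
    rewrite !Nat.eqb_refl. reflexivity.
  - destruct (Nat.eqb_spec (q mod K) m); destruct (Nat.eqb_spec (q / K) t); auto.
    exfalso. apply N. pose proof (Nat.div_mod_eq q K). nia.
Qed.

Section Heavy.

Context (k : nat) (w B : Z) (Rs : list binrel) (D1 D2 Q : nat).
Hypothesis E : Env k w B Rs Q.
Context (hx : nat -> list nat) (hy : list nat).
Hypothesis Hhx : forall i, i < k -> length (hx i) <= Q.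
Hypothesis Hhy : length hy <= Q.
Hypothesis Hhy_lt : forall y, In y hy -> y < Q.

Notation hsl := (hsl k w B).
Notation hwp := (hwp k w B).
Notation R i := (nth i Rs (@nil (nat * nat))).
Notation Inp := (Inp k Rs D1 D2).
Notation OutInv := (OutInv k Rs Q).
Notation Built := (Built k Rs Q).
Notation for_cost := (for_cost k).
Notation half := (half k).

Let HB2 := env_B2 _ _ _ _ _ E.
Let HBw := env_Bw _ _ _ _ _ E.
Let Qp := Q_pos _ _ _ _ _ E.
Let Lhalf := half_le _ _ _ _ _ E.

Definition hn (i : nat) : nat := length (hx i).
Definition hn2 (i : nat) : nat := hn (half + i).
Definition nrow : nat := prodn hn half.
Definition ncol : nat := prodn hn2 (k - half).
Definition hyv (c : nat) : nat := nth c hy 0.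

Lemma hyv_lt c : hyv c < Q.
Proof.
  unfold hyv. destruct (Nat.lt_ge_cases c (length hy)).
  - apply Hhy_lt, nth_In; auto.
  - rewrite nth_overflow; auto.
Qed.

Lemma nrow_le i : i <= half -> prodn hn i <= Q ^ k.
Proof.
  intros L. etransitivity; [apply prodn_le with (c := Q)|].
  - intros; apply Hhx; lia.
  - apply Nat.pow_le_mono_r; lia.
Qed.

Lemma ncol_le i : i <= k - half -> prodn hn2 i <= Q ^ k.
Proof.
  intros L. etransitivity; [apply prodn_le with (c := Q)|].
  - intros; apply Hhx; lia.
  - apply Nat.pow_le_mono_r; lia.
Qed.

Lemma nat_Bk n : n <= 16 * Q ^ k -> (Z.abs (Z.of_nat n) <= B)%Z.
Proof. intros. apply (nat_B k w B Rs Q E) with (m := k) (c := 16); lia. Qed.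

Definition Sides (h : hst) : Prop :=
  forall i, i < k -> hv h Vrad i = Z.of_nat (hn i) /\ hv h Vbase i = Z.of_nat 0.

Lemma set_sides_spec h :
  HeavyLists k hx hy h ->
  hsl (set_sides k) (fun h' => frame [Vu; Vw; Vrad; Vbase] [] h h' /\
    hv h' Vu 0 = Z.of_nat nrow /\ hv h' Vw 0 = Z.of_nat ncol /\ Sides h') h.
Proof.
  intros [HH _].
  assert (Eh : forall i, i < k -> hv h Vh i = Z.of_nat (hn i)) by (intros; apply HH; auto).
  unfold set_sides. seq. asg 1%Z. { cbn; lia. } { intros _; cbn; lia. }
  seq. spec.
  { eapply iter_rule with (I := fun i h' =>
      frame [Vu; Vw; Vrad; Vbase] [] h h' /\ hv h' Vu 0 = Z.of_nat (prodn hn i)).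
    - split; [frm|]. reflexivity.
    - intros i h1 Li [F Eu].
      assert (Ei : hv h1 Vh i = Z.of_nat (hn i)).
      { frv F. apply Eh; lia. }
      asg (Z.of_nat (prodn hn (S i))).
      + ev. auto.
      + intros _. ev. cbn [prodn]. split; [lia|]. apply nat_Bk.
        pose proof (nrow_le (S i) ltac:(lia)). cbn [prodn] in *. lia.
      + split; [frm; auto|]. hs. reflexivity. }
  intros h1 _ [F1 Eu]. seq. asg 1%Z. { cbn; lia. } { intros _; cbn; lia. }
  seq. spec.
  { eapply iter_rule with (I := fun i h' =>
      frame [Vu; Vw; Vrad; Vbase] [] h h' /\ hv h' Vu 0 = Z.of_nat nrow /\
      hv h' Vw 0 = Z.of_nat (prodn hn2 i)).
    - split; [frm; auto|]. split; [hs; auto|]. reflexivity.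
    - intros i h2 Li (F & Eu2 & Ew).
      assert (Ei : hv h2 Vh (half + i) = Z.of_nat (hn2 i)).
      { frv F. apply Eh; lia. }
      asg (Z.of_nat (prodn hn2 (S i))).
      + ev. auto.
      + intros _. ev. cbn [prodn]. split; [lia|]. apply nat_Bk.
        pose proof (ncol_le (S i) ltac:(lia)). cbn [prodn] in *. lia.
      + split; [frm; auto|]. split; [hs; auto|]. hs. reflexivity. }
  intros h2 _ (F2 & Eu2 & Ew2).
  spec.
  { eapply iter_rule with (I := fun n h' =>
      frame [Vu; Vw; Vrad; Vbase] [] h h' /\ hv h' Vu 0 = Z.of_nat nrow /\
      hv h' Vw 0 = Z.of_nat ncol /\
      forall i, i < n -> hv h' Vrad i = Z.of_nat (hn i) /\ hv h' Vbase i = Z.of_nat 0).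
    - split; [auto|]. split; [auto|]. split; [auto|]. intros; lia.
    - intros i h3 Li (F & Eu3 & Ew3 & Hb).
      assert (Ei : hv h3 Vh i = Z.of_nat (hn i)).
      { frv F. apply Eh; lia. }
      seq. asg (Z.of_nat (hn i)).
      { ev. auto. }
      { intros _. ev. split; auto. apply (nat_BQ k w B Rs Q E). specialize (Hhx i Li).
        unfold hn; lia. }
      asg 0%Z. { cbn; lia. } { intros _; cbn; lia. }
      split; [frm; auto|]. split; [hs; auto|]. split; [hs; auto|].
      intros j Lj. hs. destruct (Nat.eqb_spec j i) as [->|]; auto. apply Hb; lia. }
  intros h3 _ (F & Eu3 & Ew3 & Hb). split; auto.
Qed.

Definition bt : nat := Nat.min (Nat.min (length hy) nrow) ncol.
Definition nu : nat := S (nrow / bt).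
Definition nv : nat := S (length hy / bt).
Definition nw : nat := S (ncol / bt).
Definition nb : nat := nu * (nv * nw).

Definition Blocks (h : hst) : Prop :=
  hv h Vbeta 0 = Z.of_nat bt /\ hv h Vnv 0 = Z.of_nat nv /\
  hv h Vnw 0 = Z.of_nat nw /\ hv h Vnb 0 = Z.of_nat nb.

(** The three sides are at most [Q ^ k], [Q] and [Q ^ k], and each count [a / bt + 1] is at most
    twice the bound of its side. *)
Lemma nb_B : 0 < bt -> nb <= 8 * Q ^ (2 * k + 1).
Proof.
  intros P. unfold nb, nu, nv, nw.
  assert (Hle : forall a, a / bt <= a).
  { intros a. apply Nat.Div0.div_le_upper_bound. nia. }
  pose proof (Hle nrow) as H1. pose proof (Hle (length hy)) as H2. pose proof (Hle ncol) as H3.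
  pose proof (nrow_le half ltac:(lia)) as H4. pose proof (ncol_le (k - half) ltac:(lia)) as H5.
  fold nrow in H4. fold ncol in H5.
  assert (P0 : 1 <= Q ^ k) by (apply Nat.neq_0_lt_0, Nat.pow_nonzero; lia).
  replace (8 * Q ^ (2 * k + 1)) with ((2 * Q ^ k) * ((2 * Q) * (2 * Q ^ k))).
  - apply Nat.mul_le_mono; [lia|]. apply Nat.mul_le_mono; lia.
  - replace (2 * k + 1) with (k + (1 + k)) by lia. rewrite !Nat.pow_add_r, Nat.pow_1_r. ring.
Qed.

Lemma set_blocks_spec h :
  HeavyLists k hx hy h -> hv h Vu 0 = Z.of_nat nrow -> hv h Vw 0 = Z.of_nat ncol ->
  0 < bt ->
  hsl (set_blocks k) (fun h' => frame [Vbeta; Vnv; Vnw; Vnb] [] h h' /\ Blocks h') h.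
Proof.
  intros [_ (_ & Em & _)] Eu Ew Pb.
  assert (Hle : forall a, a / bt <= a).
  { intros a. apply Nat.Div0.div_le_upper_bound. nia. }
  pose proof (nrow_le half ltac:(lia)) as H4. pose proof (ncol_le (k - half) ltac:(lia)) as H5.
  fold nrow in H4. fold ncol in H5.
  assert (P0 : 1 <= Q ^ k) by (apply Nat.neq_0_lt_0, Nat.pow_nonzero; lia).
  unfold set_blocks. seq. asg (Z.of_nat (length hy)).
  { ev. auto. } { intros _. ev. split; auto. apply (nat_BQ k w B Rs Q E); lia. }
  seq. spec.
  { eapply (if_rule k w B Rs Q E) with (P := fun h' => frame [Vbeta] [] h h' /\
      hv h' Vbeta 0 = Z.of_nat (Nat.min (length hy) nrow))
      (z := (Z.of_nat (length hy) - Z.of_nat nrow)%Z).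
    { cbn; lia. } { ev. auto. } { ev. auto. }
    - intros Hgt. asg (Z.of_nat nrow).
      { ev. auto. } { intros _. ev. split; auto. apply nat_Bk; lia. }
      split; [frm|]. hs. f_equal. lia.
    - intros Hle'. apply hsl_skip. split; [frm|]. hs. f_equal. lia. }
  intros h1 _ [F1 E1].
  seq. spec.
  { eapply (if_rule k w B Rs Q E) with (P := fun h' => frame [Vbeta] [] h h' /\
      hv h' Vbeta 0 = Z.of_nat bt)
      (z := (Z.of_nat (Nat.min (length hy) nrow) - Z.of_nat ncol)%Z).
    { cbn; lia. } { ev. auto. } { ev. frv F1. now rewrite Ew. }
    - intros Hgt. asg (Z.of_nat ncol).
      { ev. auto. } { intros _. ev. frv F1.
        split; auto. apply nat_Bk; lia. }
      split; [frm; auto|]. hs. f_equal. unfold bt. lia.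
    - intros Hle'. apply hsl_skip. split; [auto|]. rewrite E1. f_equal. unfold bt. lia. }
  intros h2 _ [F2 E2].
  assert (Eu2 : hv h2 Vu 0 = Z.of_nat nrow) by (frv F2; auto).
  assert (Ew2 : hv h2 Vw 0 = Z.of_nat ncol) by (frv F2; auto).
  assert (Em2 : hv h2 Vm 0 = Z.of_nat (length hy)) by (frv F2; auto).
  assert (ES : forall a, (Z.of_nat a / Z.of_nat bt + 1)%Z = Z.of_nat (S (a / bt))).
  { intros a. rewrite Nat2Z.inj_succ, Nat2Z.inj_div. lia. }
  seq. asg (Z.of_nat nv).
  { ev. repeat split; auto; cbn; lia. }
  { intros _. ev. rewrite ES. split; auto. apply (nat_BQ k w B Rs Q E).
    unfold nv. specialize (Hle (length hy)). lia. }
  seq. asg (Z.of_nat nw).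
  { ev. repeat split; auto; cbn; lia. }
  { intros _. ev. rewrite ES. split; auto. apply nat_Bk.
    unfold nw. specialize (Hle ncol). lia. }
  asg (Z.of_nat nb).
  { ev. repeat split; auto; cbn; lia. }
  { intros _. ev. rewrite ES. split; [unfold nb, nu; lia|].
    apply (nat_B k w B Rs Q E) with (m := 2 * k + 1) (c := 8); try lia.
    apply nb_B; auto. }
  split; [frm; fweak F2|].
  repeat split; hs; auto.
Qed.

Definition rowt (r i : nat) : nat := nth (digit hn r i) (hx i) 0.
Definition colt (s i : nat) : nat := nth (digit hn2 s i) (hx (half + i)) 0.

Definition btup (r s : nat) : list nat :=
  map (fun i => if i <? half then rowt r i else colt s (i - half)) (seq 0 k).

Definition mem (i x y : nat) : nat := if in_dec pair_dec (x, y) (R i) then 1 else 0.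

Definition entA (r y : nat) : nat := prodn (fun i => mem i (rowt r i) y) half.
Definition entB (s y : nat) : nat := prodn (fun i => mem (half + i) (colt s i) y) (k - half).

Lemma mem_le i x y : mem i x y <= 1.
Proof. unfold mem. destruct (in_dec _ _ _); lia. Qed.

Lemma prodn_le1 f n : (forall i, f i <= 1) -> prodn f n <= 1.
Proof. intros H. etransitivity; [apply prodn_le with (c := 1); auto|]. now rewrite Nat.pow_1_l. Qed.

(** The indices are arbitrary: past the last row or column the digits wrap around, and positive
    entries still certify membership in every relation. This is why overhanging blocks report no
    wrong tuple. *)
Lemma btup_star r s y : 0 < entA r y -> 0 < entB s y -> star_out Rs (btup r s).
Proof.
  intros P1 P2. exists y. apply (in_join_nth k w B Rs Q E). split.
  - unfold btup. now rewrite length_map, length_seq.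
  - intros i Li. unfold btup. rewrite nth_map_seq by auto.
    destruct (Nat.ltb_spec i half) as [L|L].
    + pose proof (prodn_factor_pos _ half i P1 L) as P. cbn beta in P. unfold mem in P.
      destruct (in_dec _ _ _); auto. lia.
    + pose proof (prodn_factor_pos _ (k - half) (i - half) P2 ltac:(lia)) as P.
      cbn beta in P. unfold mem in P.
      replace (half + (i - half)) with i in P by lia.
      destruct (in_dec _ _ _); auto. lia.
Qed.

Lemma btup_complete a b :
  in_join Rs a b -> (forall i, i < k -> In (nth i a 0) (hx i)) ->
  exists r s, r < nrow /\ s < ncol /\ btup r s = a /\ 0 < entA r b /\ 0 < entB s b.
Proof.
  intros H Ha. apply (in_join_nth k w B Rs Q E) in H. destruct H as [La H].
  assert (G : exists d, forall i, i < k -> d i < hn i /\ nth (d i) (hx i) 0 = nth i a 0).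
  { clear -Ha. unfold hn. induction k as [|n IH].
    - exists (fun _ => 0). intros; lia.
    - destruct IH as [d Hd]; [intros; apply Ha; lia|].
      destruct (In_nth _ _ 0 (Ha n ltac:(lia))) as (dn & Hn).
      exists (fun i => if i =? n then dn else d i). intros i Li.
      destruct (Nat.eqb_spec i n); [subst; auto|apply Hd; lia]. }
  destruct G as [d Hd].
  destruct (digits_exist hn d half) as (r & Lr & Dr); [intros; apply Hd; lia|].
  destruct (digits_exist hn2 (fun i => d (half + i)) (k - half)) as (s & Ls & Ds);
    [intros; apply Hd; lia|].
  assert (ER : forall i, i < half -> rowt r i = nth i a 0).
  { intros i Li. unfold rowt. rewrite Dr by auto. apply Hd; lia. }
  assert (EC : forall i, i < k - half -> colt s i = nth (half + i) a 0).
  { intros i Li. unfold colt. rewrite Ds by auto. apply Hd; lia. }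
  exists r, s. split; [exact Lr|]. split; [exact Ls|]. split; [|split].
  - apply (nth_ext _ _ 0 0).
    + unfold btup. now rewrite length_map, length_seq.
    + intros i Li. unfold btup in *. rewrite length_map, length_seq in Li.
      rewrite nth_map_seq by auto. destruct (Nat.ltb_spec i half); [apply ER; auto|].
      rewrite EC by lia. f_equal. lia.
  - apply prodn_pos. intros i Li. unfold mem. rewrite ER by auto.
    destruct (in_dec _ _ _) as [|N]; [lia|]. exfalso. apply N, H. lia.
  - apply prodn_pos. intros i Li. unfold mem. rewrite EC by auto.
    destruct (in_dec _ _ _) as [|N]; [lia|]. exfalso. apply N, H. lia.
Qed.

Definition At (p t : nat) (h : hst) : Prop :=
  hv h Vp 0 = Z.of_nat p /\ hv h Vt 0 = Z.of_nat t /\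
  hv h VI 0 = Z.of_nat (p / nw / nv) /\ hv h VL 0 = Z.of_nat (p / nw mod nv) /\
  hv h VJ 0 = Z.of_nat (p mod nw).

Definition brow (p i : nat) : nat := p / nw / nv * bt + i.
Definition bmid (p l : nat) : nat := (p / nw mod nv) * bt + l.
Definition bcol (p j : nat) : nat := p mod nw * bt + j.

(** The factor 2 is the overhang: the last block starts at most at [nrow], and its side is at most
    [nrow]. *)
Lemma brow_le p i : p < nb -> i < bt -> brow p i <= 2 * Q ^ k.
Proof.
  intros Lp Li. unfold brow.
  assert (p / nw / nv < nu).
  { rewrite Nat.Div0.div_div. apply Nat.Div0.div_lt_upper_bound. unfold nb in Lp. nia. }
  pose proof (nrow_le half ltac:(lia)) as H4. fold nrow in H4.
  pose proof (Nat.Div0.mul_div_le nrow bt). unfold nu in *.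
  assert (p / nw / nv * bt <= nrow) by nia.
  assert (bt <= nrow) by (unfold bt; lia). lia.
Qed.

Lemma bcol_le p j : j < bt -> bcol p j <= 2 * Q ^ k.
Proof.
  intros Lj. unfold bcol.
  assert (p mod nw < nw) by (apply Nat.mod_upper_bound; unfold nw; lia).
  pose proof (ncol_le (k - half) ltac:(lia)) as H4. fold ncol in H4.
  pose proof (Nat.Div0.mul_div_le ncol bt). unfold nw in *.
  assert (p mod S (ncol / bt) * bt <= ncol) by nia.
  assert (bt <= ncol) by (unfold bt; lia). lia.
Qed.

Lemma div_mod_lt t : t < bt * bt -> t / bt < bt /\ t mod bt < bt.
Proof.
  intros L. assert (bt <> 0) by nia. split; [|apply Nat.mod_upper_bound; auto].
  apply Nat.Div0.div_lt_upper_bound. auto.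
Qed.

Lemma decode_row_spec p t h :
  HeavyLists k hx hy h -> Sides h -> Blocks h -> At p t h -> p < nb -> t < bt * bt ->
  hsl (decode_row k) (fun h' => frame [Vrem; Vxs] [] h h' /\
    (forall i, half <= i -> hv h' Vxs i = hv h Vxs i) /\
    forall i, i < half -> hv h' Vxs i = Z.of_nat (rowt (brow p (t / bt)) i)) h.
Proof.
  intros HH HS (Eb & _) (Ep & Et & EI & _) Lp Lt.
  destruct (div_mod_lt t Lt) as [L1 L2].
  unfold decode_row. seq. asg (Z.of_nat (brow p (t / bt))).
  { ev. auto. }
  { intros _. ev. unfold brow. rewrite Nat2Z.inj_add, Nat2Z.inj_mul, (Nat2Z.inj_div t).
    split; [lia|]. rewrite <- Nat2Z.inj_div, <- Nat2Z.inj_mul, <- Nat2Z.inj_add.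
    apply nat_Bk. pose proof (brow_le p (t / bt) Lp L1). unfold brow in *. lia. }
  spec.
  { apply (decode_spec k w B Rs Q E AHX 0 half hn (fun _ => 0) (brow p (t / bt))).
    - discriminate.
    - lia.
    - reflexivity.
    - intros i Li. hs. apply HS. lia.
    - intros i Li. hs. apply HS. lia. }
  intros h2 _ (F & Ho & Hi). split; [|split].
  - eapply frame_trans; [|exact F|reflexivity|reflexivity]. frm.
  - intros i Li. rewrite Ho by lia. hs. auto.
  - intros i Li. cbn [Nat.add] in Hi. rewrite Hi by auto. hs. apply HH. lia.
Qed.

Lemma decode_col_spec p t h :
  HeavyLists k hx hy h -> Sides h -> Blocks h -> At p t h -> p < nb -> t < bt * bt ->
  hsl (decode_col k) (fun h' => frame [Vrem; Vxs] [] h h' /\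
    (forall i, i < half -> hv h' Vxs i = hv h Vxs i) /\
    forall i, i < k - half ->
      hv h' Vxs (half + i) = Z.of_nat (colt (bcol p (t mod bt)) i)) h.
Proof.
  intros HH HS (Eb & _) (Ep & Et & _ & _ & EJ) Lp Lt.
  destruct (div_mod_lt t Lt) as [L1 L2].
  unfold decode_col. seq. asg (Z.of_nat (bcol p (t mod bt))).
  { ev. repeat split; auto. }
  { intros _. ev. rewrite <- of_nat_mod. unfold bcol. split; [lia|].
    apply nat_Bk. pose proof (bcol_le p (t mod bt) L2). unfold bcol in *. lia. }
  spec.
  { apply (decode_spec k w B Rs Q E AHX half (k - half) hn2 (fun _ => 0) (bcol p (t mod bt))).
    - discriminate.
    - lia.
    - reflexivity.
    - intros i Li. hs. apply HS. lia.
    - intros i Li. hs. apply HS. lia. }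
  intros h2 _ (F & Ho & Hi). split; [|split].
  - eapply frame_trans; [|exact F|reflexivity|reflexivity]. frm.
  - intros i Li. rewrite Ho by lia. hs. auto.
  - intros i Li. rewrite Hi by auto. hs. apply HH. lia.
Qed.

Lemma entry_spec lo n X y h :
  Built h -> hv h VQ 0 = Z.of_nat Q -> lo + n <= k -> y < Q -> hv h Vy 0 = Z.of_nat y ->
  (forall i, i < n -> hv h Vxs (lo + i) = Z.of_nat (X i)) ->
  hsl (entry k lo n) (fun h' => frame [Vent] [] h h' /\
    hv h' Vent 0 = Z.of_nat (prodn (fun i => mem (lo + i) (X i) y) n)) h.
Proof.
  intros HBt EQ Ln Ly Ey HX.
  unfold entry. seq. asg 1%Z. { cbn; lia. } { intros _; cbn; lia. }
  spec.
  { eapply iter_rule with (I := fun m h' => frame [Vent] [] h h' /\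
      hv h' Vent 0 = Z.of_nat (prodn (fun i => mem (lo + i) (X i) y) m)).
    - split; [frm|]. reflexivity.
    - intros m h1 Lm [F Ee].
      assert (Ex : hv h1 Vxs (lo + m) = Z.of_nat (X m)).
      { frv F. auto. }
      assert (Ey1 : hv h1 Vy 0 = Z.of_nat y) by (frv F; auto).
      assert (EQ1 : hv h1 VQ 0 = Z.of_nat Q) by (frv F; auto).
      assert (Ea : (Z.of_nat (X m) * Z.of_nat Q + Z.of_nat y)%Z = Z.of_nat (X m * Q + y)) by lia.
      asg (Z.of_nat (prodn (fun i => mem (lo + i) (X i) y) (S m))).
      + ev. rewrite Ea. repeat split; auto. lia.
      + intros _. ev. rewrite Ea, Nat2Z.id. fra F.
        destruct (HBt (lo + m) ltac:(lia)) as (_ & _ & _ & HA). rewrite HA by auto.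
        cbn [prodn]. unfold mem at 3.
        split; [destruct (in_dec _ _ _); lia|].
        apply (nat_BQ k w B Rs Q E).
        pose proof (prodn_le1 (fun i => mem (lo + i) (X i) y) (S m)
          ltac:(intros; apply mem_le)) as P. cbn [prodn] in P. lia.
      + split; [frm; auto|]. hs. reflexivity. }
  intros h1 _ H. exact H.
Qed.

Lemma Sides_frame vs al h h' :
  Sides h -> frame vs al h h' ->
  existsb (veqb Vrad) vs = false -> existsb (veqb Vbase) vs = false -> Sides h'.
Proof. intros H [F _] N1 N2 i Li. rewrite !F by auto. auto. Qed.

Lemma Blocks_frame vs al h h' :
  Blocks h -> frame vs al h h' ->
  forallb (fun v => negb (existsb (veqb v) vs)) [Vbeta; Vnv; Vnw; Vnb] = true -> Blocks h'.
Proof.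
  intros (A1 & A2 & A3 & A4) [F _] N. rewrite forallb_forall in N.
  assert (N' : forall v, In v [Vbeta; Vnv; Vnw; Vnb] -> existsb (veqb v) vs = false)
    by (intros v Hv; apply negb_true_iff; auto).
  cbn in N'. unfold Blocks. rewrite !F by (apply N'; tauto). auto.
Qed.

Lemma At_frame vs al p t h h' :
  At p t h -> frame vs al h h' ->
  forallb (fun v => negb (existsb (veqb v) vs)) [Vp; Vt; VI; VL; VJ] = true -> At p t h'.
Proof.
  intros (A1 & A2 & A3 & A4 & A5) [F _] N. rewrite forallb_forall in N.
  assert (N' : forall v, In v [Vp; Vt; VI; VL; VJ] -> existsb (veqb v) vs = false)
    by (intros v Hv; apply negb_true_iff; auto).
  cbn in N'. unfold At. rewrite !F by (apply N'; tauto). auto.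
Qed.

Definition Ready (h : hst) : Prop :=
  Inp h /\ Built h /\ hv h VQ 0 = Z.of_nat Q /\ HeavyLists k hx hy h /\ Sides h /\ Blocks h.

Lemma Ready_frame vs al h h' :
  Ready h -> frame vs al h h' ->
  forallb (fun v => negb (existsb (veqb v) vs))
    [VIn; VQ; Vh; Vm; Vrad; Vbase; Vbeta; Vnv; Vnw; Vnb] = true ->
  forallb (fun a => negb (existsb (aeqb a) al))
    [AIn; AL; ACnt; ADx; AAdj; AHX; AMkx; AHY; AMky] = true ->
  Ready h'.
Proof.
  intros (R1 & R2 & R3 & R4 & R5 & R6) F Nv Na.
  pose proof Nv as Nv'. pose proof Na as Na'. rewrite forallb_forall in Nv', Na'.
  assert (NV : forall v, In v [VIn; VQ; Vh; Vm; Vrad; Vbase; Vbeta; Vnv; Vnw; Vnb] ->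
    existsb (veqb v) vs = false) by (intros v Hv; apply negb_true_iff; auto).
  assert (NA : forall a, In a [AIn; AL; ACnt; ADx; AAdj; AHX; AMkx; AHY; AMky] ->
    existsb (aeqb a) al = false) by (intros a Hv; apply negb_true_iff; auto).
  cbn in NV, NA. split; [|split; [|split; [|split; [|split]]]].
  - eapply Inp_frame; [exact R1|exact F|apply NV; tauto|apply NA; tauto].
  - eapply Built_frame; [exact R2|exact F|apply NA; tauto..].
  - rewrite (proj1 F) by (apply NV; tauto). auto.
  - eapply HeavyLists_frame; [exact R4|exact F| |]; apply forallb_forall; intros z Hz;
      apply negb_true_iff; [apply NV|apply NA]; cbn in Hz; tauto.
  - eapply Sides_frame; [exact R5|exact F|apply NV; tauto..].
  - eapply Blocks_frame; [exact R6|exact F|]. apply forallb_forall; intros z Hz.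
    apply negb_true_iff, NV. cbn in Hz. tauto.
Qed.

Definition blkA (p i l : nat) : nat := entA (brow p i) (hyv (bmid p l)).
Definition blkB (p l j : nat) : nat := entB (bcol p j) (hyv (bmid p l)).

Lemma entA_le r y : entA r y <= 1.
Proof. apply prodn_le1. intros; apply mem_le. Qed.

Lemma entB_le s y : entB s y <= 1.
Proof. apply prodn_le1. intros; apply mem_le. Qed.

Lemma nat_B1 n : n <= 1 -> (Z.abs (Z.of_nat n) <= B)%Z.
Proof. intros. apply (nat_BQ k w B Rs Q E). lia. Qed.

Lemma fill_spec p t h :
  Ready h -> At p t h -> p < nb -> t < bt * bt ->
  hsl (fill k) (fun h' => frame [Vy; Vrem; Vxs; Vent] [ABox] h h' /\
    forall a q, ha h' ABox a q =
      if (Nat.eqb q (t * nb + p) && Nat.ltb a 2)%bool then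
        Z.of_nat (if Nat.eqb a 0 then blkA p (t / bt) (t mod bt)
                  else blkB p (t / bt) (t mod bt))
      else ha h ABox a q) h.
Proof.
  intros HR HA Lp Lt. destruct (div_mod_lt t Lt) as [L1 L2].
  pose proof HR as (HI & HBt & EQ & HH & HS & HBk).
  pose proof HA as (Ep & Et & EI & EL & EJ). pose proof HBk as (Eb & _ & _ & Enb).
  assert (Ehy : forall c, ha h AHY 0 c = Z.of_nat (hyv c)) by (intros c; apply HH).
  assert (Em : forall l, (Z.of_nat (p / nw mod nv) * Z.of_nat bt + Z.of_nat l)%Z =
     Z.of_nat (bmid p l)) by (intros; unfold bmid; lia).
  assert (Ec : (Z.of_nat t * Z.of_nat nb + Z.of_nat p)%Z = Z.of_nat (t * nb + p)) by lia.
  unfold fill. seq. asg (Z.of_nat (hyv (bmid p (t mod bt)))).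
  { ev. rewrite <- of_nat_mod, Em. repeat split; auto. lia. }
  { intros _. ev. rewrite <- of_nat_mod, Em, Nat2Z.id. split; auto.
    apply (nat_BQ k w B Rs Q E). pose proof (hyv_lt (bmid p (t mod bt))). lia. }
  set (h1 := setv h Vy 0 (Z.of_nat (hyv (bmid p (t mod bt))))).
  assert (F1 : frame [Vy; Vrem; Vxs; Vent] [] h h1) by (unfold h1; frm).
  pose proof (Ready_frame _ _ _ _ HR F1 eq_refl eq_refl) as R1.
  pose proof (At_frame _ _ _ _ _ _ HA F1 eq_refl) as A1.
  seq. spec; [apply (decode_row_spec p t); auto; apply R1|].
  intros h2 _ (G2 & _ & X2).
  assert (F2 : frame [Vy; Vrem; Vxs; Vent] [] h h2)
    by (ftrans F1 G2).
  pose proof (Ready_frame _ _ _ _ HR F2 eq_refl eq_refl) as R2.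
  pose proof (At_frame _ _ _ _ _ _ HA F2 eq_refl) as A2.
  seq. spec.
  { apply (entry_spec 0 half (rowt (brow p (t / bt))) (hyv (bmid p (t mod bt)))); try apply R2; auto.
    - apply hyv_lt.
    - frv G2. reflexivity. }
  intros h3 _ (G3 & E3).
  assert (F3 : frame [Vy; Vrem; Vxs; Vent] [] h h3)
    by (ftrans F2 G3).
  pose proof (Ready_frame _ _ _ _ HR F3 eq_refl eq_refl) as R3.
  pose proof (At_frame _ _ _ _ _ _ HA F3 eq_refl) as A3.
  change (prodn (fun i => mem (0 + i) (rowt (brow p (t / bt)) i) (hyv (bmid p (t mod bt)))) half)
    with (blkA p (t / bt) (t mod bt)) in E3.
  seq. sto (t * nb + p) (Z.of_nat (blkA p (t / bt) (t mod bt))).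
  { ev. auto. } { ev. auto. }
  { ev. destruct A3 as (-> & -> & _). destruct R3 as (_ & _ & _ & _ & _ & _ & _ & _ & ->). auto. }
  { intros _. ev. split; auto. apply nat_B1, entA_le. }
  set (h4 := seta h3 ABox 0 (t * nb + p) (Z.of_nat (blkA p (t / bt) (t mod bt)))).
  assert (F4 : frame [Vy; Vrem; Vxs; Vent] [ABox] h h4).
  { unfold h4; frm. fweak F3. }
  pose proof (Ready_frame _ _ _ _ HR F4 eq_refl eq_refl) as R4.
  pose proof (At_frame _ _ _ _ _ _ HA F4 eq_refl) as A4.
  seq. asg (Z.of_nat (hyv (bmid p (t / bt)))).
  { ev. destruct A4 as (_ & -> & _ & -> & _).
    destruct R4 as (_ & _ & _ & _ & _ & -> & _ & _ & _).
    rewrite <- Nat2Z.inj_div, Em. repeat split; auto. lia. }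
  { intros _. ev. destruct A4 as (_ & -> & _ & -> & _).
    destruct R4 as (_ & _ & _ & (_ & _ & _ & HY & _) & _ & -> & _ & _ & _).
    rewrite <- Nat2Z.inj_div, Em, Nat2Z.id, HY. split; auto.
    apply (nat_BQ k w B Rs Q E). pose proof (hyv_lt (bmid p (t / bt))). unfold hyv in *. lia. }
  set (h5 := setv h4 Vy 0 (Z.of_nat (hyv (bmid p (t / bt))))).
  assert (F5 : frame [Vy; Vrem; Vxs; Vent] [ABox] h h5) by (unfold h5; frm; auto).
  pose proof (Ready_frame _ _ _ _ HR F5 eq_refl eq_refl) as R5.
  pose proof (At_frame _ _ _ _ _ _ HA F5 eq_refl) as A5.
  seq. spec; [apply (decode_col_spec p t); auto; apply R5|].
  intros h6 _ (G6 & _ & X6).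
  assert (F6 : frame [Vy; Vrem; Vxs; Vent] [ABox] h h6)
    by (ftrans F5 G6).
  pose proof (Ready_frame _ _ _ _ HR F6 eq_refl eq_refl) as R6.
  pose proof (At_frame _ _ _ _ _ _ HA F6 eq_refl) as A6.
  seq. spec.
  { apply (entry_spec half (k - half) (colt (bcol p (t mod bt))) (hyv (bmid p (t / bt))));
      try apply R6; auto.
    - lia.
    - apply hyv_lt.
    - frv G6. reflexivity. }
  intros h7 _ (G7 & E7).
  assert (F7 : frame [Vy; Vrem; Vxs; Vent] [ABox] h h7)
    by (ftrans F6 G7).
  pose proof (Ready_frame _ _ _ _ HR F7 eq_refl eq_refl) as R7.
  pose proof (At_frame _ _ _ _ _ _ HA F7 eq_refl) as A7.
  change (prodn (fun i => mem (half + i) (colt (bcol p (t mod bt)) i) (hyv (bmid p (t / bt))))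
    (k - half)) with (blkB p (t / bt) (t mod bt)) in E7.
  sto (t * nb + p) (Z.of_nat (blkB p (t / bt) (t mod bt))).
  { ev. auto. } { ev. auto. }
  { ev. destruct A7 as (-> & -> & _). destruct R7 as (_ & _ & _ & _ & _ & _ & _ & _ & ->). auto. }
  { intros _. ev. split; auto. apply nat_B1, entB_le. }
  split; [frm; auto|]. intros a q. hs.
  assert (E4 : forall a q, ha h7 ABox a q = ha h4 ABox a q).
  { intros. rewrite (proj2 G7), (proj2 G6) by reflexivity. reflexivity. }
  rewrite E4. unfold h4. hs. fra F3.
  destruct (q =? t * nb + p); rewrite ?andb_false_r, ?andb_true_r; cbn [andb]; [|reflexivity].
  destruct a as [|[|a]]; reflexivity.
Qed.

Lemma scan_spec p t OUT h :
  Ready h -> At p t h -> p < nb -> t < bt * bt -> OutInv OUT h ->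
  ((0 < ha h ABox 2 (t * nb + p))%Z -> star_out Rs (btup (brow p (t / bt)) (bcol p (t mod bt)))) ->
  hsl (scan k) (fun h' => frame [Vrem; Vxs; Vcode; Vcnt] [AVis; AOut] h h' /\
    exists OUT', OutInv OUT' h' /\ incl OUT OUT' /\
      ((0 < ha h ABox 2 (t * nb + p))%Z -> In (btup (brow p (t / bt)) (bcol p (t mod bt))) OUT')) h.
Proof.
  intros HR HA Lp Lt HO Hst.
  pose proof HR as (HI & HBt & EQ & HH & HS & HBk).
  pose proof HA as (Ep & Et & EI & EL & EJ). pose proof HBk as (Eb & _ & _ & Enb).
  assert (Ec : (Z.of_nat t * Z.of_nat nb + Z.of_nat p)%Z = Z.of_nat (t * nb + p)) by lia.
  unfold scan. eapply (if_rule k w B Rs Q E) with (z := ha h ABox 2 (t * nb + p)).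
  { cbn; lia. } { ev. rewrite Ec. repeat split; auto. lia. }
  { ev. now rewrite Ec, Nat2Z.id. }
  - intros Hpos. specialize (Hst Hpos).
    seq. spec; [apply (decode_row_spec p t); auto|].
    intros h2 _ (G2 & _ & X2).
    pose proof (Ready_frame _ _ _ _ HR G2 eq_refl eq_refl) as R2.
    pose proof (At_frame _ _ _ _ _ _ HA G2 eq_refl) as A2.
    seq. spec; [apply (decode_col_spec p t); auto; apply R2|].
    intros h3 _ (G3 & Y3 & X3).
    assert (F3 : frame [Vrem; Vxs] [] h h3)
      by (ftrans G2 G3).
    pose proof (Ready_frame _ _ _ _ HR F3 eq_refl eq_refl) as R3.
    spec; [apply (insert_spec k w B Rs Q E OUT (btup (brow p (t / bt)) (bcol p (t mod bt))))|].
    + eapply (OutInv_frame k Rs Q); [exact HO|exact F3|reflexivity..].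
    + apply R3.
    + auto.
    + intros i Li. unfold btup. rewrite nth_map_seq by auto.
      destruct (Nat.ltb_spec i half).
      * rewrite Y3 by auto. apply X2; auto.
      * rewrite <- X3 by lia. f_equal. lia.
    + intros h4 _ (F4 & OUT' & HO' & HIn). split.
      * eapply frame_trans; [fweak F3|exact F4|reflexivity|reflexivity].
      * exists OUT'. split; auto. split; [intros z Hz; apply HIn; auto|].
        intros _. apply HIn; auto.
  - intros Hle. apply hsl_skip. split; [apply frame_refl|]. exists OUT.
    split; auto. split; [apply incl_refl|lia].
Qed.

Lemma set_block_spec p h :
  Ready h -> hv h Vp 0 = Z.of_nat p -> p < nb ->
  0 < bt ->
  hsl (set_block k) (fun h' => frame [VJ; VL; VI] [] h h' /\
    hv h' VI 0 = Z.of_nat (p / nw / nv) /\ hv h' VL 0 = Z.of_nat (p / nw mod nv) /\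
    hv h' VJ 0 = Z.of_nat (p mod nw)) h.
Proof.
  intros (_ & _ & _ & _ & _ & (Eb & Env_ & Enw & Enb)) Ep Lp Pb.
  assert (Hb : forall n, n <= p -> (Z.abs (Z.of_nat n) <= B)%Z).
  { intros n Ln. apply (nat_B k w B Rs Q E) with (m := 2 * k + 1) (c := 8); try lia.
    pose proof (nb_B Pb). lia. }
  assert (L1 : p mod nw <= p) by apply Nat.Div0.mod_le.
  assert (L2 : p / nw <= p) by (apply Nat.Div0.div_le_upper_bound; unfold nw; nia).
  assert (L3 : p / nw mod nv <= p / nw) by apply Nat.Div0.mod_le.
  assert (L4 : p / nw / nv <= p / nw) by (apply Nat.Div0.div_le_upper_bound; unfold nv; nia).
  unfold set_block. seq. asg (Z.of_nat (p mod nw)).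
  { ev. repeat split; auto. } { intros _. ev. rewrite <- of_nat_mod. auto. }
  seq. asg (Z.of_nat (p / nw mod nv)).
  { ev. repeat split; auto. }
  { intros _. ev. rewrite <- Nat2Z.inj_div, <- of_nat_mod. split; auto. apply Hb; lia. }
  asg (Z.of_nat (p / nw / nv)).
  { ev. repeat split; auto. }
  { intros _. ev. rewrite <- !Nat2Z.inj_div. split; auto. apply Hb; lia. }
  split; [frm|]. repeat split.
Qed.

Context (mm : cmd) (e0 : nat) (TB : nat -> nat).
Hypothesis Hmm : forall n A1 A2, 1 <= n -> exists s t,
  runs mm e0 (mx_input n A1 A2) s t /\ mx_output n (mx_prod n A1 A2) s /\ t <= TB n.
Hypothesis HB0 : ((Z.of_nat Q + 2) ^ Z.of_nat e0 <= B)%Z.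

Notation block_body := (block_body k mm).

Definition block_const : nat :=
  csz (set_block k) + csz (call_init k mm) + csz (fill k) + csz (scan k) +
  4 * for_cost Vt (beta * beta)%e + 3.

(** The 3 is the slowdown of [lift]; the two loops over the [bt * bt] cells fit into it as well. *)
Definition block_cost : nat := 3 * block_const * (1 + bt * bt + TB bt).

Definition HV : list vname := [VJ; VL; VI; Vt; Vy; Vrem; Vxs; Vent; Vcode; Vcnt].
Definition HA : list aname := [ABox; AVis; AOut].

Lemma bt_le_Q : bt <= Q.
Proof. unfold bt. lia. Qed.

Lemma fill_loop_spec p h :
  Ready h -> hv h Vp 0 = Z.of_nat p -> hv h VI 0 = Z.of_nat (p / nw / nv) ->
  hv h VL 0 = Z.of_nat (p / nw mod nv) -> hv h VJ 0 = Z.of_nat (p mod nw) ->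
  p < nb -> 0 < bt ->
  hwp (for_loop k Vt (beta * beta)%e (fill k))
    (block_const * (bt * bt) + for_cost Vt (beta * beta)%e)
    (fun h' => frame [Vt; Vy; Vrem; Vxs; Vent] [ABox] h h' /\
      forall a q, ha h' ABox a q =
        if (Nat.eqb (q mod nb) p && (Nat.ltb (q / nb) (bt * bt) && Nat.ltb a 2))%bool then
          Z.of_nat (if Nat.eqb a 0 then blkA p (q / nb / bt) ((q / nb) mod bt)
                    else blkB p (q / nb / bt) ((q / nb) mod bt))
        else ha h ABox a q) h.
Proof.
  intros HR Ep EI EL EJ Lp Pb. pose proof bt_le_Q as Lq.
  eapply hwp_mono; [eapply (hwp_for k w B HB2 HBw Vt) with (n := bt * bt)
    (T := fun _ => csz (fill k))
    (I := fun t h' => frame [Vt; Vy; Vrem; Vxs; Vent] [ABox] h h' /\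
       hv h' Vt 0 = Z.of_nat t /\
       forall a q, ha h' ABox a q =
        if (Nat.eqb (q mod nb) p && (Nat.ltb (q / nb) t && Nat.ltb a 2))%bool then
          Z.of_nat (if Nat.eqb a 0 then blkA p (q / nb / bt) ((q / nb) mod bt)
                    else blkB p (q / nb / bt) ((q / nb) mod bt))
        else ha h ABox a q)| |].
  - cbn; lia.
  - exact I.
  - pose proof (nat_BQ2 k w B Rs Q E (bt * bt) ltac:(nia)). lia.
  - cbn. auto.
  - split; [frm|]. split; [reflexivity|]. intros a q. cbn [Nat.ltb Nat.leb].
    rewrite andb_false_r. reflexivity.
  - intros t h' Lt _ (F & Et & _). split; [cbn; auto|]. split; auto.
    pose proof HR as (_ & _ & _ & _ & _ & Eb & _).
    cbn [eval eval_op beta]. frv F. rewrite Eb. lia.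
  - intros t h' Lt _ (F & Et & HX).
    pose proof (Ready_frame _ _ _ _ HR F eq_refl eq_refl) as HR'.
    eapply hwp_mono; [eapply (fill_spec p t); auto|reflexivity|].
    + repeat split; auto; frv F; auto.
    + intros h2 _ (F2 & HX2). split; [frv F2; auto|].
      split; [cbn; auto|].
      split; [frm; ftrans F F2|].
      split; [reflexivity|]. intros a q. rewrite ha_setv, HX2, HX.
      rewrite (cell_eq nb p q t Lp).
      destruct (Nat.eqb_spec (q mod nb) p); cbn [andb]; [|reflexivity].
      destruct (Nat.eqb_spec (q / nb) t) as [Eq|Nq]; cbn [andb].
      * replace (q / nb <? t) with false by (symmetry; apply Nat.ltb_ge; lia).
        replace (q / nb <? S t) with true by (symmetry; apply Nat.ltb_lt; lia).
        rewrite Eq. cbn [andb]. reflexivity.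
      * replace (q / nb <? S t) with (q / nb <? t); [reflexivity|].
        destruct (Nat.ltb_spec (q / nb) t), (Nat.ltb_spec (q / nb) (S t)); auto; lia.
  - rewrite sumn_const. unfold block_const, for_cost. nia.
  - intros h' _ (F & _ & HX). auto.
Qed.

Lemma scan_loop_spec p OUT h :
  Ready h -> hv h Vp 0 = Z.of_nat p -> hv h VI 0 = Z.of_nat (p / nw / nv) ->
  hv h VL 0 = Z.of_nat (p / nw mod nv) -> hv h VJ 0 = Z.of_nat (p mod nw) ->
  p < nb -> 0 < bt -> OutInv OUT h ->
  (forall t, t < bt * bt -> (0 < ha h ABox 2 (t * nb + p))%Z ->
     star_out Rs (btup (brow p (t / bt)) (bcol p (t mod bt)))) ->
  hwp (for_loop k Vt (beta * beta)%e (scan k))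
    (block_const * (bt * bt) + for_cost Vt (beta * beta)%e)
    (fun h' => frame [Vt; Vrem; Vxs; Vcode; Vcnt] [AVis; AOut] h h' /\
      exists OUT', OutInv OUT' h' /\ incl OUT OUT' /\
      forall t, t < bt * bt -> (0 < ha h ABox 2 (t * nb + p))%Z ->
        In (btup (brow p (t / bt)) (bcol p (t mod bt))) OUT') h.
Proof.
  intros HR Ep EI EL EJ Lp Pb HO Hst. pose proof bt_le_Q as Lq.
  eapply hwp_mono; [eapply (hwp_for k w B HB2 HBw Vt) with (n := bt * bt)
    (T := fun _ => csz (scan k))
    (I := fun t h' => frame [Vt; Vrem; Vxs; Vcode; Vcnt] [AVis; AOut] h h' /\
       hv h' Vt 0 = Z.of_nat t /\
       exists OUT', OutInv OUT' h' /\ incl OUT OUT' /\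
       forall t', t' < t -> (0 < ha h ABox 2 (t' * nb + p))%Z ->
        In (btup (brow p (t' / bt)) (bcol p (t' mod bt))) OUT')| |].
  - cbn; lia.
  - exact I.
  - pose proof (nat_BQ2 k w B Rs Q E (bt * bt) ltac:(nia)). lia.
  - cbn. auto.
  - split; [frm|]. split; [reflexivity|]. exists OUT. split; [|split].
    + eapply (OutInv_frame k Rs Q [Vt] []); [exact HO|frm|reflexivity..].
    + apply incl_refl.
    + intros; lia.
  - intros t h' Lt _ (F & Et & _). split; [cbn; auto|]. split; auto.
    pose proof HR as (_ & _ & _ & _ & _ & Eb & _).
    cbn [eval eval_op beta]. frv F. rewrite Eb. lia.
  - intros t h' Lt _ (F & Et & OUT' & HO' & Inc & Hall).
    pose proof (Ready_frame _ _ _ _ HR F eq_refl eq_refl) as HR'.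
    eapply hwp_mono; [eapply (scan_spec p t OUT'); auto|reflexivity|].
    + repeat split; auto; frv F; auto.
    + fra F. auto.
    + intros h2 _ (F2 & OUT2 & HO2 & Inc2 & Hin2).
      split; [frv F2; auto|].
      split; [cbn; auto|].
      split; [frm; ftrans F F2|].
      split; [reflexivity|]. exists OUT2. split; [|split].
      * eapply (OutInv_frame k Rs Q [Vt] []); [exact HO2|frm|reflexivity..].
      * eapply incl_tran; eauto.
      * intros t' Lt' Hp. destruct (Nat.eq_dec t' t) as [->|].
        -- apply Hin2. fra F. auto.
        -- apply Inc2, Hall; auto. lia.
  - rewrite sumn_const. unfold block_const, for_cost. nia.
  - intros h' _ (F & _ & OUT' & H). split; auto. exists OUT'. auto.
Qed.

(** Earlier calls have left their data in the residue classes below [p] modulo [nb]. Only the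
    classes from [p] on are required to be blank, and those after [p] are handed on blank. *)
Lemma block_spec p OUT h :
  Ready h -> hv h Vp 0 = Z.of_nat p -> p < nb -> 0 < bt ->
  (forall a q, p <= q mod nb -> ha h ABox a q = 0%Z) -> OutInv OUT h ->
  hwp block_body block_cost (fun h' =>
    frame HV HA h h' /\ (forall a q, p < q mod nb -> ha h' ABox a q = 0%Z) /\
    exists OUT', OutInv OUT' h' /\ incl OUT OUT' /\
      forall i j l, i < bt -> j < bt -> l < bt -> 0 < blkA p i l -> 0 < blkB p l j ->
        In (btup (brow p i) (bcol p j)) OUT') h.
Proof.
  intros HR Ep Lp Pb HZ HO. pose proof bt_le_Q as Lq.
  unfold block_body.
  eapply hwp_seq with (T1 := csz (set_block k))
    (T2 := block_cost - csz (set_block k)); [|unfold block_cost, block_const; nia].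
  eapply hwp_mono; [apply (set_block_spec p); auto|reflexivity|].
  intros h1 _ (F1 & EI & EL & EJ).
  pose proof (Ready_frame _ _ _ _ HR F1 eq_refl eq_refl) as R1.
  assert (Ep1 : hv h1 Vp 0 = Z.of_nat p) by (frv F1; auto).
  eapply hwp_seq with
    (T1 := block_const * (bt * bt) + for_cost Vt (beta * beta)%e)
    (T2 := csz (call_init k mm) + 3 * TB bt +
           (block_const * (bt * bt) + for_cost Vt (beta * beta)%e)).
  2:{ unfold block_cost.
      assert (Hc : csz (set_block k) + csz (call_init k mm) + 2 * for_cost Vt (beta * beta)%e
        <= block_const) by (unfold block_const; lia).
      assert (1 <= block_const) by (unfold block_const; lia). nia. }
  eapply hwp_mono; [apply (fill_loop_spec p); auto|reflexivity|].
  intros h2 _ (F2 & HX2).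
  pose proof (Ready_frame _ _ _ _ R1 F2 eq_refl eq_refl) as R2.
  destruct (Hmm bt (fun i l => Z.of_nat (blkA p i l)) (fun l j => Z.of_nat (blkB p l j)) Pb)
    as (sF & tF & Hrun & Hout & HtF).
  eapply hwp_seq with (T1 := csz (call_init k mm) + 3 * tF)
    (T2 := block_const * (bt * bt) + for_cost Vt (beta * beta)%e); [|lia].
  (* The residue class of [p] now holds exactly the input state of the embedded program, including
     the zeros beyond the matrices and in all its other arrays. *)
  assert (Hin : forall a q, ha h2 ABox a (q * nb + p) =
    arr (mx_input bt (fun i l => Z.of_nat (blkA p i l)) (fun l j => Z.of_nat (blkB p l j))) a q).
  { intros a q. rewrite HX2.
    assert (Emod : (q * nb + p) mod nb = p).
    { rewrite Nat.add_comm, Nat.Div0.mod_add. apply Nat.mod_small; auto. }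
    assert (Ediv : (q * nb + p) / nb = q).
    { rewrite Nat.add_comm, Nat.div_add, Nat.div_small by lia. auto. }
    rewrite Emod, Ediv, Nat.eqb_refl. cbn [andb].
    fra F1. rewrite HZ by lia.
    destruct a as [|[|a]]; cbn [mx_input arr Nat.ltb Nat.leb Nat.eqb]; unfold row_major;
      rewrite ?andb_true_r, ?andb_false_r; auto. }
  eapply (hwp_call k w B HB2 HBw) with (A1 := fun i l => Z.of_nat (blkA p i l))
    (A2 := fun l j => Z.of_nat (blkB p l j)) (e0 := e0) (n := bt) (K := nb) (m := p) (sF := sF).
  - exact Pb.
  - intros i j. pose proof (entA_le (brow p i) (hyv (bmid p j))). unfold blkA. lia.
  - intros i j. pose proof (entB_le (bcol p j) (hyv (bmid p i))). unfold blkB. lia.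
  - exact Hrun.
  - exact Hout.
  - etransitivity; [|exact HB0]. apply Z.pow_le_mono_l. lia.
  - pose proof (nat_BQ k w B Rs Q E bt ltac:(lia)). lia.
  - apply R2.
  - frv F2. auto.
  - exact Lp.
  - apply R2.
  - exact Hin.
  - intros h3 Gv Ga Gq G2.
    assert (F3 : frame [] [ABox] h2 h3).
    { split; intros; auto. apply Ga. intros ->. discriminate. }
    pose proof (Ready_frame _ _ _ _ R2 F3 eq_refl eq_refl) as R3.
    assert (F03 : frame HV HA h h3).
    { eapply frame_trans; [|exact F3|reflexivity|reflexivity].
      eapply frame_trans; [|exact F2|reflexivity|reflexivity].
      fweak F1. }
    assert (F13 : frame [Vt; Vy; Vrem; Vxs; Vent] [ABox] h1 h3).
    { ftrans F2 F3. }
    assert (HP : forall t, t < bt * bt -> ((0 < ha h3 ABox 2 (t * nb + p))%Z <->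
      exists l, l < bt /\ 0 < blkA p (t / bt) l /\ 0 < blkB p l (t mod bt))).
    { intros t Lt. destruct (div_mod_lt t Lt) as [L1 L2].
      rewrite <- (mx_prod_pos bt (blkA p) (blkB p)).
      rewrite <- G2 by auto. replace (t / bt * bt + t mod bt) with t; [tauto|].
      pose proof (Nat.div_mod_eq t bt). lia. }
    eapply hwp_mono; [apply (scan_loop_spec p OUT); auto|reflexivity|].
    + frv F13. auto.
    + frv F13. auto.
    + frv F13. auto.
    + frv F13. auto.
    + eapply (OutInv_frame k Rs Q); [|exact F13|reflexivity..].
      eapply (OutInv_frame k Rs Q); [exact HO|exact F1|reflexivity..].
    + intros t Lt Hpos. apply HP in Hpos; auto. destruct Hpos as (l & Ll & P1 & P2).
      eapply btup_star; [exact P1|exact P2].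
    + intros h4 _ (F4 & OUT' & HO' & Inc & Hall). split; [|split].
      * ftrans F03 F4.
      * intros a q Lq'. fra F4. rewrite Gq by lia.
        rewrite HX2. destruct (Nat.eqb_spec (q mod nb) p); [lia|]. cbn [andb].
        fra F1. apply HZ. lia.
      * exists OUT'. split; auto. split; auto.
        intros i j l Li Lj Ll P1 P2.
        assert (Lt : i * bt + j < bt * bt) by nia.
        assert (E1 : (i * bt + j) / bt = i).
        { rewrite Nat.add_comm, Nat.div_add, Nat.div_small by lia. auto. }
        assert (E2 : (i * bt + j) mod bt = j).
        { rewrite Nat.add_comm, Nat.Div0.mod_add. apply Nat.mod_small; auto. }
        specialize (Hall (i * bt + j) Lt). rewrite (HP _ Lt), E1, E2 in Hall.
        apply Hall. exists l. auto.
Qed.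

Definition heavy_const : nat :=
  csz (set_sides k) + csz (comp k (Var Vu 0 * (Var Vw 0 * Var Vm 0))%e 0) +
  csz (set_blocks k) + for_cost Vp (Var Vnb 0) + 3.

Definition heavy_cost : nat :=
  heavy_const * (1 + if 0 <? bt then nb * (1 + block_cost) else 0).

Lemma block_index I L J : I < nu -> L < nv -> J < nw ->
  (I * nv + L) * nw + J < nb /\ ((I * nv + L) * nw + J) mod nw = J /\
  ((I * nv + L) * nw + J) / nw mod nv = L /\ ((I * nv + L) * nw + J) / nw / nv = I.
Proof.
  intros H1 H2 H3.
  assert (E1 : ((I * nv + L) * nw + J) / nw = I * nv + L).
  { rewrite Nat.add_comm, Nat.div_add, Nat.div_small by lia. auto. }
  split; [|split; [|split]].
  - unfold nb. assert (I * nv + L < nu * nv) by nia. nia.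
  - rewrite Nat.add_comm, Nat.Div0.mod_add. apply Nat.mod_small; auto.
  - rewrite E1, Nat.add_comm, Nat.Div0.mod_add. apply Nat.mod_small; auto.
  - rewrite E1, Nat.add_comm, Nat.div_add, Nat.div_small by lia. auto.
Qed.

Lemma heavy_phase_spec OUT h :
  Inp h -> Built h -> hv h VQ 0 = Z.of_nat Q -> HeavyLists k hx hy h -> OutInv OUT h ->
  (forall a q, ha h ABox a q = 0%Z) ->
  hwp (heavy_phase k mm) heavy_cost (fun h' => exists OUT', OutInv OUT' h' /\ incl OUT OUT' /\
    forall a b, in_join Rs a b -> (forall i, i < k -> In (nth i a 0) (hx i)) -> In b hy ->
      In a OUT') h.
Proof.
  intros HI HBt EQ HH HO HZ.
  eapply hwp_seq with (T1 := csz (set_sides k))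
    (T2 := heavy_cost - csz (set_sides k)); [|unfold heavy_cost, heavy_const; nia].
  eapply hwp_mono; [apply set_sides_spec; auto|reflexivity|].
  intros h1 _ (F1 & Eu & Ew & HS1).
  pose proof (HeavyLists_frame k _ _ _ _ _ _ HH F1 eq_refl eq_refl) as HH1.
  assert (Em : hv h1 Vm 0 = Z.of_nat (length hy)) by apply HH1.
  assert (Epos : (0 < Z.of_nat nrow * (Z.of_nat ncol * Z.of_nat (length hy)))%Z <-> 0 < bt).
  { unfold bt. split; intros Hp.
    - assert (nrow <> 0 /\ ncol <> 0 /\ length hy <> 0); [|lia].
      repeat split; intros Z0; rewrite Z0 in Hp; lia.
    - repeat apply Z.mul_pos_pos; lia. }
  eapply (hwp_if k w B HB2 HBw _ _ _ _
    (csz (set_blocks k) + for_cost Vp (Var Vnb 0) +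
      nb * (block_cost + for_cost Vp (Var Vnb 0))) 1);
    cbn [eval eval_op]; try rewrite Eu, Ew, Em; try rewrite Epos.
  - cbn. auto.
  - cbn; lia.
  - intros Pb.
    eapply hwp_seq with (T1 := csz (set_blocks k))
      (T2 := for_cost Vp (Var Vnb 0) + nb * (block_cost + for_cost Vp (Var Vnb 0)));
      [|lia].
    eapply hwp_mono; [apply set_blocks_spec; auto|reflexivity|].
    intros h2 _ (F2 & HBk).
    assert (F02 : frame [Vu; Vw; Vrad; Vbase; Vbeta; Vnv; Vnw; Vnb] [] h h2).
    { eapply frame_trans; [|exact F2|reflexivity|reflexivity].
      fweak F1. }
    assert (R2 : Ready h2).
    { split; [|split; [|split; [|split; [|split]]]]; auto.
      - eapply Inp_frame; [exact HI|exact F02|reflexivity..].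
      - eapply Built_frame; [exact HBt|exact F02|reflexivity..].
      - frv F02. auto.
      - eapply HeavyLists_frame; [exact HH1|exact F2|reflexivity..].
      - eapply Sides_frame; [exact HS1|exact F2|reflexivity..]. }
    eapply hwp_mono; [eapply (hwp_for k w B HB2 HBw Vp) with (n := nb)
      (T := fun _ => block_cost)
      (I := fun p h' => frame (Vp :: HV) HA h2 h' /\ hv h' Vp 0 = Z.of_nat p /\
        (forall a q, p <= q mod nb -> ha h' ABox a q = 0%Z) /\
        exists OUT', OutInv OUT' h' /\ incl OUT OUT' /\
        forall p' i j l, p' < p -> i < bt -> j < bt -> l < bt ->
          0 < blkA p' i l -> 0 < blkB p' l j -> In (btup (brow p' i) (bcol p' j)) OUT')| |].
    + cbn; lia.
    + exact I.
    + pose proof (nat_B k w B Rs Q E nb (2 * k + 1) 8 (nb_B Pb) ltac:(lia) ltac:(lia)). lia.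
    + exact I.
    + split; [frm|]. split; [reflexivity|]. split.
      * intros a q _. hs. fra F02. apply HZ.
      * exists OUT. split; [|split; [apply incl_refl|intros; lia]].
        eapply (OutInv_frame k Rs Q [Vp] [] _ h2); [|frm|reflexivity..].
        eapply (OutInv_frame k Rs Q); [exact HO|exact F02|reflexivity..].
    + intros p h' Lp _ (F & Ep & _). split; [exact I|]. split; auto.
      cbn [eval]. frv F. apply HBk.
    + intros p h' Lp _ (F & Ep & HZ' & OUT' & HO' & Inc & Hall).
      pose proof (Ready_frame _ _ _ _ R2 F eq_refl eq_refl) as R'.
      eapply hwp_mono; [apply (block_spec p OUT'); auto|reflexivity|].
      intros h3 _ (F3 & HZ3 & OUT3 & HO3 & Inc3 & Hall3).
      split; [frv F3; auto|]. split; [exact I|].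
      split; [frm; ftrans F F3|].
      split; [reflexivity|]. split; [intros a q Lq; apply HZ3; lia|].
      exists OUT3. split; [|split].
      * eapply (OutInv_frame k Rs Q [Vp] []); [exact HO3|frm|reflexivity..].
      * eapply incl_tran; eauto.
      * intros p' i j l Lp' Li Lj Ll P1 P2. destruct (Nat.eq_dec p' p) as [->|].
        -- apply (Hall3 i j l); auto.
        -- apply Inc3, (Hall p' i j l); auto. lia.
    + rewrite sumn_const. unfold for_cost. nia.
    + intros h' _ (F & _ & _ & OUT' & HO' & Inc & Hall).
      exists OUT'. split; auto. split; auto. intros a b Hj Ha Hb.
      destruct (btup_complete a b Hj Ha) as (r & s & Lr & Ls & Ea & P1 & P2).
      apply (In_nth _ _ 0) in Hb. destruct Hb as (c & Lc & Ec).
      change (hyv c = b) in Ec. rewrite <- Ec in P1, P2.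
      assert (Lq : forall a n, a < n -> a / bt < S (n / bt)).
      { intros a' n' L. pose proof (Nat.Div0.div_le_mono a' n' bt). lia. }
      (* Quotients by the block side locate the block of row [r], witness [c] and column [s]; the
         remainders are the indices inside it. *)
      destruct (block_index (r / bt) (c / bt) (s / bt)) as (B1 & B2 & B3 & B4);
        [apply Lq; auto..|].
      set (p := (r / bt * nv + c / bt) * nw + s / bt) in *.
      assert (Er : brow p (r mod bt) = r).
      { unfold brow. rewrite B4. pose proof (Nat.div_mod_eq r bt). lia. }
      assert (Es : bcol p (s mod bt) = s).
      { unfold bcol. rewrite B2. pose proof (Nat.div_mod_eq s bt). lia. }
      assert (Ecc : bmid p (c mod bt) = c).
      { unfold bmid. rewrite B3. pose proof (Nat.div_mod_eq c bt). lia. }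
      specialize (Hall p (r mod bt) (s mod bt) (c mod bt) B1).
      unfold blkA, blkB in Hall. rewrite Er, Es, Ecc in Hall. rewrite <- Ea.
      apply Hall; auto; apply Nat.mod_upper_bound; lia.
  (* With an empty side there is nothing to report: a tuple with only heavy components and a heavy
     witness would give an index below each of the three sides. *)
  - intros Pb. assert (Nb : ~ 0 < bt) by (rewrite <- Epos; lia).
    apply hwp_skip; [lia|]. exists OUT.
    split; [eapply (OutInv_frame k Rs Q); [exact HO|exact F1|reflexivity..]|].
    split; [apply incl_refl|]. intros a b Hj Ha Hb. exfalso. apply Nb.
    destruct (btup_complete a b Hj Ha) as (r & s & Lr & Ls & _).
    apply (In_nth _ _ 0) in Hb. destruct Hb as (c & Lc & _). unfold bt. lia.
  - intros Pb. unfold heavy_cost.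
    replace (0 <? bt) with true by (symmetry; apply Nat.ltb_lt; auto).
    unfold heavy_const. nia.
  - intros Pb. unfold heavy_cost, heavy_const. nia.
Qed.

End Heavy.

(** * Correctness and cost of the whole program *)

Section Whole.

Context (k : nat) (w B : Z) (Rs : list binrel) (D1 D2 Q : nat).
Hypothesis E : Env k w B Rs Q.

Notation hsl := (hsl k w B).
Notation hwp := (hwp k w B).
Notation R i := (nth i Rs (@nil (nat * nat))).
Notation Inp := (Inp k Rs D1 D2).
Notation OutInv := (OutInv k Rs Q).
Notation for_cost := (for_cost k).

Let HB2 := env_B2 _ _ _ _ _ E.
Let HBw := env_Bw _ _ _ _ _ E.

Definition output_const : nat :=
  csz (iter k (fun i => store k AIn i pv (Rd AOut i pv))) +
  2 * for_cost Vp (Var Vcnt 0) + csz (assign k VIn 0 (Var Vcnt 0)) + 1.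

Lemma output_spec OUT h :
  OutInv OUT h ->
  hwp (output k) (output_const * (1 + length OUT)) (fun h' =>
    hv h' VIn 0 = Z.of_nat (length OUT) /\
    forall p j, p < length OUT -> j < k ->
      ha h' AIn j p = Z.of_nat (nth j (nth p OUT []) 0)) h.
Proof.
  intros (ON & OS & Oc & Oo & _).
  pose proof (star_out_bound k w B Rs Q E OUT ON OS) as Lb.
  pose proof (nat_B k w B Rs Q E (length OUT) k 1 ltac:(lia) ltac:(lia) ltac:(lia)) as LB.
  unfold output. eapply hwp_seq with (T2 := csz (assign k VIn 0 (Var Vcnt 0)))
    (T1 := for_cost Vp (Var Vcnt 0) + length OUT *
       (csz (iter k (fun i => store k AIn i pv (Rd AOut i pv))) + for_cost Vp (Var Vcnt 0)));
    [|unfold output_const; nia].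
  eapply hwp_mono; [eapply (hwp_for k w B HB2 HBw Vp) with (n := length OUT)
      (T := fun _ => csz (iter k (fun i => store k AIn i pv (Rd AOut i pv))))
      (I := fun p h' => frame [Vp] [AIn] h h' /\ hv h' Vp 0 = Z.of_nat p /\
        forall p' j, p' < p -> j < k ->
          ha h' AIn j p' = Z.of_nat (nth j (nth p' OUT []) 0))| |].
  - cbn; lia.
  - exact I.
  - lia.
  - exact I.
  - split; [frm|]. split; [reflexivity|]. intros; lia.
  - intros p h' Lp _ (F & Ep & _). split; [exact I|]. split; auto.
    cbn [eval]. frv F. auto.
  - intros p h' Lp _ (F & Ep & HX).
    eapply hwp_mono; [ |reflexivity|].
    { eapply iter_rule with (I := fun i h2 => frame [] [AIn] h' h2 /\
        (forall p' j, p' <> p -> ha h2 AIn j p' = ha h' AIn j p') /\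
        forall j, j < i -> ha h2 AIn j p = Z.of_nat (nth j (nth p OUT []) 0)).
      - split; [frm|]. split; auto. intros; lia.
      - intros i h2 Li (F2 & Ho & Hi).
        assert (Ep2 : hv h2 Vp 0 = Z.of_nat p) by (frv F2; auto).
        assert (Eo : ha h2 AOut i p = Z.of_nat (nth i (nth p OUT []) 0)).
        { rewrite (proj2 F2), (proj2 F) by reflexivity. auto. }
        sto p (Z.of_nat (nth i (nth p OUT []) 0)).
        + ev. auto.
        + ev. repeat split; auto. lia.
        + ev. auto.
        + intros Hb. ev. rewrite Nat2Z.id. split; auto. rewrite <- Eo. apply Hb.
        + split; [frm; auto|]. split.
          * intros p' j Np. hs. destruct (Nat.eqb_spec p' p); [contradiction|].
            rewrite andb_false_r. auto.
          * intros j Lj. hs. rewrite Nat.eqb_refl, andb_true_r.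
            destruct (Nat.eqb_spec j i) as [->|]; auto. apply Hi. lia. }
    intros h2 _ (F2 & Ho & Hi). split; [frv F2; auto|].
    split; [exact I|].
    split; [frm; ftrans F F2|].
    split; [reflexivity|]. intros p' j Lp' Lj. hs.
    destruct (Nat.eq_dec p' p) as [->|]; [auto|]. rewrite Ho by auto. apply HX; lia.
  - rewrite sumn_const. unfold for_cost. nia.
  - intros h2 _ (F2 & _ & HX).
    assert (Ec : hv h2 Vcnt 0 = Z.of_nat (length OUT)) by (frv F2; auto).
    asg (Z.of_nat (length OUT)).
    + ev. auto.
    + intros _. ev. auto.
    + split; [reflexivity|]. intros. hs. auto.
Qed.

Definition scan_cost : nat :=
  csz (assign k VQ 0 1%Z) + 1 + sumn (fun i => for_cost Vp (size_of i) +
       sumn (fun p => csz (load k i ;; assign k VQ 0 (qv + ((xv + yv) + 1%Z))%e)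
                      + for_cost Vp (size_of i)) (length (R i))) k +
  S (sumn (fun i => for_cost Vp (size_of i) +
       sumn (fun p => csz (build_tuple k i) + for_cost Vp (size_of i)) (length (R i))) k) +
  S (sumn (fun i => for_cost Vp (size_of i) +
       sumn (fun p => csz (find_body k i) + for_cost Vp (size_of i)) (length (R i))) k).

Definition light_cost : nat :=
  S (sumn (fun j => for_cost Vp (size_of j) +
       sumn (fun p => lcost k Rs D1 D2 j p + for_cost Vp (size_of j)) (length (R j))) k).

Context (mm : cmd) (e0 : nat) (TB : nat -> nat).
Hypothesis Hmm : forall n A1 A2, 1 <= n -> exists s t,
  runs mm e0 (mx_input n A1 A2) s t /\ mx_output n (mx_prod n A1 A2) s /\ t <= TB n.
Hypothesis HB0 : ((Z.of_nat Q + 2) ^ Z.of_nat e0 <= B)%Z.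

Lemma star_query_run h s :
  Q = stride Rs -> rep k B h s -> Inp h ->
  (forall v i, v <> VIn -> hv h v i = 0%Z) ->
  (forall a i p, a <> AIn -> ha h a i p = 0%Z) ->
  exists OUT hx hy s' t,
    exec w (star_query k mm) s s' t /\ enumerates OUT (star_out Rs) /\
    star_output k OUT s' /\
    (forall i, i < k -> NoDup (hx i)) /\ NoDup hy /\
    Found k Rs D1 D2 (fun j => R j) hx hy /\
    t <= scan_cost + light_cost + heavy_cost k hx hy mm TB + output_const * (1 + length OUT).
Proof.
  intros EQ R0 I0 Z1 Z2.
  assert (Hk : 2 <= k) by apply E.
  destruct (set_stride_spec k w B Rs D1 D2 Q E h I0 EQ ltac:(apply R0) s R0)
    as (s1 & h1 & t1 & X1 & R1 & T1 & F1 & EQ1).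
  assert (I1 : Inp h1) by (eapply Inp_frame; [exact I0|exact F1|reflexivity..]).
  destruct (build_spec k w B Rs D1 D2 Q E h1 I1 EQ1) with (s := s1)
    as (s2 & h2 & t2 & X2 & R2 & T2 & F2 & B2); [|apply R1|exact R1|].
  { intros. fra F1. auto. }
  assert (I2 : Inp h2) by (eapply Inp_frame; [exact I1|exact F2|reflexivity..]).
  assert (EQ2 : hv h2 VQ 0 = Z.of_nat Q) by (frv F2; auto).
  destruct (light_phase_spec k w B Rs D1 D2 Q E h2 I2 B2 EQ2) with (s := s2)
    as (s3 & h3 & t3 & X3 & R3 & T3 & F3 & OUT3 & O3 & L3); [|apply R2|exact R2|].
  { split; [constructor|]. split; [intros a []|]. split; [|split].
    - rewrite (proj1 F2), (proj1 F1) by reflexivity. apply Z1. discriminate.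
    - cbn; intros; lia.
    - intros c. rewrite (proj2 F2), (proj2 F1) by reflexivity. apply Z2. discriminate. }
  assert (I3 : Inp h3) by (eapply Inp_frame; [exact I2|exact F3|reflexivity..]).
  assert (B3 : Built k Rs Q h3) by (eapply Built_frame; [exact B2|exact F3|reflexivity..]).
  assert (EQ3 : hv h3 VQ 0 = Z.of_nat Q) by (frv F3; auto).
  destruct (find_heavy_spec k w B Rs D1 D2 Q E h3 I3 B3) with (s := s3)
    as (s4 & h4 & t4 & X4 & R4 & T4 & F4 & hx & hy & H4 & HF); [| | |apply R3|exact R3|].
  { intros. rewrite (proj1 F3), (proj1 F2), (proj1 F1) by reflexivity. apply Z1. discriminate. }
  { rewrite (proj1 F3), (proj1 F2), (proj1 F1) by reflexivity. apply Z1. discriminate. }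
  { intros a i p Ha. assert (a <> AIn) by (intros ->; cbn in Ha; intuition discriminate).
    cbn in Ha. destruct Ha as [<-|[<-|[<-|[<-|[]]]]];
    rewrite (proj2 F3), (proj2 F2), (proj2 F1) by reflexivity; apply Z2; auto. }
  assert (I4 : Inp h4) by (eapply Inp_frame; [exact I3|exact F4|reflexivity..]).
  assert (B4 : Built k Rs Q h4) by (eapply Built_frame; [exact B3|exact F4|reflexivity..]).
  assert (EQ4 : hv h4 VQ 0 = Z.of_nat Q) by (frv F4; auto).
  assert (O4 : OutInv OUT3 h4) by (eapply (OutInv_frame k Rs Q); [exact O3|exact F4|reflexivity..]).
  destruct (pre_lt k w B Rs D1 D2 Q E (fun j => R j)) with (2 := HF) as [Lx Ly].
  { intros; apply incl_refl. }
  destruct (heavy_phase_spec k w B Rs D1 D2 Q E hx hy) with (mm := mm) (e0 := e0) (TB := TB)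
    (OUT := OUT3) (h := h4) (s := s4)
    as (s5 & h5 & t5 & X5 & R5 & T5 & OUT & O5 & Inc & C5);
    [ | | | | | | | | | | |apply R4|exact R4|]; auto.
  { intros i Li. apply NoDup_lt_length; [apply H4; auto|]. intros x. apply Lx; auto. }
  { apply NoDup_lt_length; [apply H4; auto|]. auto. }
  { intros a q. rewrite (proj2 F4), (proj2 F3), (proj2 F2), (proj2 F1) by reflexivity.
    apply Z2. discriminate. }
  destruct (output_spec OUT h5 O5) with (s := s5)
    as (s6 & h6 & t6 & X6 & R6 & T6 & C6 & A6); [apply R5|exact R5|].
  exists OUT, hx, hy, s6, (t1 + (t2 + (t3 + (t4 + (t5 + t6))))).
  split; [|split; [|split; [|split; [|split; [|split]]]]].
  - unfold star_query. repeat (eapply exec_seq; [eassumption|]). eassumption.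
  - split; [apply O5|]. intros a. split; [apply O5|]. intros [b Hj].
    pose proof Hj as Hj'. apply (in_join_nth k w B Rs Q E) in Hj'. destruct Hj' as [La Hn].
    destruct (existsb (fun j => light k Rs D1 D2 j (nth j a 0) b) (List.seq 0 k)) eqn:El.
    + apply existsb_exists in El. destruct El as (j & Hjk & El). apply in_seq in Hjk.
      apply Inc, (L3 a b j); auto; [lia|left; lia].
    + assert (El' : forall j, j < k -> light k Rs D1 D2 j (nth j a 0) b = false).
      { intros j Lj. destruct (light k Rs D1 D2 j (nth j a 0) b) eqn:Ej; auto.
        rewrite <- El. symmetry. apply existsb_exists. exists j. split; auto.
        apply in_seq. lia. }
      apply (C5 a b Hj).
      * intros i Li. apply HF; auto. specialize (El' i Li). unfold light in El'.
        apply orb_false_elim in El'. destruct El' as [El' _]. apply Nat.leb_gt in El'.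
        split; auto. change (nth i a 0) with (fst (nth i a 0, b)). apply in_map. auto.
      (* Lightness of the witness is a disjunct of [light] at every component, so looking at
         component 0 shows that [b] is heavy. *)
      * apply HF. specialize (El' 0 ltac:(lia)). unfold light in El'.
        apply orb_false_elim in El'. destruct El' as [_ El'].
        assert (Hex : existsb (fun i => D1 <? length (sec (R i) b)) (List.seq 0 k) = true).
        { destruct (existsb (fun i => D1 <? length (sec (R i) b)) (List.seq 0 k)) eqn:Ex; auto.
          rewrite <- El'. unfold light_y. apply forallb_forall. intros i Hi.
          apply Nat.leb_le. destruct (Nat.le_gt_cases (length (sec (R i) b)) D1) as [|G]; auto.
          exfalso. assert (true = false); [|discriminate]. rewrite <- Ex. symmetry.
          apply existsb_exists. exists i. split; auto. apply Nat.ltb_lt; auto. }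
        apply existsb_exists in Hex. destruct Hex as (i & Hi & Hl). apply in_seq in Hi.
        apply Nat.ltb_lt in Hl. exists i. split; [lia|]. split; auto.
        change b with (snd (nth i a 0, b)) at 1. apply in_map. apply Hn. lia.
  - destruct R6 as (Q1 & Q2 & _). split.
    + rewrite <- C6. apply (Q1 VIn 0). cbn. lia.
    + intros p j Lp Lj. rewrite <- A6 by auto. apply (Q2 AIn j p). cbn. lia.
  - intros i Li. apply H4; auto.
  - apply H4.
  - exact HF.
  - unfold scan_cost, light_cost. lia.
Qed.

End Whole.

(** * Numbers of the input and the overflow bound *)

Lemma weight_cons x y l : weight ((x, y) :: l) = x + y + 1 + weight l.
Proof. reflexivity. Qed.

Lemma weight_In x y l : In (x, y) l -> x + y + 1 <= weight l.
Proof.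
  induction l as [|[u v] l IH]; [intros []|]. rewrite weight_cons.
  intros [H|H]; [inversion H; subst; lia|]. specialize (IH H). lia.
Qed.

Lemma length_weight l : length l <= weight l.
Proof. induction l as [|[u v] l IH]; [auto|]. rewrite weight_cons. cbn [length]. lia. Qed.

Lemma weight_concat Rs i : i < length Rs -> weight (nth i Rs []) <= weight (concat Rs).
Proof.
  revert i. induction Rs as [|S Rs IH]; intros i L; cbn in L; [lia|].
  cbn [concat]. rewrite weight_app. destruct i; cbn [nth]; [lia|].
  specialize (IH i ltac:(lia)). lia.
Qed.

Lemma weight_le l v : (forall x y, In (x, y) l -> x <= v /\ y <= v) ->
  weight l <= length l * (2 * v + 1).
Proof.
  induction l as [|[x y] l IH]; intros H; [cbn; lia|]. rewrite weight_cons. cbn [length].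
  pose proof (H x y ltac:(cbn; auto)).
  specialize (IH ltac:(intros; apply H; cbn; auto)). nia.
Qed.

Lemma weight_concat_le Rs c : (forall S, In S Rs -> weight S <= c) ->
  weight (concat Rs) <= length Rs * c.
Proof.
  induction Rs as [|S Rs IH]; intros H; [cbn; lia|].
  cbn [concat length]. rewrite weight_app.
  pose proof (H S ltac:(cbn; auto)). specialize (IH ltac:(intros; apply H; cbn; auto)). nia.
Qed.

Lemma stride_env k w B Rs :
  2 <= k -> length Rs = k -> (forall S, In S Rs -> NoDup S) ->
  (2 <= B)%Z -> (B ^ 24 <= w)%Z ->
  (Z.of_nat (16 * stride Rs ^ (2 * k + 3)) <= B)%Z ->
  Env k w B Rs (stride Rs).
Proof.
  intros Hk Lk HN HB HBw HBQ. split; auto.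
  - intros i Li. apply HN. apply nth_In. unfold binrel in *. lia.
  - intros i x y Li Hin. apply weight_In in Hin.
    pose proof (weight_concat Rs i ltac:(unfold binrel in *; lia)). unfold stride, binrel in *. lia.
  - intros i Li. pose proof (length_weight (nth i Rs [])).
    pose proof (weight_concat Rs i ltac:(unfold binrel in *; lia)). unfold stride, binrel in *. lia.
Qed.

Definition init_hst (k : nat) (s : state) : hst :=
  Hst (fun v i => match v with VIn => if i <? k + 2 then reg s i else 0%Z | _ => 0%Z end)
      (fun a i p => match a with AIn => if i <? 2 * k then arr s i p else 0%Z | _ => 0%Z end).

Lemma init_rep k B D1 D2 Rs :
  length Rs = k -> (0 <= B)%Z -> bounded B (star_input D1 D2 Rs) ->
  rep k B (init_hst k (star_input D1 D2 Rs)) (star_input D1 D2 Rs).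
Proof.
  intros Lk PB [Hb1 Hb2].
  assert (Hn : forall i, k <= i -> nth i Rs [] = []) by (intros; apply nth_overflow; lia).
  split; [|split; [|split]].
  - intros v i O. cbn [init_hst hv].
    assert (Hz : forall n, reg (star_input D1 D2 Rs) (k + 2 + n) = 0%Z).
    { intros n. replace (k + 2 + n) with (S (S (k + n))) by lia. cbn. rewrite Hn by lia. auto. }
    destruct v; cbn [okv] in O; try tauto; try apply Hz.
    unfold rg. destruct (Nat.ltb_spec i (k + 2)); auto. lia.
  - intros a i p O. cbn [init_hst ha].
    assert (Hz : forall n, arr (star_input D1 D2 Rs) (2 * k + n) p = 0%Z).
    { intros n. cbn [star_input arr].
      assert (k <= (2 * k + n) / 2) by (apply Nat.div_le_lower_bound; lia).
      rewrite Hn by auto. destruct p; cbn; destruct (Nat.even _); auto. }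
    destruct a; try apply Hz. unfold ar. cbn [oka] in O.
    destruct (Nat.ltb_spec i (2 * k)); auto. lia.
  - intros v i. cbn [init_hst hv]. destruct v; try (rewrite Z.abs_0; exact PB).
    destruct (Nat.ltb_spec i (k + 2)); [apply Hb1|cbn; lia].
  - intros a i p. cbn [init_hst ha]. destruct a; try (rewrite Z.abs_0; exact PB).
    destruct (Nat.ltb_spec i (2 * k)); [apply Hb2|cbn; lia].
Qed.

Lemma init_Inp k D1 D2 Rs :
  length Rs = k -> Inp k Rs D1 D2 (init_hst k (star_input D1 D2 Rs)).
Proof.
  intros Lk. unfold Inp. cbn [init_hst hv ha].
  rewrite !(proj2 (Nat.ltb_lt _ _)) by lia. split; [reflexivity|]. split; [reflexivity|].
  split.
  - intros i Li. rewrite (proj2 (Nat.ltb_lt _ _)) by lia. reflexivity.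
  - intros i p Li Lp. rewrite !(proj2 (Nat.ltb_lt _ _)) by lia. cbn [star_input arr].
    rewrite (Nat.mul_comm 2 i), Nat.div_mul by lia.
    rewrite Nat.div_add_l by lia. change (1 / 2) with 0. rewrite Nat.add_0_r.
    rewrite (Nat.mul_comm i 2), Nat.even_even, Nat.even_odd.
    destruct (nth p (nth i Rs []) (0, 0)). auto.
Qed.

Lemma input_value D1 D2 (Rs : list binrel) i x y :
  In (x, y) (nth i Rs []) ->
  exists a a' p, arr (star_input D1 D2 Rs) a p = Z.of_nat x /\
               arr (star_input D1 D2 Rs) a' p = Z.of_nat y.
Proof.
  unfold binrel in *.
  intros H. apply (In_nth _ _ (0, 0)) in H. destruct H as (p & Lp & Ep).
  exists (i * 2), (i * 2 + 1), p. cbn [star_input arr]. unfold binrel.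
  rewrite Nat.div_mul by lia.
  rewrite Nat.div_add_l by lia. change (1 / 2) with 0. rewrite Nat.add_0_r, Ep.
  rewrite (Nat.mul_comm i 2), Nat.even_even, Nat.even_odd. auto.
Qed.

(** A bound [V] on the input limits both the values and, through the size registers, the number of
    tuples of each relation, so the stride is at most [1 + k * V * (2 * V + 1)]. The exponent
    absorbs [k] by [k < (V + 2) ^ k] and the polynomial in [V] by a fourth power. *)
Lemma stride_le V D1 D2 Rs :
  bounded V (star_input D1 D2 Rs) ->
  (Z.of_nat (stride Rs) <= (V + 2) ^ Z.of_nat (length Rs + 4))%Z.
Proof.
  intros [H1 H2]. pose proof (H1 0) as H0.
  assert (V0 : (0 <= V)%Z) by lia. clear H0.
  destruct (Z_of_nat_complete V V0) as [v ->].
  assert (HW : weight (concat Rs) <= length Rs * (v * (2 * v + 1))).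
  { apply weight_concat_le. intros S HS. apply (In_nth _ _ []) in HS.
    destruct HS as (i & Li & <-). etransitivity; [apply weight_le with (v := v)|].
    - intros x y Hin. destruct (input_value D1 D2 Rs i x y Hin) as (a & a' & p & E1 & E2).
      pose proof (H2 a p). pose proof (H2 a' p). lia.
    - specialize (H1 (S (S i))). cbn in H1. unfold binrel in *. apply Nat.mul_le_mono; lia. }
  replace (Z.of_nat v + 2)%Z with (Z.of_nat (v + 2)) by lia.
  rewrite <- Nat2Z.inj_pow. apply inj_le. unfold stride.
  rewrite Nat.pow_add_r.
  assert (Hk : length Rs < (v + 2) ^ length Rs) by (apply Nat.pow_gt_lin_r; lia).
  assert (H4 : 1 + v * (2 * v + 1) <= (v + 2) ^ 4) by (cbn; nia).
  set (P := (v + 2) ^ length Rs) in *. set (F := (v + 2) ^ 4) in *. nia.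
Qed.

(** One concrete bound of the input: it provides the run with which the runs for all other bounds
    are then identified. *)
Definition input_bound (D1 D2 : nat) (Rs : list binrel) : Z :=
  Z.of_nat (D1 + D2 + stride Rs).

Lemma input_bounded D1 D2 Rs : bounded (input_bound D1 D2 Rs) (star_input D1 D2 Rs).
Proof.
  assert (G : forall i, weight (nth i Rs []) <= weight (concat Rs)).
  { intros i. destruct (Nat.lt_ge_cases i (length Rs)); [apply weight_concat; auto|].
    rewrite nth_overflow by auto. cbn. lia. }
  unfold input_bound, stride. split.
  - intros [|[|i]]; cbn [star_input reg]; [lia|lia|].
    pose proof (length_weight (nth i Rs [])). specialize (G i). lia.
  - intros a p. cbn [star_input arr]. specialize (G (a / 2)).
    destruct (Nat.lt_ge_cases p (length (nth (a / 2) Rs []))) as [L|L].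
    + pose proof (nth_In _ (0, 0) L) as Hin.
      destruct (nth p (nth (a / 2) Rs []) (0, 0)) as [x y]. apply weight_In in Hin.
      destruct (Nat.even a); lia.
    + rewrite nth_overflow by auto. destruct (Nat.even a); lia.
Qed.

Lemma star_query_correct k mm e0 TB :
  2 <= k ->
  (forall n A1 A2, 1 <= n -> exists s t,
    runs mm e0 (mx_input n A1 A2) s t /\ mx_output n (mx_prod n A1 A2) s /\ t <= TB n) ->
  exists e, forall (D1 D2 : nat) (Rs : list binrel),
    length Rs = k -> (forall S, In S Rs -> NoDup S) ->
    exists OUT hx hy s t,
      enumerates OUT (star_out Rs) /\
      runs (star_query k mm) e (star_input D1 D2 Rs) s t /\
      star_output k OUT s /\
      (forall i, i < k -> NoDup (hx i)) /\ NoDup hy /\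
      Found k Rs D1 D2 (fun j => nth j Rs []) hx hy /\
      t <= scan_cost k Rs + light_cost k Rs D1 D2 + heavy_cost k hx hy mm TB
           + output_const k * (1 + length OUT).
Proof.
  (* With [T = V + 2], the three summands pay for [16 <= T ^ 4], for [stride Rs <= T ^ (k + 4)]
     raised to the power [2 * k + 3], and for [stride Rs + 2 <= T ^ (k + 6)] raised to the power
     [e0]. The factor 24 below is the size limit of expressions. *)
  intros Hk Hmm. set (b := 4 + (k + 4) * (2 * k + 3) + (k + 6) * e0).
  exists (b * 24). intros D1 D2 Rs Lk HN.
  assert (G : forall V, bounded V (star_input D1 D2 Rs) ->
    exists OUT hx hy s' t,
      exec ((V + 2) ^ Z.of_nat (b * 24)) (star_query k mm) (star_input D1 D2 Rs) s' t /\
      enumerates OUT (star_out Rs) /\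
      star_output k OUT s' /\
      (forall i, i < k -> NoDup (hx i)) /\ NoDup hy /\
      Found k Rs D1 D2 (fun j => nth j Rs []) hx hy /\
      t <= scan_cost k Rs + light_cost k Rs D1 D2 + heavy_cost k hx hy mm TB
           + output_const k * (1 + length OUT)).
  { intros V HV. pose proof (stride_le V D1 D2 Rs HV) as HQ. unfold binrel in HQ, Lk; rewrite Lk in HQ.
    pose proof (proj1 HV 0) as V0. assert (V1 : (0 <= V)%Z) by lia. clear V0.
    set (T := (V + 2)%Z) in *. assert (T2 : (2 <= T)%Z) by (unfold T; lia).
    set (B := (T ^ Z.of_nat b)%Z).
    assert (Tm : forall m n, m <= n -> (T ^ Z.of_nat m <= T ^ Z.of_nat n)%Z)
      by (intros; apply Z.pow_le_mono_r; lia).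
    assert (Tp : forall m, (0 < T ^ Z.of_nat m)%Z) by (intros; apply Z.pow_pos_nonneg; lia).
    assert (T1 : (T ^ Z.of_nat 1 = T)%Z) by apply Z.pow_1_r.
    assert (BT : (T <= B)%Z) by (rewrite <- T1; apply Tm; unfold b; lia).
    assert (HBw : (B ^ 24 <= T ^ Z.of_nat (b * 24))%Z).
    { unfold B. rewrite Nat2Z.inj_mul, Z.pow_mul_r by lia. reflexivity. }
    assert (Ea : (Z.of_nat (16 * stride Rs ^ (2 * k + 3)) <= B)%Z).
    { rewrite Nat2Z.inj_mul, Nat2Z.inj_pow.
      assert (A1 : (Z.of_nat (stride Rs) ^ Z.of_nat (2 * k + 3) <=
                T ^ Z.of_nat ((k + 4) * (2 * k + 3)))%Z).
      { rewrite Nat2Z.inj_mul, Z.pow_mul_r by lia. apply Z.pow_le_mono_l. lia. }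
      assert (A2 : (16 <= T ^ Z.of_nat 4)%Z).
      { change 16%Z with (2 ^ Z.of_nat 4)%Z. apply Z.pow_le_mono_l. lia. }
      assert (A3 : (T ^ Z.of_nat (4 + (k + 4) * (2 * k + 3)) <= B)%Z)
        by (apply Tm; unfold b; lia).
      rewrite Nat2Z.inj_add, Z.pow_add_r in A3 by lia.
      pose proof (Tp ((k + 4) * (2 * k + 3))). nia. }
    assert (Eb : ((Z.of_nat (stride Rs) + 2) ^ Z.of_nat e0 <= B)%Z).
    { transitivity ((T ^ Z.of_nat (k + 6)) ^ Z.of_nat e0)%Z.
      - apply Z.pow_le_mono_l. split; [lia|].
        replace (k + 6) with ((k + 4) + 2) by lia.
        rewrite Nat2Z.inj_add, Z.pow_add_r by lia.
        assert (T ^ Z.of_nat 2 = T * T)%Z by (change (Z.of_nat 2) with 2%Z; ring).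
        pose proof (Tp (k + 4)). nia.
      - rewrite <- Z.pow_mul_r, <- Nat2Z.inj_mul by lia. apply Tm. unfold b. lia. }
    assert (E : Env k (T ^ Z.of_nat (b * 24)) B Rs (stride Rs)).
    { apply stride_env; auto. lia. }
    apply (star_query_run k _ B Rs D1 D2 (stride Rs) E mm e0 TB Hmm Eb
      (init_hst k (star_input D1 D2 Rs)) (star_input D1 D2 Rs) eq_refl).
    - apply init_rep; auto; [lia|]. destruct HV as [HV1 HV2].
      assert (V <= B)%Z by (unfold T in BT; lia).
      split; intros; etransitivity; [apply HV1|auto|apply HV2|auto].
    - apply init_Inp; auto.
    - intros v i Nv. cbn [init_hst hv]. destruct v; auto. congruence.
    - intros a i p Na. cbn [init_hst ha]. destruct a; auto. congruence. }
  (* The final state and the time are taken from the run for one bound; [exec_det] shows that the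
     run for any other [V] ends in the same state at the same time. *)
  destruct (G _ (input_bounded D1 D2 Rs)) as (OUT & hx & hy & s & t & X & P1 & P2 & P).
  exists OUT, hx, hy, s, t. split; [exact P1|]. split; [|split; [exact P2|exact P]].
  intros V HV. destruct (G V HV) as (_ & _ & _ & s' & t' & X' & _).
  destruct (exec_det _ _ _ _ _ _ _ _ X X') as [-> ->]. exact X'.
Qed.

(** * Counting *)

Lemma sumn_factor_le f n i : i < n -> f i <= sumn f n.
Proof.
  induction n; intros L; [lia|]. rewrite sumn_S.
  destruct (Nat.eq_dec i n) as [->|]; [lia|]. specialize (IHn ltac:(lia)). lia.
Qed.

Lemma sumn_ext f g n : (forall i, i < n -> f i = g i) -> sumn f n = sumn g n.
Proof.
  intros H. apply Nat.le_antisymm; apply sumn_le; intros; rewrite H; auto.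
Qed.

Lemma sumn_list {T} (d : T) (f : T -> nat) l :
  sumn (fun p => f (nth p l d)) (length l) = list_sum (map f l).
Proof.
  induction l as [|x l IH] using rev_ind; [reflexivity|].
  rewrite length_app, Nat.add_1_r, sumn_S, map_app, list_sum_app. cbn [map list_sum].
  rewrite nth_middle. rewrite <- IH. f_equal; [|cbn; lia].
  apply sumn_ext. intros i Li. now rewrite app_nth1.
Qed.

Lemma list_sum_map_cons {T} (f : T -> nat) x l :
  list_sum (map f (x :: l)) = f x + list_sum (map f l).
Proof. reflexivity. Qed.

Lemma list_sum_le {T} (f g : T -> nat) l :
  (forall x, In x l -> f x <= g x) -> list_sum (map f l) <= list_sum (map g l).
Proof.
  induction l as [|x l IH]; intros H; [auto|]. rewrite !list_sum_map_cons.
  pose proof (H x ltac:(cbn; auto)).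
  specialize (IH ltac:(intros; apply H; cbn; auto)). lia.
Qed.

Lemma list_sum_const {T} c (l : list T) : list_sum (map (fun _ => c) l) = length l * c.
Proof. induction l; [reflexivity|]. rewrite list_sum_map_cons. cbn [length]. lia. Qed.

Lemma list_sum_add {T} (f g : T -> nat) l :
  list_sum (map (fun x => f x + g x) l) = list_sum (map f l) + list_sum (map g l).
Proof. induction l; [reflexivity|]. rewrite !list_sum_map_cons. lia. Qed.

Lemma flat_map_length_sum {S T} (F : S -> list T) l :
  length (flat_map F l) = list_sum (map (fun x => length (F x)) l).
Proof.
  induction l; [reflexivity|]. rewrite list_sum_map_cons. cbn [flat_map].
  rewrite length_app. lia.
Qed.

(** The key [g] recovers the index from an element, so the lists for different indices are
    disjoint. *)
Lemma NoDup_flat_map_key {S T} (F : S -> list T) (g : T -> S) l :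
  NoDup l -> (forall t, In t l -> NoDup (F t)) ->
  (forall t e, In e (F t) -> g e = t) -> NoDup (flat_map F l).
Proof.
  intros N HF Hg. induction N as [|t l Hn N IH]; cbn; [constructor|].
  apply NoDup_app; [apply HF; cbn; auto|apply IH; intros; apply HF; cbn; auto|].
  intros e He He'. apply in_flat_map in He'. destruct He' as (t' & Ht' & He').
  apply Hg in He. apply Hg in He'. congruence.
Qed.

Lemma filter_filter_neq {T} (key : T -> nat) x z l : z <> x ->
  filter (fun t => Nat.eqb (key t) z) (filter (fun t => negb (Nat.eqb (key t) x)) l) =
  filter (fun t => Nat.eqb (key t) z) l.
Proof.
  intros N. induction l as [|t l IH]; [auto|]. cbn.
  destruct (Nat.eqb_spec (key t) x) as [E|E]; cbn; rewrite IH; auto.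
  destruct (Nat.eqb_spec (key t) z); auto. congruence.
Qed.

(** Fibres of [key] over distinct values are disjoint. The induction removes the fibre of one value
    from [l], which leaves the other fibres intact. *)
Lemma heavy_count {T} (key : T -> nat) D H : NoDup H -> forall l,
  (forall x, In x H -> D <= length (filter (fun t => Nat.eqb (key t) x) l)) ->
  length H * D <= length l.
Proof.
  induction 1 as [|x H Hn N IH]; intros l Hl; [cbn; lia|].
  cbn [length]. rewrite <- (filter_length (fun t => Nat.eqb (key t) x) l).
  pose proof (Hl x ltac:(cbn; auto)).
  assert (length H * D <= length (filter (fun t => negb (key t =? x)) l)); [|lia].
  apply IH. intros z Hz. rewrite filter_filter_neq by congruence. apply Hl. cbn; auto.
Qed.

Lemma filter_concat_le {T} (f : T -> bool) ls l :
  In l ls -> length (filter f l) <= length (filter f (concat ls)).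
Proof.
  induction ls as [|m ls IH]; [intros []|]. cbn [concat]. rewrite filter_app, length_app.
  intros [->|H]; [lia|]. specialize (IH H). lia.
Qed.

Lemma length_concat_le {T} (ls : list (list T)) n :
  (forall l, In l ls -> length l <= n) -> length (concat ls) <= length ls * n.
Proof.
  induction ls as [|m ls IH]; intros H; [cbn; lia|]. cbn [concat length].
  rewrite length_app. pose proof (H m ltac:(cbn; auto)).
  specialize (IH ltac:(intros; apply H; cbn; auto)). lia.
Qed.

Lemma digit_add rad n i r d : i < n -> 0 < prodn rad n ->
  digit rad (r + d * prodn rad n) i = digit rad r i.
Proof.
  intros L P. unfold digit. rewrite !quo_prodn.
  destruct (prodn_split rad n i L) as [c E].
  assert (Pi : prodn rad i <> 0) by (intros E0; rewrite E0 in E; lia).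
  replace (r + d * prodn rad n) with (r + (d * c * rad i) * prodn rad i)
    by (rewrite E; ring).
  now rewrite Nat.div_add, Nat.Div0.mod_add by auto.
Qed.

(** The top digit is the quotient by the product of the lower radices, since that quotient is
    already below the top radix; the remainders agree by induction. *)
Lemma digits_inj rad n : forall r r', r < prodn rad n -> r' < prodn rad n ->
  (forall i, i < n -> digit rad r i = digit rad r' i) -> r = r'.
Proof.
  induction n; intros r r' L L' H; [cbn in *; lia|]. cbn [prodn] in *.
  assert (P : 0 < prodn rad n) by nia.
  set (p := prodn rad n) in *.
  pose proof (Nat.div_mod_eq r p) as Er. pose proof (Nat.div_mod_eq r' p) as Er'.
  assert (E1 : r / p = r' / p).
  { specialize (H n ltac:(lia)). unfold digit in H. rewrite !quo_prodn in H. fold p in H.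
    rewrite !Nat.mod_small in H by (apply Nat.Div0.div_lt_upper_bound; lia). auto. }
  assert (E2 : r mod p = r' mod p).
  { apply IHn; try (apply Nat.mod_upper_bound; lia). intros i Li.
    rewrite <- (digit_add rad n i (r mod p) (r / p)) by auto.
    rewrite <- (digit_add rad n i (r' mod p) (r' / p)) by auto.
    fold p. replace (r mod p + r / p * p) with r by lia.
    replace (r' mod p + r' / p * p) with r' by lia. apply H; lia. }
  rewrite Er, Er', E1, E2. reflexivity.
Qed.

Lemma sec_NoDup R y : NoDup R -> NoDup (sec R y).
Proof.
  intros N. unfold sec. apply NoDup_map_NoDup_ForallPairs; [|apply NoDup_filter; auto].
  intros [a b] [c d] H1 H2 E. apply filter_In in H1, H2. cbn in *.
  destruct H1 as [_ H1], H2 as [_ H2]. apply Nat.eqb_eq in H1, H2. congruence.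
Qed.

Lemma prodn_one_le f c n j : (forall i, i < n -> f i <= c) -> j < n -> f j <= 1 ->
  prodn f n <= c ^ (n - 1).
Proof.
  induction n; intros H L H1; [lia|]. cbn [prodn].
  replace (S n - 1) with n by lia.
  destruct (Nat.eq_dec j n) as [->|N].
  - assert (prodn f n <= c ^ n) by (apply prodn_le; intros; apply H; lia). nia.
  - specialize (IHn ltac:(intros; apply H; lia) ltac:(lia) H1).
    pose proof (H n ltac:(lia)).
    replace (c ^ n) with (c ^ (n - 1) * c); [nia|].
    replace n with (S (n - 1)) at 2 by lia. cbn; lia.
Qed.

Section Counting.

Context (k : nat) (w B : Z) (Rs : list binrel) (D1 D2 Q : nat).
Hypothesis E : Env k w B Rs Q.
Notation R i := (nth i Rs (@nil (nat * nat))).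

Definition lightx (j x : nat) : bool := length (sec2 (R j) x) <=? D2.

(* The pairs (output tuple, witness) met through a light [j]-th component: they
   are distinct, and every output tuple has at most [D2] of them. *)
Definition lightJ (j : nat) : list (list nat * nat) :=
  flat_map (fun t => if lightx j (fst t)
    then map (fun s => (ltup k Rs j (fst t) (snd t) s, snd t)) (seq 0 (ltot k Rs j (snd t)))
    else []) (R j).

(** Relations have no repetitions, so a value determines its position in the list of partners of
    [y]; equal tuples thus have equal digits. The digit at [j] has radix 1 and is always 0. *)
Lemma ltup_inj j x y s s' : j < k ->
  s < ltot k Rs j y -> s' < ltot k Rs j y -> ltup k Rs j x y s = ltup k Rs j x y s' -> s = s'.
Proof.
  intros Lj L L' Eq. apply (digits_inj (lrad Rs j y) k); auto.
  intros i Li. assert (P : 0 < lrad Rs j y i) by (eapply (prodn_factor_pos _ k); [unfold ltot in L; lia|auto]).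
  pose proof (digit_lt (lrad Rs j y) s i P) as H1.
  pose proof (digit_lt (lrad Rs j y) s' i P) as H2.
  assert (En : nth i (ltup k Rs j x y s) 0 = nth i (ltup k Rs j x y s') 0) by congruence.
  unfold ltup in En. rewrite !nth_map_seq in En by auto.
  unfold lrad in H1 at 2. unfold lrad in H2 at 2.
  destruct (Nat.eqb_spec i j); [lia|].
  eapply (proj1 (NoDup_nth (sec (R i) y) 0)); auto.
  apply sec_NoDup. apply (env_NoDup _ _ _ _ _ E); auto.
Qed.

(** The pairs over an output tuple [a] have their witness among the partners of its [j]-th component
    in [R j], at most [D2] in number when that component is light. The pairs are distinct because
    component and witness together give back the tuple of [R j] they come from. *)
Lemma lightJ_length j OUT : j < k -> enumerates OUT (star_out Rs) ->
  length (lightJ j) <= length OUT * D2.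
Proof.
  intros Lj [_ HO].
  transitivity (length (flat_map (fun a => map (pair a)
     (if lightx j (nth j a 0) then sec2 (R j) (nth j a 0) else [])) OUT)).
  - apply NoDup_incl_length.
    + unfold lightJ. apply NoDup_flat_map_key with (g := fun e => (nth j (fst e) 0, snd e)).
      * apply (env_NoDup _ _ _ _ _ E); auto.
      * intros [x y] _. destruct (lightx j (fst (x, y))); [|constructor].
        cbn [fst snd]. apply NoDup_map_NoDup_ForallPairs; [|apply seq_NoDup].
        intros s s' Hs Hs' Eq. apply in_seq in Hs, Hs'. inversion Eq.
        eapply ltup_inj; eauto; lia.
      * intros [x y] e He. cbn [fst snd] in He. destruct (lightx j x); [|destruct He].
        apply in_map_iff in He. destruct He as (s & <- & _). cbn [fst snd].
        unfold ltup. rewrite nth_map_seq, Nat.eqb_refl by auto. auto.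
    + intros e He. unfold lightJ in He. apply in_flat_map in He.
      destruct He as ([x y] & Hin & He). cbn [fst snd] in He.
      destruct (lightx j x) eqn:El; [|destruct He].
      apply in_map_iff in He. destruct He as (s & <- & Hs). apply in_seq in Hs.
      assert (Ex : nth j (ltup k Rs j x y s) 0 = x).
      { unfold ltup. rewrite nth_map_seq, Nat.eqb_refl by auto. auto. }
      apply in_flat_map. exists (ltup k Rs j x y s). split.
      * apply HO. eapply ltup_star; eauto. lia.
      * rewrite Ex, El. apply in_map. apply in_sec2. auto.
  - rewrite flat_map_length_sum. rewrite <- list_sum_const. apply list_sum_le.
    intros a _. rewrite length_map. destruct (lightx j (nth j a 0)) eqn:El; [|cbn; lia].
    apply Nat.leb_le in El. auto.
Qed.

Lemma ltot_light j y : j < k -> 1 <= D1 -> light_y Rs D1 k y = true ->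
  ltot k Rs j y <= D1 ^ (k - 1).
Proof.
  intros Lj P Hl. unfold light_y in Hl. rewrite forallb_forall in Hl.
  apply prodn_one_le with (j := j); auto.
  - intros i Li. unfold lrad. destruct (i =? j); auto.
    apply Nat.leb_le, Hl, in_seq. lia.
  - unfold lrad. rewrite Nat.eqb_refl. auto.
Qed.

(** Work around a tuple with light [x] is charged to the pairs in [lightJ], whatever its [y]. If [x]
    is heavy, then [y] is light and the tuple itself pays [D1 ^ (k - 1)]. *)
Lemma light_sum j OUT : j < k -> 1 <= D1 -> enumerates OUT (star_out Rs) ->
  sumn (fun p => let '(x, y) := nth p (R j) (0, 0) in
                 if light k Rs D1 D2 j x y then ltot k Rs j y else 0) (length (R j))
  <= length (R j) * D1 ^ (k - 1) + length OUT * D2.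
Proof.
  intros Lj P HO.
  rewrite (sumn_list (0, 0) (fun t => let '(x, y) := t in
    if light k Rs D1 D2 j x y then ltot k Rs j y else 0)).
  etransitivity; [apply list_sum_le with (g := fun t => D1 ^ (k - 1) +
    (if lightx j (fst t) then ltot k Rs j (snd t) else 0))|].
  - intros [x y] _. unfold light. cbn [fst snd].
    destruct (lightx j x) eqn:El; unfold lightx in El; rewrite El; cbn [orb].
    + lia.
    + destruct (light_y Rs D1 k y) eqn:Ey; [|lia].
      pose proof (ltot_light j y Lj P Ey). lia.
  - rewrite list_sum_add, list_sum_const. apply Nat.add_le_mono_l.
    rewrite <- (lightJ_length j OUT Lj HO). unfold lightJ. rewrite flat_map_length_sum.
    apply list_sum_le. intros [x y] _. cbn [fst snd].
    destruct (lightx j x); [|cbn; lia]. now rewrite length_map, length_seq.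
Qed.

(** A heavy [x] is counted within its own relation. The relation in which a [y] is heavy varies, so
    the heavy [y] are counted in the concatenation of all relations, which is the origin of the
    factor [k]. *)
Lemma Found_count hx hy N :
  (forall i, i < k -> NoDup (hx i)) -> NoDup hy ->
  Found k Rs D1 D2 (fun j => R j) hx hy ->
  (forall S, In S Rs -> length S <= N) ->
  (forall i, i < k -> length (hx i) * D2 <= N) /\ length hy * D1 <= k * N.
Proof.
  intros Nx Ny [F1 F2] HN. pose proof (env_k _ _ _ _ _ E) as Ek.
  assert (Hin : forall i, i < k -> In (R i) Rs).
  { intros i Li. apply nth_In. unfold binrel in *. lia. }
  split.
  - intros i Li. etransitivity; [|apply (HN (R i)); auto].
    apply (heavy_count fst); auto. intros x Hx. apply F1 in Hx; auto.
    destruct Hx as [Hx _]. unfold sec2 in Hx. rewrite length_map in Hx. lia.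
  - etransitivity; [apply (heavy_count snd) with (l := concat Rs); auto|].
    + intros y Hy. apply F2 in Hy. destruct Hy as (j & Lj & Hy & _).
      unfold sec in Hy. rewrite length_map in Hy.
      pose proof (filter_concat_le (fun t => Nat.eqb (snd t) y) Rs (R j) (Hin j Lj)). lia.
    + rewrite <- Ek. apply length_concat_le. exact HN.
Qed.

Lemma phase_sum (a : nat -> nat) (g : nat -> nat -> nat) (n : nat -> nat) A N G :
  (forall i, i < k -> a i <= A) -> (forall i, i < k -> n i <= N) ->
  (forall i, i < k -> sumn (g i) (n i) <= G) ->
  sumn (fun i => a i + sumn (fun p => g i p + a i) (n i)) k <= k * (A + A * N + G).
Proof.
  intros HA HN HG. rewrite Nat.mul_comm, <- sumn_const. apply sumn_le.
  intros i Li. rewrite sumn_add, sumn_const.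
  specialize (HA i Li). specialize (HN i Li). specialize (HG i Li). nia.
Qed.

(** Here and in [tuple_max] a sum over the relations stands in for a maximum. *)
Definition fc_max : nat := sumn (fun i => for_cost k Vp (size_of i)) k.
Definition tuple_max : nat := sumn (fun i =>
  csz (load k i ;; assign k VQ 0 (qv + ((xv + yv) + 1%Z))%e) +
  csz (build_tuple k i) + csz (find_body k i) + light_const k i) k.

(** The factor 16 is generous: it leaves room for three linear passes, each with setup and body
    costs. *)
Definition base_const : nat := 16 * (csz (assign k VQ 0 1%Z) + 4 + k * (fc_max + tuple_max)).

Lemma scan_cost_le N :
  1 <= N -> (forall i, i < k -> length (R i) <= N) -> scan_cost k Rs <= base_const * N.
Proof.
  intros PN HN.
  assert (HA : forall i, i < k -> for_cost k Vp (size_of i) <= fc_max).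
  { intros i Li. apply (sumn_factor_le (fun i => for_cost k Vp (size_of i))); auto. }
  assert (HT : forall i, i < k ->
    csz (load k i ;; assign k VQ 0 (qv + ((xv + yv) + 1%Z))%e) +
    csz (build_tuple k i) + csz (find_body k i) + light_const k i <= tuple_max).
  { intros i Li. apply (sumn_factor_le (fun i =>
      csz (load k i ;; assign k VQ 0 (qv + ((xv + yv) + 1%Z))%e) +
      csz (build_tuple k i) + csz (find_body k i) + light_const k i)); auto. }
  assert (G : forall c : nat -> nat, (forall i, i < k -> c i <= tuple_max) ->
    sumn (fun i => for_cost k Vp (size_of i) + sumn (fun p => c i + for_cost k Vp (size_of i))
       (length (R i))) k <= k * (fc_max + fc_max * N + tuple_max * N)).
  { intros c Hc. apply (phase_sum _ (fun i _ => c i)); auto.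
    intros i Li. rewrite sumn_const. specialize (Hc i Li). specialize (HN i Li). nia. }
  unfold scan_cost.
  pose proof (G (fun i => csz (load k i ;; assign k VQ 0 (qv + ((xv + yv) + 1%Z))%e))
    ltac:(intros i Li; specialize (HT i Li); lia)) as G1.
  pose proof (G (fun i => csz (build_tuple k i))
    ltac:(intros i Li; specialize (HT i Li); lia)) as G2.
  pose proof (G (fun i => csz (find_body k i))
    ltac:(intros i Li; specialize (HT i Li); lia)) as G3.
  cbv beta in G1, G2, G3. unfold base_const.
  generalize dependent fc_max. generalize dependent tuple_max. intros.
  generalize dependent (csz (assign k VQ 0 1%Z)). intros c.
  remember (sumn _ k) as S1.
  assert (k * (n0 + n0 * N + n * N) <= 2 * (k * (n0 + n)) * N) by nia.
  nia.
Qed.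

Lemma light_cost_le OUT N :
  1 <= N -> 1 <= D1 -> (forall i, i < k -> length (R i) <= N) ->
  enumerates OUT (star_out Rs) ->
  light_cost k Rs D1 D2 <= 1 + k * (fc_max + fc_max * N +
    tuple_max * (N + N * D1 ^ (k - 1) + length OUT * D2)).
Proof.
  intros PN PD HN HO. unfold light_cost. apply le_n_S.
  apply (phase_sum _ (lcost k Rs D1 D2)); auto.
  - intros i Li. apply (sumn_factor_le (fun i => for_cost k Vp (size_of i))); auto.
  - intros j Lj. pose proof (light_sum j OUT Lj PD HO) as HS.
    rewrite (sumn_ext _ (fun p => light_const k j * (1 +
      let '(x, y) := nth p (R j) (0, 0) in
      if light k Rs D1 D2 j x y then ltot k Rs j y else 0))).
    2:{ intros p _. unfold lcost. destruct (nth p (R j) (0, 0)). reflexivity. }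
    rewrite sumn_mul, sumn_add, sumn_const.
    apply Nat.mul_le_mono.
    + pose proof (sumn_factor_le (fun i =>
        csz (load k i ;; assign k VQ 0 (qv + ((xv + yv) + 1%Z))%e) +
        csz (build_tuple k i) + csz (find_body k i) + light_const k i) k j Lj) as H.
      cbv beta in H. unfold tuple_max. lia.
    + specialize (HN j Lj). nia.
Qed.

Definition block_work (hx : nat -> list nat) (hy : list nat) (TB : nat -> nat) : nat :=
  let b := bt k hx hy in if 0 <? b then nb k hx hy * (b * b + TB b) else 0.

Lemma heavy_cost_le hx hy mm TB :
  heavy_cost k hx hy mm TB <=
  heavy_const k * (1 + (1 + 6 * block_const k mm) * block_work hx hy TB).
Proof.
  unfold heavy_cost, block_work, block_cost. apply Nat.mul_le_mono_l.
  destruct (Nat.ltb_spec 0 (bt k hx hy)) as [L|L]; [|lia].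
  set (b := bt k hx hy) in *. set (n := nb k hx hy). set (c := block_const k mm).
  assert (1 <= b * b) by nia.
  assert (1 + 3 * c * (1 + b * b + TB b) <= (1 + 6 * c) * (b * b + TB b)) by nia.
  nia.
Qed.

Definition total_const (mm : cmd) : nat :=
  base_const + 1 + k * (2 * fc_max + 2 * tuple_max) +
  heavy_const k * (2 + 6 * block_const k mm) + 2 * output_const k.

(** Additive constants and linear terms are absorbed because [1 <= N <= N * D1 ^ (k - 1)], and the
    cost of writing the output because [length OUT <= length OUT * D2]. *)
Lemma total_cost_le OUT hx hy mm TB N :
  1 <= N -> 1 <= D1 -> 1 <= D2 -> (forall i, i < k -> length (R i) <= N) ->
  enumerates OUT (star_out Rs) ->
  scan_cost k Rs + light_cost k Rs D1 D2 + heavy_cost k hx hy mm TB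
    + output_const k * (1 + length OUT) <=
  total_const mm * (N * D1 ^ (k - 1) + length OUT * D2 + block_work hx hy TB).
Proof.
  intros PN P1 P2 HN HO.
  pose proof (scan_cost_le N PN HN) as H1.
  pose proof (light_cost_le OUT N PN P1 HN HO) as H2.
  pose proof (heavy_cost_le hx hy mm TB) as H3.
  unfold total_const.
  assert (PD : 1 <= D1 ^ (k - 1)) by (apply Nat.neq_0_lt_0, Nat.pow_nonzero; lia).
  generalize dependent (block_work hx hy TB). intros W H3.
  set (X := N * D1 ^ (k - 1)) in *. set (Y := length OUT * D2) in *.
  assert (NX : N <= X) by (unfold X; nia).
  assert (OY : length OUT <= Y) by (unfold Y; nia).
  assert (A1 : base_const * N <= base_const * (X + Y + W)) by (apply Nat.mul_le_mono_l; lia).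
  assert (A2 : 1 + k * (fc_max + fc_max * N + tuple_max * (N + X + Y)) <=
    (1 + k * (2 * fc_max + 2 * tuple_max)) * (X + Y + W)).
  { assert (fc_max + fc_max * N + tuple_max * (N + X + Y) <=
      (2 * fc_max + 2 * tuple_max) * (X + Y + W)) by nia.
    nia. }
  assert (A3 : heavy_const k * (1 + (1 + 6 * block_const k mm) * W) <=
    heavy_const k * (2 + 6 * block_const k mm) * (X + Y + W)).
  { rewrite <- (Nat.mul_assoc _ _ (X + Y + W)). apply Nat.mul_le_mono_l. nia. }
  assert (A4 : output_const k * (1 + length OUT) <= 2 * output_const k * (X + Y + W)) by nia.
  rewrite !Nat.mul_add_distr_r. rewrite !Nat.mul_add_distr_r in A2. lia.
Qed.

End Counting.

(** Supplies the counting lemmas with an [Env] outside of any particular run. *)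
Lemma env_exists k Rs : 2 <= k -> length Rs = k -> (forall S, In S Rs -> NoDup S) ->
  exists w B, Env k w B Rs (stride Rs).
Proof.
  intros Hk Lk HN. set (B := (2 + Z.of_nat (16 * stride Rs ^ (2 * k + 3)))%Z).
  exists (B ^ 24)%Z, B. apply stride_env; auto; unfold B; lia.
Qed.

(** * The running time *)

Open Scope R_scope.

Lemma Rpower_pos x y : 0 < Rpower x y.
Proof. apply exp_pos. Qed.

Lemma Rpower_le_neg a b c : 0 < a <= b -> c <= 0 -> Rpower b c <= Rpower a c.
Proof.
  intros H Hc. replace c with (- (- c)) by ring. rewrite !(Rpower_Ropp _ (- c)).
  apply Rinv_le_contravar; [apply Rpower_pos|]. apply Rle_Rpower_l; lra.
Qed.

Lemma M_pos omega U V W : 0 < U -> 0 < V -> 0 < W -> 0 < M omega U V W.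
Proof. intros. unfold M. pose proof (Rpower_pos (Rmin U (Rmin V W)) (omega - 3)).
  repeat apply Rmult_lt_0_compat; auto. Qed.

Lemma Rmin3_cases U V W (P : R -> Prop) :
  (U <= V -> U <= W -> P U) -> (V <= U -> V <= W -> P V) -> (W <= U -> W <= V -> P W) ->
  P (Rmin U (Rmin V W)).
Proof.
  intros H1 H2 H3. unfold Rmin. destruct (Rle_dec V W); destruct (Rle_dec U _);
  (apply H1 || apply H2 || apply H3); lra.
Qed.

(** The power with exponent [omega - 3 < 0] shrinks as the sides grow. Since [omega - 3 >= -1], it
    shrinks at most by the factor [b / b'], so [u * v * w * b' <= U * V * W * b] suffices. Here [b]
    is one of [u], [v], [w]; once it is cancelled, [b'] is compared with the corresponding large
    side and the two others with theirs. *)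
Lemma M_mono omega u v w U V W :
  2 <= omega < 3 -> 0 < u <= U -> 0 < v <= V -> 0 < w <= W ->
  M omega u v w <= M omega U V W.
Proof.
  intros Ho Hu Hv Hw. unfold M.
  set (b := Rmin u (Rmin v w)). set (b' := Rmin U (Rmin V W)).
  assert (Hb : 0 < b) by (unfold b; apply Rmin3_cases; lra).
  assert (Hbb : b <= b').
  { unfold b, b'. apply (Rmin3_cases u v w); intros; apply (Rmin3_cases U V W); intros; lra. }
  assert (Eb : Rpower b' (omega - 3) = Rpower b (omega - 3) * Rpower (b' / b) (omega - 3)).
  { rewrite Rpower_mult_distr; auto; [f_equal; field; lra|].
    apply Rdiv_lt_0_compat; lra. }
  assert (Hr : b / b' <= Rpower (b' / b) (omega - 3)).
  { assert (1 <= b' / b).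
    { apply Rmult_le_reg_r with b; auto. replace (b' / b * b) with b' by (field; lra). lra. }
    transitivity (Rpower (b' / b) (Ropp 1)); [|apply Rle_Rpower; lra].
    rewrite Rpower_Ropp, Rpower_1 by lra. right. field. lra. }
  rewrite Eb. pose proof (Rpower_pos b (omega - 3)) as Hp.
  set (p := Rpower b (omega - 3)) in *.
  assert (Hk : u * v * w * b' <= U * V * W * b).
  { assert (H1 : b' <= U /\ b' <= V /\ b' <= W).
    { unfold b'. apply (Rmin3_cases U V W); lra. }
    assert (G : forall x y z X Y Z, 0 < x -> 0 < y <= Y -> 0 < z <= Z -> b' <= X ->
      0 < b' -> x * y * z * b' <= X * Y * Z * x).
    { intros x y z X Y Z Hx Hy Hz HX Hb'.
      assert (y * z <= Y * Z) by (apply Rmult_le_compat; lra).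
      assert (b' * (y * z) <= X * (Y * Z)) by (apply Rmult_le_compat; nra).
      nra. }
    apply (Rmin3_cases u v w (fun b => u * v * w * b' <= U * V * W * b)); intros.
    - apply G; lra.
    - pose proof (G v u w V U W). lra.
    - pose proof (G w u v W U V). lra. }
  assert (H1 : u * v * w <= U * V * W * (b / b')).
  { apply Rmult_le_reg_r with b'; [lra|].
    replace (U * V * W * (b / b') * b') with (U * V * W * b) by (field; lra). exact Hk. }
  assert (0 < U * V * W) by (repeat apply Rmult_lt_0_compat; lra).
  assert (U * V * W * (b / b') <= U * V * W * Rpower (b' / b) (omega - 3))
    by (apply Rmult_le_compat_l; lra).
  nra.
Qed.

(** Enlarging one side can only enlarge the minimum, and the exponent [omega - 3] is negative, so
    the product of the sides alone accounts for the growth. *)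
Lemma M_scale omega U V W c :
  omega < 3 -> 0 < U -> 0 < V -> 0 < W -> 1 <= c ->
  M omega U (c * V) W <= c * M omega U V W.
Proof.
  intros Ho HU HV HW Hc. unfold M.
  assert (V <= c * V) by nra.
  assert (Rpower (Rmin U (Rmin (c * V) W)) (omega - 3) <=
          Rpower (Rmin U (Rmin V W)) (omega - 3)).
  { apply Rpower_le_neg; [|lra].
    apply (Rmin3_cases U V W); intros; apply (Rmin3_cases U (c * V) W); intros; lra. }
  replace (c * (U * V * W * Rpower (Rmin U (Rmin V W)) (omega - 3)))
    with (U * (c * V) * W * Rpower (Rmin U (Rmin V W)) (omega - 3)) by ring.
  apply Rmult_le_compat_l; auto. repeat apply Rmult_le_pos; nra.
Qed.

Lemma INR_min a b : INR (Nat.min a b) = Rmin (INR a) (INR b).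
Proof.
  destruct (Nat.le_ge_cases a b) as [L|L].
  - rewrite Nat.min_l, Rmin_left; auto. apply le_INR; auto.
  - rewrite Nat.min_r, Rmin_right; auto. apply le_INR; auto.
Qed.

Lemma INR_prodn_le f x n :
  (forall i, (i < n)%nat -> INR (f i) <= x) -> INR (prodn f n) <= x ^ n.
Proof.
  induction n; intros H; [cbn; lra|]. cbn [prodn]. rewrite mult_INR.
  specialize (IHn ltac:(intros; apply H; lia)). specialize (H n ltac:(lia)).
  pose proof (pos_INR (f n)). pose proof (pos_INR (prodn f n)).
  cbn [pow]. rewrite (Rmult_comm x). apply Rmult_le_compat; auto.
Qed.

Lemma INR_le_div a d n : (1 <= d)%nat -> (a * d <= n)%nat -> INR a <= INR n / INR d.
Proof.
  intros Pd L. assert (0 < INR d) by (apply lt_0_INR; lia).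
  apply Rmult_le_reg_r with (INR d); auto.
  replace (INR n / INR d * INR d) with (INR n) by (field; lra).
  rewrite <- mult_INR. apply le_INR; auto.
Qed.

(* The block products cost [bt ^ omega] each, and there are at most
   [8 u v w / bt ^ 3] of them because [bt] is the least of the three sides. *)
Lemma block_work_le k hx hy TB omega C0 :
  2 <= omega < 3 -> 0 <= C0 ->
  (forall n, (1 <= n)%nat -> INR (TB n) <= C0 * Rpower (INR n) omega + 1) ->
  (0 < bt k hx hy)%nat ->
  INR (block_work k hx hy TB) <= 8 * (2 + C0) *
    M omega (INR (nrow k hx)) (INR (length hy)) (INR (ncol k hx)).
Proof.
  intros Ho HC HTB Pb. unfold block_work. rewrite (proj2 (Nat.ltb_lt _ _) Pb).
  set (b := bt k hx hy) in *. set (u := nrow k hx). set (m := length hy). set (v := ncol k hx).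
  assert (Hb : (b <= u /\ b <= m /\ b <= v)%nat)
    by (unfold b, bt; fold u m v; lia).
  (* A side is at least [b], so its additional block costs at most a factor 2; three sides give the
     8. *)
  assert (Hn : forall a, (b <= a)%nat -> (S (a / b) * b <= 2 * a)%nat).
  { intros a La. pose proof (Nat.Div0.mul_div_le a b). nia. }
  assert (Hnb : (nb k hx hy * (b * (b * b)) <= 8 * (u * (m * v)))%nat).
  { unfold nb, nu, nv, nw. fold b u m v.
    pose proof (Hn u ltac:(lia)). pose proof (Hn m ltac:(lia)). pose proof (Hn v ltac:(lia)).
    set (x := S (u / b)) in *. set (y := S (m / b)) in *. set (z := S (v / b)) in *.
    replace (x * (y * z) * (b * (b * b)))%nat with ((x * b) * ((y * b) * (z * b)))%nat by ring.
    replace (8 * (u * (m * v)))%nat with ((2 * u) * ((2 * m) * (2 * v)))%nat by ring.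
    apply Nat.mul_le_mono; [|apply Nat.mul_le_mono]; auto. }
  apply le_INR in Hnb. rewrite !mult_INR in Hnb. replace (INR 8) with 8 in Hnb by (cbn; lra).
  assert (B1 : 1 <= INR b) by (apply (le_INR 1); lia).
  set (bb := INR b) in *.
  (* Here [2 <= omega] enters: filling and scanning a block cost no more than multiplying. *)
  assert (Hsq : bb * bb <= Rpower bb omega).
  { replace (bb * bb) with (bb ^ 2) by ring. rewrite <- Rpower_pow by lra.
    apply Rle_Rpower; auto. cbn; lra. }
  assert (H1 : 1 <= Rpower bb omega) by nra.
  (* Of the 2, one unit pays for [b * b] and the other for the additive 1 in the bound on [TB]. *)
  assert (Hw : INR (b * b + TB b) <= (2 + C0) * Rpower bb omega).
  { rewrite plus_INR, mult_INR. fold bb. specialize (HTB b ltac:(lia)). fold bb in HTB. nra. }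
  rewrite mult_INR.
  assert (Emin : Rmin (INR u) (Rmin (INR m) (INR v)) = bb).
  { rewrite <- !INR_min. unfold bb, b, bt. fold u m v. f_equal. lia. }
  unfold M. rewrite Emin.
  assert (Ep : Rpower bb omega = Rpower bb (omega - 3) * (bb * (bb * bb))).
  { replace (bb * (bb * bb)) with (bb ^ 3) by ring. rewrite <- Rpower_pow by lra.
    rewrite <- Rpower_plus. f_equal. cbn. ring. }
  pose proof (Rpower_pos bb (omega - 3)) as Hp.
  set (p := Rpower bb (omega - 3)) in *. pose proof (pos_INR (nb k hx hy)) as Hn0.
  set (n := INR (nb k hx hy)) in *.
  transitivity (n * ((2 + C0) * Rpower bb omega)); [apply Rmult_le_compat_l; auto|].
  rewrite Ep.
  replace (n * ((2 + C0) * (p * (bb * (bb * bb))))) with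
    ((2 + C0) * p * (n * (bb * (bb * bb)))) by ring.
  replace (8 * (2 + C0) * (INR u * INR m * INR v * p)) with
    ((2 + C0) * p * (8 * (INR u * (INR m * INR v)))) by ring.
  apply Rmult_le_compat_l; auto. nra.
Qed.

(** The real time bound is rounded up to a natural number that depends on [n] only, since the
    program logic counts in [nat]. The absolute value makes the bound nonnegative without a case
    distinction on [C], and rounding adds at most 1. *)
Lemma matmul_nat_time omega c e C :
  (forall (n : nat) (A B : nat -> nat -> Z), (1 <= n)%nat ->
    exists s t, runs c e (mx_input n A B) s t /\ mx_output n (mx_prod n A B) s /\
      INR t <= C * Rpower (INR n) omega) ->
  exists TB : nat -> nat,
    (forall n A B, (1 <= n)%nat -> exists s t, runs c e (mx_input n A B) s t /\
      mx_output n (mx_prod n A B) s /\ (t <= TB n)%nat) /\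
    (forall n, (1 <= n)%nat -> INR (TB n) <= Rabs C * Rpower (INR n) omega + 1).
Proof.
  intros H. set (f := fun n => Rabs C * Rpower (INR n) omega).
  assert (Pf : forall n, 0 <= f n).
  { intros n. pose proof (Rabs_pos C). pose proof (Rpower_pos (INR n) omega).
    unfold f. nra. }
  exists (fun n => Z.to_nat (up (f n))).
  assert (Pu : forall n, (0 <= up (f n))%Z).
  { intros n. apply le_IZR. pose proof (archimed (f n)). specialize (Pf n). lra. }
  split.
  - intros n A B Ln. destruct (H n A B Ln) as (s & t & Hr & Ho & Ht).
    exists s, t. split; auto. split; auto. apply INR_le.
    rewrite (INR_IZR_INZ (Z.to_nat _)), Z2Nat.id by auto.
    pose proof (archimed (f n)). pose proof (Rle_abs C).
    pose proof (Rpower_pos (INR n) omega). unfold f in *. nra.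
  - intros n _. rewrite INR_IZR_INZ, Z2Nat.id by auto.
    pose proof (archimed (f n)). unfold f in *. lra.
Qed.

Theorem mainTheorem2
  (omega : R) (homega : 2 <= omega < 3) (hmm : matmul_in_time omega)
  (k : nat) (hk : (2 <= k)%nat) :
  exists (c : cmd) (e : nat) (C : R),
    forall (N D1 D2 : nat) (Rs : list binrel),
      (1 <= N)%nat -> (1 <= D1)%nat -> (1 <= D2)%nat ->
      length Rs = k ->
      (forall S, In S Rs -> NoDup S /\ (length S <= N)%nat) ->
      no_dangling Rs ->
      exists (OUT : list (list nat)) (s : state) (t : nat),
        enumerates OUT (star_out Rs) /\
        runs c e (star_input D1 D2 Rs) s t /\
        star_output k OUT s /\
        INR t <= C * (INR N * INR D1 ^ (k - 1)
                      + INR (length OUT) * INR D2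
                      + M omega ((INR N / INR D2) ^ ((k + 1) / 2))
                                (INR N / INR D1)
                                ((INR N / INR D2) ^ (k / 2))).
Proof.
  destruct hmm as (mm & e0 & C0 & Hmm).
  destruct (matmul_nat_time omega mm e0 C0 Hmm) as (TB & HT1 & HT2).
  destruct (star_query_correct k mm e0 TB hk HT1) as (e & He).
  (* The constant of [block_work_le], times [k] because the number of heavy [y] is bounded by
     [k * N / D1]. *)
  set (H := 8 * (2 + Rabs C0) * INR k).
  exists (star_query k mm), e, (INR (total_const k mm) * (1 + H)).
  intros N D1 D2 Rs PN P1 P2 Lk HS _.
  assert (HN : forall S, In S Rs -> NoDup S) by (intros; apply HS; auto).
  destruct (He D1 D2 Rs Lk HN) as (OUT & hx & hy & s & t & HO & Hr & Hs & Nx & Ny & HF & Ht).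
  exists OUT, s, t. split; [exact HO|]. split; [exact Hr|]. split; [exact Hs|].
  destruct (env_exists k Rs hk Lk HN) as (w & B & E).
  assert (Hlen : forall i, (i < k)%nat -> (length (nth i Rs []) <= N)%nat).
  { intros i Li. apply HS. apply nth_In. unfold binrel in *. lia. }
  pose proof (total_cost_le k w B Rs D1 D2 (stride Rs) E OUT hx hy mm TB N PN P1 P2 Hlen HO) as HT.
  destruct (Found_count k w B Rs D1 D2 (stride Rs) E hx hy N Nx Ny HF) as [Cx Cy].
  { intros S HSin. apply HS; auto. }
  assert (PN' : 1 <= INR N) by (apply (le_INR 1); auto).
  assert (P1' : 1 <= INR D1) by (apply (le_INR 1); auto).
  assert (P2' : 1 <= INR D2) by (apply (le_INR 1); auto).
  assert (Pk : 2 <= INR k) by (apply (le_INR 2); auto).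
  assert (QV : 0 < INR N / INR D1) by (apply Rdiv_lt_0_compat; lra).
  assert (QU : 0 < INR N / INR D2) by (apply Rdiv_lt_0_compat; lra).
  pose proof (pow_lt _ ((k + 1) / 2) QU) as PU. pose proof (pow_lt _ (k / 2) QU) as PW.
  set (U := (INR N / INR D2) ^ ((k + 1) / 2)) in *.
  set (V := INR N / INR D1) in *.
  set (W := (INR N / INR D2) ^ (k / 2)) in *.
  pose proof (M_pos omega U V W PU QV PW) as PM.
  assert (PH : 0 <= H).
  { unfold H. pose proof (Rabs_pos C0). nra. }
  (* The columns take what the rows leave: the ceiling and the floor of [k / 2] add up to [k]. *)
  assert (Ek : (k - half k = k / 2)%nat).
  { unfold half. pose proof (Nat.div_mod_eq k 2). pose proof (Nat.div_mod_eq (k + 1) 2).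
    pose proof (Nat.mod_upper_bound k 2 ltac:(lia)).
    pose proof (Nat.mod_upper_bound (k + 1) 2 ltac:(lia)). lia. }
  assert (HW : INR (block_work k hx hy TB) <= H * M omega U V W).
  { destruct (Nat.ltb_spec 0 (bt k hx hy)) as [Pb|Pb].
    2:{ unfold block_work. rewrite (proj2 (Nat.ltb_ge _ _) Pb). apply Rmult_le_pos; lra. }
    etransitivity; [apply (block_work_le k hx hy TB omega (Rabs C0)); auto using Rabs_pos|].
    assert (Pos : (0 < nrow k hx /\ 0 < length hy /\ 0 < ncol k hx)%nat)
      by (unfold bt in Pb; lia).
    destruct Pos as (Pa & Pc & Pd). apply lt_0_INR in Pa, Pc, Pd.
    unfold H. rewrite (Rmult_assoc _ (INR k)).
    apply Rmult_le_compat_l; [pose proof (Rabs_pos C0); lra|].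
    (* The actual dimensions are first raised to their bounds by monotonicity; then the factor [k]
       of the inner dimension is pulled out of [M]. *)
    transitivity (M omega U (INR k * V) W); [|apply M_scale; lra].
    apply M_mono; auto; split; auto.
    - apply INR_prodn_le. intros i Li. apply INR_le_div; auto. apply Cx.
      pose proof (half_le k w B Rs (stride Rs) E). unfold half in *. lia.
    - unfold V. replace (INR k * (INR N / INR D1)) with (INR (k * N) / INR D1) by (rewrite mult_INR; field; lra). apply INR_le_div; auto.
    - unfold W. rewrite <- Ek. apply INR_prodn_le. intros i Li.
      apply INR_le_div; auto. apply Cx. lia. }
  assert (Ht' : (t <= total_const k mm * (N * D1 ^ (k - 1) + length OUT * D2 +
     block_work k hx hy TB))%nat) by lia.
  apply le_INR in Ht'. rewrite mult_INR, !plus_INR, !mult_INR, pow_INR in Ht'.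
  etransitivity; [exact Ht'|]. rewrite Rmult_assoc.
  apply Rmult_le_compat_l; [apply pos_INR|].
  assert (0 <= INR N * INR D1 ^ (k - 1)) by (apply Rmult_le_pos; [lra|apply pow_le; lra]).
  assert (0 <= INR (length OUT) * INR D2) by (apply Rmult_le_pos; [apply pos_INR|lra]).
  nra.
Qed.
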